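(* Let $V$ be a vertex algebra, let $\sigma,\sigma_1,\sigma_2$ be finite-order automorphisms of $V$ and $T$ a positive integer such that $\sigma_1\sigma_2=\sigma_2\sigma_1$, $\sigma=(\sigma_1\sigma_2)^{-1}$, $\sigma_1^T=1=\sigma_2^T$. Let $(W,Y_W)$ be a right $\sigma$-twisted $V$-module and let $z$ be a nonzero complex number. Then for all $u,v\in V$, $$Y_\sigma^L(u,x_1)Y_\sigma^R(v,x_2)=Y_\sigma^R(v,x_2)Y_\sigma^L(u,x_1)$$ on $\mathfrak{D}^{(z)}_{\sigma_1,\sigma_2}(W)$. Furthermore, $\mathfrak{D}^{(z)}_{\sigma_1,\sigma_2}(W)$ is a $\sigma_1\otimes\sigma_2$-twisted $V\otimes V$-module, where the vertex operator map $Y_\sigma^{\rm reg}(\cdot,x)$ is defined by $$Y_\sigma^{\rm reg}(u\otimes v,x)=Y_\sigma^L(u,x)Y_\sigma^R(v,x)\quad\text{for }u,v\in V.$$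
   Context: Formal calculus. Vector spaces are over $\mathbb C$; $\mathbb N=\{0,1,2,\dots\}$; $\delta(x)=\sum_{n\in\mathbb Z}x^n$; $U((x))$ is the space of Laurent series in integer powers of $x$ with only finitely many negative powers, and $U((x^{-1/T}))$ is the space of formal Laurent series in $x^{-1/T}$ (finitely many positive powers of $x^{1/T}$). Complex powers of binomials $(x_1\pm x_2)^\alpha$ are expanded in nonnegative integer powers of the second summand, and $x_2^{-1}\delta\left(\frac{x_1-x_0}{x_2}\right)\left(\frac{x_1-x_0}{x_2}\right)^{\alpha}=\sum_{n\in\mathbb Z}x_2^{-n-1-\alpha}(x_1-x_0)^{n+\alpha}$. For $\xi\in\mathbb C^\times$: $\log\xi=\ln|\xi|+i\arg\xi$ with $0\le\arg\xi<2\pi$, $\xi^\alpha=e^{\alpha\log\xi}$, $(x\pm\xi)^\alpha=\sum_{j\ge0}\binom{\alpha}{j}(\pm\xi)^jx^{\alpha-j}$, $(\xi\pm x)^\alpha=\sum_{j\ge0}\binom{\alpha}{j}\xi^{\alpha-j}(\pm x)^j$. Twisted modules. Let $V$ be a vertex algebra with vertex operator map $Y$ and vacuum ${\bf 1}$, let $\tau$ be an automorphism with $\tau^T=1$, and $V^j=\{v\in V: \tau v=e^{2\pi ij/T}v\}$ for $j\in\mathbb Z$. A $\tau$-twisted $V$-module is a vector space $M$ with a linear map $Y_M(\cdot,x):V\to(\mathrm{End}\,M)[[x^{1/T},x^{-1/T}]]$ such that $Y_M({\bf 1},x)=1$, $Y_M(v,x)w\in x^{-j/T}M((x))$ for $v\in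 V^j$, $w\in M$, and for $u\in V^j$, $v\in V$: $$x_0^{-1}\delta\left(\tfrac{x_1-x_2}{x_0}\right)Y_M(u,x_1)Y_M(v,x_2)-x_0^{-1}\delta\left(\tfrac{x_2-x_1}{-x_0}\right)Y_M(v,x_2)Y_M(u,x_1)=x_2^{-1}\delta\left(\tfrac{x_1-x_0}{x_2}\right)\left(\tfrac{x_1-x_0}{x_2}\right)^{-j/T}Y_M(Y(u,x_0)v,x_2).$$ A right $\tau$-twisted $V$-module is a vector space $W$ with a linear map $Y_W(\cdot,x):V\to(\mathrm{End}\,W)[[x^{1/T},x^{-1/T}]]$ such that $Y_W({\bf 1},x)=1$, $Y_W(v,x)w\in W((x^{-1/T}))$ for $v\in V,w\in W$, and for $u\in V^j$, $v\in V$: $$x_0^{-1}\delta\left(\tfrac{x_1-x_2}{x_0}\right)Y_W(v,x_2)Y_W(u,x_1)-x_0^{-1}\delta\left(\tfrac{x_2-x_1}{-x_0}\right)Y_W(u,x_1)Y_W(v,x_2)=x_2^{-1}\delta\left(\tfrac{x_1-x_0}{x_2}\right)\left(\tfrac{x_1-x_0}{x_2}\right)^{j/T}Y_W(Y(u,x_0)v,x_2).$$ The space $\mathfrak D$ and its operators. For $j_1,j_2\in\mathbb Z$ put $V^{(j_1,j_2)}=\{v\in V:\sigma_r(v)=e^{2\pi ij_r/T}v,\ r=1,2\}$; $V$ is the sum of these subspaces. Define $Y_W^*(v,x)\in(\mathrm{End}\,W^* )[[x^{1/T},x^{-1/T}]]$ on the full dual $W^*$ by $\langle Y_W^*(v,x)f,w\rangle=\langle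 f,Y_W(v,x)w\rangle$, and $Y_W^*(v,x+z)\alpha=e^{z\frac{d}{dx}}Y_W^*(v,x)\alpha$. $\mathfrak D^{(z)}_{\sigma_1,\sigma_2}(W)$ is the set of all $\alpha\in W^*$ such that for every $v\in V^{(j_1,j_2)}$, $j_1,j_2\in\mathbb Z$, there is $k\in\mathbb N$ with $$x^{j_2/T}(x-z)^{k+j_1/T}Y_W^*(v,x)\alpha\in W^*((x)).\qquad( * )$$ For $\alpha\in\mathfrak D^{(z)}_{\sigma_1,\sigma_2}(W)$ and $v\in V^{(j_1,j_2)}$ define (extending linearly in $v$) $$Y_\sigma^R(v,x)\alpha=e^{-(k+j_1/T)\pi i}(z-x)^{-k-j_1/T}\left[(x-z)^{k+j_1/T}Y_W^*(v,x)\alpha\right]$$ for any $k\in\mathbb N$ satisfying $( * )$, and $$Y_\sigma^L(v,x)\alpha=(z+x)^{-l-j_2/T}\left[(x+z)^{l+j_2/T}Y_W^*(v,x+z)\alpha\right]$$ for any $l\in\mathbb N$ with $x^{j_1/T}(x+z)^{l+j_2/T}Y_W^*(v,x+z)\alpha\in W^*((x))$. Such $l$ exist; these definitions do not depend on the choices of $k,l$ and the coefficients of the resulting series lie in $\mathfrak D^{(z)}_{\sigma_1,\sigma_2}(W)$. *)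

(* Defs.v *)
From HB Require Import structures.
From mathcomp Require Import all_boot all_order all_algebra.
From mathcomp Require Import complex.
From mathcomp Require Import all_classical all_reals all_analysis.
From mathcomp Require Import ring lra.

Set Implicit Arguments.
Unset Strict Implicit.
Unset Printing Implicit Defensive.

Import Order.TTheory GRing.Theory Num.Theory.

Local Open Scope classical_set_scope.
Local Open Scope ring_scope.
Local Open Scope complex_scope.

(* Conventions.  The complex numbers are R[i] for a realType R.  A formal
   series in rational powers of x is the function sending e to the coefficient
   of x^e (not of x^(-e-1)).  Infinite sums [\sum_(i \in setT) F i] are those
   of fsbigop; wherever they are used below, at most finitely many terms are
   nonzero (fsbigop returns 0 otherwise). *)

Section ComplexFunctions.
Variable R : realType.
Local Notation C := R[i].

Definition cexp (a : C) : C :=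
  (expR (complex.Re a))%:C * (cos (complex.Im a) +i* sin (complex.Im a)).

(* the argument in [0, 2 pi[; only meaningful for a nonzero complex number *)
Definition carg (a : C) : R :=
  xget 0 [set t : R | 0 <= t < 2 * pi /\ a = `|a| * cexp (0 +i* t)].

Definition clog (a : C) : C := ln (complex.Re `|a|) +i* carg a.

Definition cpow (a b : C) : C := cexp (b * clog a).

Definition cbin (a : C) (i : nat) : C :=
  (\prod_(k < i) (a - k%:R)) / i`!%:R.

(* e^(2 pi i j / T) *)
Definition eT (T : nat) (j : int) : C := cexp (0 +i* (2 * pi * j%:~R / T%:R)).

End ComplexFunctions.

Section Series.

(* multiplication by x^a *)
Definition mulX (U : Type) (a : rat) (f : rat -> U) : rat -> U :=
  fun e => f (e - a).

(* f \in U((x)) *)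
Definition laurent (U : zmodType) (f : rat -> U) : Prop :=
  exists N : int, forall e, f e <> 0 -> e \is a Num.int /\ N%:~R <= e.

Variables (R : realType) (W : Type).
Local Notation C := R[i].

(* The series below have coefficients in the functions W -> C; infinite sums
   of such coefficients are evaluated at each w in W. *)
Implicit Type f : rat -> W -> C^o.

(* (x + c)^a f(x), with (x + c)^a = sum_i binom(a, i) c^i x^(a - i) *)
Definition mul_x_plus (c : C) (a : rat) f : rat -> W -> C^o := fun e w =>
  \sum_(i \in [set: nat]) cbin (ratr a) i * c ^+ i * f (e - (a - i%:R)) w.

(* (c + s x)^a f(x),
   with (c + s x)^a = sum_i binom(a, i) c^(a - i) (s x)^i; used for s = 1, -1 *)
Definition mul_plus_x (c s : C) (a : rat) f : rat -> W -> C^o := fun e w =>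
  \sum_(i \in [set: nat])
     cbin (ratr a) i * cpow c (ratr a - i%:R) * s ^+ i * f (e - i%:R) w.

Definition ddx f : rat -> W -> C^o := fun e w => ratr (e + 1) * f (e + 1) w.

(* e^(c d/dx) f(x) *)
Definition exp_ddx (c : C) f : rat -> W -> C^o := fun e w =>
  \sum_(i \in [set: nat]) c ^+ i / i`!%:R * iter i ddx f e w.

End Series.

(* Closure of D under linear combinations needs that (x + c)^(a + 1) f and
   (x + c) ((x + c)^a f) agree, so that k can be increased. *)
Section SeriesLemmas.
Variables (R : realType) (W : Type).
Local Notation C := R[i].
Implicit Type f : rat -> W -> C^o.

Definition bounded_above f := forall w, exists N : rat, forall e, N < e ->
  f e w = 0.

Lemma fsum_nat (F : nat -> C) n : (forall i, (n <= i)%N -> F i = 0) ->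
  \sum_(i \in [set: nat]) F i = \sum_(i < n) F i.
Proof.
move=> F0; rewrite (fsbig_ord _ _ F); apply/esym/fsbig_widen => // i [_ /= ni].
by rewrite F0 // leqNgt; apply/negP.
Qed.

Lemma cbinS (a : C) i : cbin (a + 1) i.+1 = cbin a i.+1 + cbin a i.
Proof.
rewrite /cbin big_ord_recl /= subr0.
have -> : \prod_(k < i) (a + 1 - (bump 0 k)%:R) = \prod_(k < i) (a - k%:R).
  by apply: eq_bigr => k _; rewrite /bump /= add1n -natr1; ring.
rewrite big_ord_recr /= factS natrM.
have i0 : i`!%:R != 0 :> C by rewrite pnatr_eq0 -lt0n fact_gt0.
have i1 : i.+1%:R != 0 :> C by rewrite pnatr_eq0.
move: i1; rewrite -natr1 => i1; field; by rewrite i0 i1.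
Qed.

Lemma mul_x_plus_bound f (a e : rat) w : bounded_above f ->
  exists n, forall i, (n <= i)%N -> f (e - (a - i%:R)) w = 0.
Proof.
move=> /(_ w)[N fN]; exists (Num.bound (N - e + a)) => i ni.
apply: fN.
have [ge0|lt0] := leP 0 (N - e + a).
  have := archi_boundP ge0.
  have : (Num.bound (N - e + a))%:R <= i%:R :> rat by rewrite ler_nat.
  by move=> *; lra.
by have := ler0n rat i; move=> *; lra.
Qed.

Lemma mul_x_plusS c a f : bounded_above f -> forall e w,
  mul_x_plus c (a + 1) f e w =
    mul_x_plus c a f (e - 1) w + c * mul_x_plus c a f e w.
Proof.
move=> fb e w; rewrite /mul_x_plus.
have [n fn] := mul_x_plus_bound (a + 1) e w fb.
rewrite (@fsum_nat _ n.+1); last first.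
  by move=> i /ltnW ni; rewrite fn ?mulr0.
rewrite (@fsum_nat _ n.+1); last first.
  move=> i /ltnW ni; have -> : e - 1 - (a - i%:R) = e - (a + 1 - i%:R) by ring.
  by rewrite fn ?mulr0.
rewrite (@fsum_nat _ n); last first.
  move=> i ni.
  have -> : e - (a - i%:R) = e - (a + 1 - i.+1%:R) by rewrite -natr1; ring.
  by rewrite fn ?mulr0 // (leq_trans ni).
rewrite !big_ord_recl /= mulr_sumr -[RHS]addrA -big_split /=.
congr (_ + _).
  rewrite /cbin !big_ord0; congr (_ * f _ w); ring.
apply: eq_bigr => i _; rewrite /bump /= !add1n rmorphD rmorph1 cbinS.
have -> : e - 1 - (a - i.+1%:R) = e - (a + 1 - i.+1%:R) by ring.
have -> : e - (a - i%:R) = e - (a + 1 - i.+1%:R) by rewrite -natr1; ring.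
by rewrite exprS; ring.
Qed.

Lemma mul_x_plus_linear c a f g (l : C) :
  bounded_above f -> bounded_above g -> forall e,
  mul_x_plus c a (fun e w => l * f e w + g e w) e =
    l *: mul_x_plus c a f e + mul_x_plus c a g e :> (W -> C^o).
Proof.
move=> fb gb e; apply/funext => w.
have [n fn] := mul_x_plus_bound a e w fb.
have [m gm] := mul_x_plus_bound a e w gb.
rewrite /mul_x_plus /= !fctE.
rewrite !(@fsum_nat _ (maxn n m)); first last.
- by move=> i; rewrite geq_max => /andP[ni mi]; rewrite fn ?gm ?mulr0 ?addr0 ?mulr0.
- by move=> i; rewrite geq_max => /andP[ni mi]; rewrite fn ?mulr0.
- by move=> i; rewrite geq_max => /andP[ni mi]; rewrite gm ?mulr0.
rewrite -[_ *: _]/(_ * _) mulr_sumr -big_split /=; apply: eq_bigr => i _; ring.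
Qed.

End SeriesLemmas.

Section VertexAlgebra.
Variable R : realType.
Local Notation C := R[i].

(* [va_Y u n] is the coefficient of x^n in Y(u, x), that is u_(-n-1).  The
   Jacobi identity is the equality of the coefficients of
   x0^(-n-1) x1^b x2^c in
     x0^-1 delta((x1-x2)/x0) Y(u,x1)Y(v,x2)w
       - x0^-1 delta((x2-x1)/(-x0)) Y(v,x2)Y(u,x1)w
     = x2^-1 delta((x1-x0)/x2) Y(Y(u,x0)v,x2)w.  *)
Record vertex_algebra (V : lmodType C) := VertexAlgebra {
  va_Y :> V -> int -> {linear V -> V};
  vacuum : V;
  va_linear : forall n w, linear (fun v => va_Y v n w);
  va_truncation : forall u v,
    exists N : int, forall n, n < N -> va_Y u n v = 0;
  va_vacuum : forall n v, va_Y vacuum n v = if n == 0 then v else 0;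
  va_creation : forall v,
    va_Y v 0 vacuum = v /\ forall n, n < 0 -> va_Y v n vacuum = 0;
  va_jacobi : forall (u v w : V) (n b c : int),
    \sum_(i \in [set: nat]) ((-1) ^+ i * cbin n%:~R i : C) *:
       va_Y u (b - (n - i%:Z)) (va_Y v (c - i%:Z) w)
    - \sum_(i \in [set: nat]) ((-1) ^ n * (-1) ^+ i * cbin n%:~R i : C) *:
       va_Y v (c - (n - i%:Z)) (va_Y u (b - i%:Z) w)
    = \sum_(i \in [set: nat]) ((-1) ^+ i * cbin (b + i%:Z)%:~R i : C) *:
       va_Y (va_Y u (- n - 1 - i%:Z) v) (b + c + 1 + i%:Z) w
}.

Record va_aut (V : lmodType C) (A : vertex_algebra V) := VaAut {
  va_aut_fun :> {linear V -> V};
  va_aut_bij : bijective va_aut_fun;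
  va_aut_vacuum : va_aut_fun (vacuum A) = vacuum A;
  va_aut_Y : forall u n v,
    va_aut_fun (A u n v) = A (va_aut_fun u) n (va_aut_fun v)
}.

(* V^j with respect to tau *)
Definition in_eigenspace (V : lmodType C) (T : nat) (tau : V -> V) (j : int)
  (v : V) : Prop := tau v = eT R T j *: v.

Section TwistedModules.
Variables (V : lmodType C) (A : vertex_algebra V) (tau : va_aut A) (T : nat).

(* Coefficient of x0^(-n-1) x1^b x2^c in
   x2^-1 delta((x1-x0)/x2) ((x1-x0)/x2)^a Y_M(Y(u,x0)v,x2)w
   = sum_(r in a + Z) x2^(-r-1) (x1-x0)^r Y_M(Y(u,x0)v,x2)w,
   to which only the terms with r = b + i contribute. *)
Definition jacobi_rhs (M : lmodType C) (Y : V -> rat -> M -> M) (a : rat)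
    (u v : V) (w : M) (n : int) (b c : rat) : M :=
  if b - a \is a Num.int then
    \sum_(i \in [set: nat]) ((-1) ^+ i * cbin (ratr (b + i%:R)) i : C) *:
       Y (A u (- n - 1 - i%:Z) v) (b + c + 1 + i%:R) w
  else 0.

(* [tw_Y v e] is the coefficient of x^e in Y_M(v, x). *)
Record twisted_module (M : lmodType C) := TwistedModule {
  tw_Y :> V -> rat -> {linear M -> M};
  tw_period : iter T tau =1 id;
  tw_linear : forall e w, linear (fun v => tw_Y v e w);
  tw_support : forall v e w, T%:R * e \isn't a Num.int -> tw_Y v e w = 0;
  tw_vacuum : forall e w, tw_Y (vacuum A) e w = if e == 0 then w else 0;
  tw_truncation : forall j v w, in_eigenspace T tau j v ->
    laurent (mulX (j%:~R / T%:R) (fun e => tw_Y v e w));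
  tw_jacobi : forall j u v w (n : int) (b c : rat), in_eigenspace T tau j u ->
    \sum_(i \in [set: nat]) ((-1) ^+ i * cbin n%:~R i : C) *:
       tw_Y u (b - (n%:~R - i%:R)) (tw_Y v (c - i%:R) w)
    - \sum_(i \in [set: nat]) ((-1) ^ n * (-1) ^+ i * cbin n%:~R i : C) *:
       tw_Y v (c - (n%:~R - i%:R)) (tw_Y u (b - i%:R) w)
    = jacobi_rhs tw_Y (- (j%:~R / T%:R)) u v w n b c
}.

Record right_twisted_module (W : lmodType C) := RightTwistedModule {
  rtw_Y :> V -> rat -> {linear W -> W};
  rtw_period : iter T tau =1 id;
  rtw_linear : forall e w, linear (fun v => rtw_Y v e w);
  rtw_support : forall v e w, T%:R * e \isn't a Num.int -> rtw_Y v e w = 0;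
  rtw_vacuum : forall e w, rtw_Y (vacuum A) e w = if e == 0 then w else 0;
  rtw_truncation : forall v w,
    exists N : rat, forall e, N < e -> rtw_Y v e w = 0;
  rtw_jacobi : forall j u v w (n : int) (b c : rat), in_eigenspace T tau j u ->
    \sum_(i \in [set: nat]) ((-1) ^+ i * cbin n%:~R i : C) *:
       rtw_Y v (c - i%:R) (rtw_Y u (b - (n%:~R - i%:R)) w)
    - \sum_(i \in [set: nat]) ((-1) ^ n * (-1) ^+ i * cbin n%:~R i : C) *:
       rtw_Y u (b - i%:R) (rtw_Y v (c - (n%:~R - i%:R)) w)
    = jacobi_rhs rtw_Y (j%:~R / T%:R) u v w n b c
}.

End TwistedModules.

(* MathComp has no tensor product of infinite-dimensional spaces, so it is
   given by its universal property. *)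
Definition is_tensor_product (U V P : lmodType C)
    (t : {bilinear U -> V -> P}) : Prop :=
  forall (X : lmodType C) (f : {bilinear U -> V -> X}),
    exists g : {linear P -> X}, (forall u v, g (t u v) = f u v) /\
      forall g' : {linear P -> X}, (forall u v, g' (t u v) = f u v) -> g' =1 g.

(* B is the tensor product vertex algebra of A1 and A2: vacuum 1 (x) 1 and
   Y(u (x) v, x) = Y(u, x) (x) Y(v, x). *)
Record is_tensor_va (V1 V2 P : lmodType C) (A1 : vertex_algebra V1)
    (A2 : vertex_algebra V2) (B : vertex_algebra P)
    (t : {bilinear V1 -> V2 -> P}) : Prop := IsTensorVa {
  tva_tensor : is_tensor_product t;
  tva_vacuum : vacuum B = t (vacuum A1) (vacuum A2);
  tva_Y : forall u v u' v' n,
    B (t u v) n (t u' v') =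
      \sum_(m \in [set: int]) t (A1 u m u') (A2 v (n - m) v')
}.

End VertexAlgebra.

Section RegularSpace.
Variables (R : realType) (V : lmodType R[i]) (A : vertex_algebra V).
Variables (T : nat) (sigma sigma1 sigma2 : va_aut A) (W : lmodType R[i]).
Variables (YW : right_twisted_module sigma T W) (z : R[i]).
Local Notation C := R[i].

(* V^(j1, j2) *)
Definition in_bigraded (j1 j2 : int) (v : V) : Prop :=
  in_eigenspace T sigma1 j1 v /\ in_eigenspace T sigma2 j2 v.

(* Y_W^*(v, x) f *)
Definition Ystar (v : V) (f : W -> C^o) : rat -> W -> C^o :=
  fun e w => f (YW v e w).

(* (x - z)^(k + j1/T) Y_W^*(v, x) f *)
Definition R_regularized (j1 : int) (k : nat) (v : V) (f : W -> C^o) :=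
  mul_x_plus (- z) (k%:R + j1%:~R / T%:R) (Ystar v f).

(* (x + z)^(l + j2/T) Y_W^*(v, x + z) f *)
Definition L_regularized (j2 : int) (l : nat) (v : V) (f : W -> C^o) :=
  mul_x_plus z (l%:R + j2%:~R / T%:R) (exp_ddx z (Ystar v f)).

Definition R_admissible j1 j2 k v f : Prop :=
  laurent (mulX (j2%:~R / T%:R) (R_regularized j1 k v f)).

Definition L_admissible j1 j2 l v f : Prop :=
  laurent (mulX (j1%:~R / T%:R) (L_regularized j2 l v f)).

Definition frakD_pred : {pred W -> C^o} := fun f =>
  `[< scalar f /\ forall j1 j2 v, in_bigraded j1 j2 v ->
        exists k, R_admissible j1 j2 k v f >].

Record frakD := FrakD { frakD_val :> W -> C^o; _ : frakD_val \in frakD_pred }.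

HB.instance Definition _ := [isSub for frakD_val].
HB.instance Definition _ := [Choice of frakD by <:].

Lemma Ystar_bounded v f : scalar f -> bounded_above (Ystar v f).
Proof.
move=> fl w; have [N YN] := rtw_truncation YW v w; exists N => e Ne.
by rewrite /Ystar YN //; have := fl (-1) 0 0; rewrite scaler0 addr0 mulN1r addNr.
Qed.

Lemma R_admissibleD j1 j2 v f k m : scalar f ->
  R_admissible j1 j2 k v f -> R_admissible j1 j2 (m + k) v f.
Proof.
move=> fl; elim: m => // m IH /IH [N FN].
exists N => e; rewrite /mulX /R_regularized addSn -natr1 -addrA [1 + _]addrC.
rewrite addrA => ne0.
set e' := e - _ in ne0.
set F := mul_x_plus (- z) ((m + k)%:R + j1%:~R / T%:R) (Ystar v f).
have [F1|F1] := pselect (F e' = 0); last exact: FN.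
have [F2|F2] := pselect (F (e' - 1) = 0).
  exfalso; apply: ne0; apply/funext => w; rewrite mul_x_plusS.
    by rewrite -/F F1 F2 mulr0 addr0.
  exact: Ystar_bounded.
have [|e1 Ne] := FN (e - 1).
  by move: F2; rewrite /mulX /e' addrAC.
split; first by rewrite -(subrK 1 e) rpredD.
by apply: le_trans Ne _; rewrite gerBl.
Qed.

Lemma frakD_submod : submod_closed (frakD_pred).
Proof.
split.
  apply/asboolP; split=> [a x y|j1 j2 v _].
    by rewrite [RHS]addr0 [RHS]mulr0.
  exists 0%N, 0 => e; case.
  apply/funext => w.
  rewrite /mulX /R_regularized /mul_x_plus (@fsum_nat _ _ 0) ?big_ord0 //.
  by move=> i _; rewrite /Ystar mulr0.
move=> a f g /asboolP[fl fD] /asboolP[gl gD]; apply/asboolP; split.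
  by move=> b x y; rewrite !fctE fl gl -![_ *: _]/(_ * _); ring.
move=> j1 j2 v vj; have [k fk] := fD j1 j2 v vj; have [l gl'] := gD j1 j2 v vj.
have [N FN] := R_admissibleD l fl fk.
have [M GM] := R_admissibleD k gl gl'; rewrite addnC in GM.
exists (l + k)%N, (Num.min N M) => e; rewrite /mulX.
set e' := e - _; rewrite /R_regularized.
have -> : Ystar v (a *: f + g) =
    (fun e w => a * Ystar v f e w + Ystar v g e w) by [].
rewrite mul_x_plus_linear; [|exact: Ystar_bounded..] => ne0.
have minN : (Num.min N M)%:~R <= N%:~R :> rat by rewrite ler_int ge_min lexx.
have minM : (Num.min N M)%:~R <= M%:~R :> rat
  by rewrite ler_int ge_min lexx orbT.
have [F0|F0] := pselect (R_regularized j1 (l + k) v f e' = 0); last first.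
  by have [eint Ne] := FN _ F0; split=> //; exact: le_trans Ne.
have [G0|G0] := pselect (R_regularized j1 (l + k) v g e' = 0); last first.
  by have [eint Ne] := GM _ G0; split=> //; exact: le_trans Ne.
by exfalso; apply: ne0; rewrite [X in _ *: X]F0 [X in _ + X]G0 scaler0 addr0.
Qed.

HB.instance Definition _ :=
  GRing.isSubmodClosed.Build C (W -> C^o) frakD_pred frakD_submod.
HB.instance Definition _ := [SubChoice_isSubLmodule of frakD by <:].

(* Y_sigma^R(v, x) and Y_sigma^L(v, x) are the maps, linear in v, given on
   homogeneous v by the formulas below for all admissible exponents. *)
Definition is_YR (F : V -> rat -> frakD -> frakD) : Prop :=
  (forall e f, linear (fun v => F v e f)) /\
  forall j1 j2 v (f : frakD) k,
    in_bigraded j1 j2 v -> R_admissible j1 j2 k v f ->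
    let a : rat := k%:R + j1%:~R / T%:R in
    forall e w, F v e f w =
      cexp (- ratr a * (0 +i* pi)) *
        mul_plus_x z (-1) (- a) (R_regularized j1 k v f) e w.

Definition is_YL (F : V -> rat -> frakD -> frakD) : Prop :=
  (forall e f, linear (fun v => F v e f)) /\
  forall j1 j2 v (f : frakD) l,
    in_bigraded j1 j2 v -> L_admissible j1 j2 l v f ->
    let a : rat := l%:R + j2%:~R / T%:R in
    forall e w, F v e f w = mul_plus_x z 1 (- a) (L_regularized j2 l v f) e w.

Definition YR : V -> rat -> frakD -> frakD :=
  xget (fun _ _ _ => 0) [set F | is_YR F].

Definition YL : V -> rat -> frakD -> frakD :=
  xget (fun _ _ _ => 0) [set F | is_YL F].

End RegularSpace.

(* Main.v *)
(* For v of degree (j1, j2), f in D and w in W, the series f(Y_W(v, x) w) is the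
   expansion at x = infinity of x^(-j2/T) (x - z)^(-j1/T) times a rational
   function with poles at 0 and z only; Y^R and Y^L are its expansions at 0 and
   at z. Two such expansions are compared after multiplication by a large power
   of the linear form, which is the relation [reg]; a truncated series is
   determined by its regularization.

   The Jacobi identity amounts to locality, (x1 - x2)^m [Y(u, x1), Y(v, x2)] = 0,
   together with the iterate formula: x0^m Y(Y(u, x0) v, x2) is the Taylor
   expansion of (x1 - x2)^m Y(u, x1) Y(v, x2) at x1 = x2 + x0. Both are
   equalities of series after multiplication by polynomials, so they pass from
   Y_W to its dual and from there to Y^R. The translation x -> x + z preserves
   them and exchanges the two poles, so the same argument gives Y^L.

   Y^L(u, x1) Y^R(v, x2) and the opposite product become equal once multiplied by
   the powers of the linear forms and by (x1 + z - x2)^m, and all these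
   multiplications are injective on series in nonnegative powers.

   For the tensor product, locality and the iterate formula of Y^L and Y^R are
   multiplied, as identities between series in four variables in which
   x1 = y1 and x2 = y2 are set afterwards. *)

Require Import Defs.
From HB Require Import structures.
From mathcomp Require Import all_boot all_order all_algebra.
From mathcomp Require Import complex.
From mathcomp Require Import all_classical all_reals all_analysis.
From mathcomp Require Import ring lra zify.

Set Implicit Arguments.
Unset Strict Implicit.
Unset Printing Implicit Defensive.

Import Order.TTheory GRing.Theory Num.Theory.

Local Open Scope classical_set_scope.
Local Open Scope ring_scope.
Local Open Scope complex_scope.

(** * Finitely supported sums *)

(** Both operators are instances of one construction. A character [chi] of the rationals stands for
    a branch of all powers of [chi 1]: with [chi 1 = z] it yields Y^L, and with the additional phase
    e^(pi i a), for which [chi 1 = - z], it yields Y^R and absorbs the scalar in its definition. The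
    recurring obstacle is uniformity of pole orders: the space supplies an exponent k for each
    vector and each functional, while a product involves infinitely many coefficients. On one side
    locality makes k independent of the coefficient. Between the two sides no uniform k is used;
    finitely many coefficients are treated at a time and the additional factors are cancelled
    afterwards. Degrees are determined modulo T only, so pole exponents must be allowed to change by
    integers. An infinite sum is 0 unless finitely supported, hence every interchange of sums comes
    with a finite box that contains the support. *)

Definition fin (I : choiceType) (X : nmodType) (F : I -> X) :=
  exists s : seq I, forall i, i \notin s -> F i = 0.

Notation fsum F := (\sum_(i \in [set: _]) F i).

Lemma funext2 (X Y Z : Type) (F G : X -> Y -> Z) : (forall x y, F x y = G x y) -> F = G.
Proof. by move=> FG; apply/funext => x; apply/funext => y. Qed.

Section FiniteSums.
Variables (I : choiceType) (X : nmodType).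
Implicit Types F G : I -> X.

Lemma fsum_seq (s : seq I) F : uniq s -> (forall i, i \notin s -> F i = 0) ->
  fsum F = \sum_(i <- s) F i.
Proof.
move=> us Fs; rewrite (fsbigE s) //; last by move=> i _; exact: Fs.
by apply: eq_bigl => i; rewrite in_setT.
Qed.

Lemma eq_fsum F G : F =1 G -> fsum F = fsum G.
Proof. by move=> FG; apply: eq_fsbigr => i _; apply: FG. Qed.

Lemma fsum0 F : (forall i, F i = 0) -> fsum F = 0.
Proof. by move=> F0; apply: fsbig1. Qed.

Lemma fsum1 i0 F : (forall i, i <> i0 -> F i = 0) -> fsum F = F i0.
Proof.
move=> F0; rewrite (@fsum_seq [:: i0]) ?big_seq1 // => i.
by rewrite inE => /eqP; apply: F0.
Qed.

Lemma out_support (s : seq I) F : (forall i, F i <> 0 -> i \in s) ->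
  forall i, i \notin s -> F i = 0.
Proof. by move=> Fs i /negP si; apply: contrapT => /Fs. Qed.

Lemma finN0 F : (exists s : seq I, forall i, F i <> 0 -> i \in s) -> fin F.
Proof.
by move=> [s Fs]; exists s; apply: out_support.
Qed.

Lemma fin_finite F : fin F -> finite_set [set i | F i <> 0].
Proof.
move=> [s Fs]; apply: ((@sub_finite_set _ _ _ _ (finite_seq s))).
by move=> i /= F0; apply: contrapT => /negP/Fs/F0.
Qed.

Lemma finite_fin F : finite_set [set i | F i <> 0] -> fin F.
Proof.
move=> /finite_seqP[s Es]; exists s; apply: out_support => i F0.
by have : [set i | F i <> 0] i by []; rewrite Es.
Qed.

Lemma fsum_dflt F : ~ fin F -> fsum F = 0.
Proof. by move=> nF; apply: fsbig_dflt; rewrite setTI => /finite_fin. Qed.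

(** Since [h] is injective, each point of the finite list supporting [G] has at most one
    preimage. *)
Lemma fin_sub (J : choiceType) (Y : nmodType) F (h : I -> J) (G : J -> Y) :
  injective h -> (forall i, F i <> 0 -> G (h i) <> 0) -> fin G -> fin F.
Proof.
move=> hi FG [s Gs].
have [s' Hs'] : exists s' : seq I, forall i, h i \in s -> i \in s'.
  elim: s {Gs} => [|j s [s' IH]]; first by exists [::].
  have [[i <-]|nh] := pselect (exists i, h i = j).
    exists (i :: s') => k; rewrite !inE => /orP[/eqP/hi->|/IH->];
      by rewrite ?eqxx ?orbT.
  exists s' => k; rewrite inE => /orP[/eqP e|/IH//].
  by case: nh; exists k.
exists s'; apply: out_support => i /FG G0; apply: Hs'.
by apply: contrapT => /negP/Gs/G0.
Qed.

Lemma finD F G : fin F -> fin G -> fin (fun i => F i + G i).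
Proof.
move=> [s Fs] [t Gt]; exists (s ++ t) => i; rewrite mem_cat negb_or.
by case/andP => /Fs-> /Gt->; rewrite addr0.
Qed.

Lemma fin_split F G : fin F -> fin G ->
  exists s : seq I, [/\ uniq s, forall i, i \notin s -> F i = 0 &
                       forall i, i \notin s -> G i = 0].
Proof.
move=> [s Fs] [t Gt]; exists (undup (s ++ t)); split.
- exact: undup_uniq.
- by move=> i; rewrite mem_undup mem_cat negb_or => /andP[/Fs].
- by move=> i; rewrite mem_undup mem_cat negb_or => /andP[_ /Gt].
Qed.

Lemma fsumD F G : fin F -> fin G -> fsum (fun i => F i + G i) = fsum F + fsum G.
Proof.
move=> Ff Gf; have [s [us Fs Gs]] := fin_split Ff Gf.
rewrite !(@fsum_seq s) ?big_split // => i si.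
by rewrite Fs ?Gs ?addr0.
Qed.

Lemma fsum_morph (Y : nmodType) (h : X -> Y) F :
  h 0 = 0 -> {morph h : x y / x + y} -> fin F ->
  h (fsum F) = fsum (fun i => h (F i)).
Proof.
move=> h0 hD Ff; have [s [us Fs _]] := fin_split Ff Ff.
rewrite (@fsum_seq s) // (big_morph h hD h0) [RHS](fsbigE s) //=.
  by apply: eq_bigl => i; rewrite in_setT.
by move=> i _ /Fs->.
Qed.

Lemma fin_sum (J : Type) (r : seq J) (F : J -> I -> X) :
  (forall j, fin (F j)) -> fin (fun i => \sum_(j <- r) F j i).
Proof.
move=> Ff; elim: r => [|j r IH]; first by exists [::] => i _; rewrite big_nil.
have [s Hs] := finD (Ff j) IH; exists s => i /Hs; by rewrite big_cons.
Qed.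

Lemma fsum_sum (J : Type) (r : seq J) (F : J -> I -> X) :
  (forall j, fin (F j)) ->
  fsum (fun i => \sum_(j <- r) F j i) = \sum_(j <- r) fsum (F j).
Proof.
move=> Ff; elim: r => [|j r IH].
  by rewrite big_nil fsum0 // => i; rewrite big_nil.
rewrite big_cons -IH -fsumD //; last exact: fin_sum.
by apply: eq_fsum => i; rewrite big_cons.
Qed.

End FiniteSums.

(** A common finite box is demanded because finite rows and finite columns alone do not allow the
    interchange, as a telescoping array shows. *)
Lemma fsum_exch (I J : choiceType) (X : nmodType) (F : I -> J -> X)
    (s : seq I) (t : seq J) :
  (forall i j, F i j <> 0 -> i \in s /\ j \in t) ->
  fsum (fun i => fsum (fun j => F i j)) = fsum (fun j => fsum (fun i => F i j)).
Proof.
move=> Fst.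
have Fs i j : i \notin undup s -> F i j = 0.
  by apply: (@out_support _ _ (undup s) (F^~ j)) => k /Fst[]; rewrite mem_undup.
have Ft i j : j \notin undup t -> F i j = 0.
  by apply: (@out_support _ _ (undup t) (F i)) => k /Fst[]; rewrite mem_undup.
rewrite (@fsum_seq _ _ (undup s)) ?undup_uniq //; last first.
  by move=> i si; rewrite fsum0 // => j; apply: Fs.
rewrite [RHS](@fsum_seq _ _ (undup t)) ?undup_uniq //; last first.
  by move=> j tj; rewrite fsum0 // => i; apply: Ft.
under eq_bigr => i _.
  rewrite (@fsum_seq _ _ (undup t)) ?undup_uniq; [over|by []|by move=> j /Ft].
under [RHS]eq_bigr => j _.
  rewrite (@fsum_seq _ _ (undup s)) ?undup_uniq; [over|by []|by move=> i /Fs].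
exact: exchange_big.
Qed.

Section ScaledSums.
Variables (K : pzRingType) (I : choiceType) (X : lmodType K).
Implicit Types F G : I -> X.

Lemma fsumZ (a : K) F : fin F -> fsum (fun i => a *: F i) = a *: fsum F.
Proof.
move=> Ff; rewrite (@fsum_morph _ _ _ ( *:%R a)) ?scaler0 //.
by move=> x y; rewrite scalerDr.
Qed.

Lemma finZ (a : I -> K) F : fin F -> fin (fun i => a i *: F i).
Proof. by move=> [s Fs]; exists s => i /Fs ->; rewrite scaler0. Qed.

Lemma finN F : fin F -> fin (fun i => - F i).
Proof. by move=> [s Fs]; exists s => i /Fs ->; rewrite oppr0. Qed.

Lemma fsumN F : fin F -> fsum (fun i => - F i) = - fsum F.
Proof.
move=> Ff; rewrite (@fsum_morph _ _ _ (@GRing.opp _)) ?oppr0 //.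
by move=> x y; rewrite opprD.
Qed.

Lemma fsumB F G : fin F -> fin G -> fsum (fun i => F i - G i) = fsum F - fsum G.
Proof. by move=> Ff Gf; rewrite fsumD ?fsumN //; apply: finN. Qed.

End ScaledSums.

Section NatSums.
Variables (X : nmodType).
Implicit Types F G : nat -> X.

Lemma fin_nat F n : (forall i, (n <= i)%N -> F i = 0) -> fin F.
Proof.
move=> F0; exists (iota 0 n) => i; rewrite mem_iota add0n leq0n /= -leqNgt.
exact: F0.
Qed.

Lemma fsum_ord F n : (forall i, (n <= i)%N -> F i = 0) ->
  fsum F = \sum_(i < n) F i.
Proof.
move=> F0; rewrite (@fsum_seq _ _ (iota 0 n)) ?iota_uniq //; last first.
  by move=> i; rewrite mem_iota add0n leq0n /= -leqNgt; apply: F0.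
by rewrite -(big_mkord xpredT) /index_iota subn0.
Qed.

Lemma natfin F : fin F -> exists n, forall i, (n <= i)%N -> F i = 0.
Proof.
move=> [s Fs]; exists (\max_(i <- s) i).+1 => i ni; apply: Fs.
apply/negP => si; move: ni; rewrite ltnNge.
by rewrite (big_rem i) //= leq_maxl.
Qed.

Lemma fsum_shiftn n F : (forall i, (i < n)%N -> F i = 0) -> fin F ->
  fsum F = fsum (fun i => F (n + i)%N).
Proof.
move=> F0 /natfin[m Fm].
rewrite (@fsum_ord _ (n + m)); last first.
  by move=> i; move/(leq_trans (leq_addl n m)); apply: Fm.
rewrite (@fsum_ord _ m); last by move=> i mi; rewrite Fm // (leq_trans mi) // leq_addl.
rewrite big_split_ord /= big1 ?add0r // => i _; exact: F0.
Qed.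

End NatSums.

Section RatSums.
Variables (X : nmodType).
Implicit Types F G : rat -> X.

Lemma fsum_shift (c : rat) F : fsum (fun p => F (p + c)) = fsum F.
Proof.
rewrite [RHS](reindex_fsbigT (fun p : rat => p + c)) //.
by exists (fun p => p - c) => p; ring.
Qed.

End RatSums.

(** Exponents run over translates of a lattice, so bounds from both sides leave finitely many of
    them; the finite boxes for sums over rational exponents come from here. *)
Lemma lattice_seq (d g lo hi : rat) : 0 < d ->
  exists s : seq rat, forall p,
    d * p - g \is a Num.int -> lo <= p -> p <= hi -> p \in s.
Proof.
move=> d0.
pose m := Num.floor (d * lo - g); pose n := `|Num.ceil (d * hi - g) - m|%N.
exists [seq ((m + (i%:Z))%:~R + g) / d | i <- iota 0 n.+1] => p.
move=> /intrP[k Ek] lop phi.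
have -> : p = (k%:~R + g) / d by rewrite -Ek; field; rewrite gt_eqF.
have km : m <= k.
  rewrite -(ler_int rat) -Ek; apply: le_trans (floor_le _) _.
  by rewrite lerB // ler_pM2l.
have kn : k <= Num.ceil (d * hi - g).
  rewrite -(ler_int rat) -Ek; apply: le_trans (ceil_ge _).
  by rewrite lerB // ler_pM2l.
apply/mapP; exists `|k - m|%N.
  rewrite mem_iota add0n leq0n /= ltnS /n.
  by move: km kn; lia.
by congr ((_ %:~R + _) / _); move: km; lia.
Qed.

Section LinearFunctions.
Variables (K : pzRingType) (U V : lmodType K) (f : U -> V).
Hypothesis fl : linear f.

Lemma linear_fun0 : f 0 = 0.
Proof. by have := fl (-1) 0 0; rewrite scaler0 addr0 scaleN1r addNr. Qed.

Lemma linear_funD : {morph f : x y / x + y}.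
Proof. by move=> x y; have := fl 1 x y; rewrite !scale1r. Qed.

Lemma linear_funZ a x : f (a *: x) = a *: f x.
Proof. by have := fl a x 0; rewrite !addr0 linear_fun0 addr0. Qed.

Lemma linear_fun_sum (I : Type) (r : seq I) (F : I -> U) :
  f (\sum_(i <- r) F i) = \sum_(i <- r) f (F i).
Proof. exact: (big_morph f linear_funD linear_fun0). Qed.

End LinearFunctions.

(** * Binomial coefficients *)

Section Binomials.
Variable R : realType.
Local Notation C := R[i].
Implicit Types a b : C.

Definition ffall a n : C := \prod_(k < n) (a - k%:R).

Lemma cbinE a n : cbin a n = ffall a n / n`!%:R.
Proof. by []. Qed.

Lemma fact_neq0 n : n`!%:R != 0 :> C.
Proof. by rewrite pnatr_eq0 -lt0n fact_gt0. Qed.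

Lemma ffallD a i j : ffall a (i + j) = ffall a i * ffall (a - i%:R) j.
Proof.
rewrite /ffall big_split_ord /=; congr (_ * _).
by apply: eq_bigr => k _; rewrite natrD; ring.
Qed.

Lemma ffall_nat n i : ffall (n + i)%:R n * i`!%:R = (n + i)`!%:R.
Proof.
elim: n => [|n IH]; first by rewrite /ffall big_ord0 mul1r.
rewrite addSn factS natrM -IH /ffall big_ord_recl /= subr0 mulrA.
congr (_ * _ * _); apply: eq_bigr => k _.
by rewrite /bump /= add1n -!natr1; ring.
Qed.

Lemma cbin0 a : cbin a 0 = 1.
Proof. by rewrite cbinE /ffall big_ord0 mul1r invr1. Qed.

Lemma cbin0l i : cbin (0 : C) i = (i == 0%N)%:R.
Proof.
case: i => [|i]; first by rewrite cbin0.
by rewrite cbinE /ffall big_ord_recl /= subr0 !mul0r.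
Qed.

Lemma cbin11 : cbin (1 : C) 1 = 1.
Proof. by rewrite cbinE /ffall big_ord1 /= subr0 invr1 mul1r. Qed.

Lemma cbin_small n i : (n < i)%N -> cbin (n%:R : C) i = 0.
Proof.
move=> ni; rewrite cbinE /ffall (bigD1 (Ordinal ni)) //= subrr.
by rewrite !mul0r.
Qed.

(** Both sides are the trinomial a(a-1)...(a-i-j+1) / (i! j!). *)
Lemma cbin_mulC a i j :
  cbin a i * cbin (a - i%:R) j = cbin a j * cbin (a - j%:R) i.
Proof.
rewrite !cbinE mulrACA -ffallD [RHS]mulrACA -ffallD addnC; congr (_ * _).
exact: mulrC.
Qed.

Lemma cbin_sub a s i :
  cbin a (s + i) * cbin (s + i)%:R s = cbin a s * cbin (a - s%:R) i.
Proof.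
rewrite !cbinE mulrACA -(ffall_nat s i) ffallD.
have := fact_neq0 (s + i); rewrite -ffall_nat mulf_eq0 negb_or => /andP[h1 h2].
have := fact_neq0 s; move: h1 h2.
set x := ffall (s + i)%:R s; set y := i`!%:R; set t := s`!%:R => *.
field; by do ?[apply/andP; split].
Qed.

Lemma cbin_neg a i : cbin (- a - 1) i = (-1) ^+ i * cbin (a + i%:R) i.
Proof.
rewrite !cbinE mulrA; congr (_ / _); rewrite /ffall.
rewrite [in RHS](reindex_inj rev_ord_inj) /=.
rewrite -[in (-1) ^+ i](card_ord i) -prodr_const -big_split /=.
apply: eq_bigr => k _; rewrite natrB ?ltn_ord // -natr1; ring.
Qed.

Lemma cbinSl a n : n.+1%:R * cbin a n.+1 = (a - n%:R) * cbin a n.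
Proof.
rewrite !cbinE /ffall big_ord_recr /= factS natrM.
have h1 := fact_neq0 n; have h2 : n.+1%:R != 0 :> C by rewrite pnatr_eq0.
move: h1 h2; set x := n`!%:R; set y := n.+1%:R => h1 h2.
field; rewrite ?h1 ?h2 //=.
Qed.

Lemma cbin_Vandermonde a b n :
  cbin (a + b) n = \sum_(i < n.+1) cbin a i * cbin b (n - i).
Proof.
elim: n => [|n IH]; first by rewrite big_ord1 !cbin0 mulr1.
have n0 : n.+1%:R != 0 :> C by rewrite pnatr_eq0.
apply: (mulfI n0); rewrite cbinSl IH mulr_sumr.
(* The factor n+1 is written as i + (n+1-i); each of the two resulting sums lowers one binomial
   through [cbinSl]. *)
pose F i := i%:R * (cbin a i * cbin b (n.+1 - i)).
pose G i := (n.+1 - i)%:R * (cbin a i * cbin b (n.+1 - i)).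
rewrite [RHS](_ : _ = \sum_(i < n.+2) F i + \sum_(i < n.+2) G i); last first.
  rewrite mulr_sumr -big_split /=; apply: eq_bigr => i _.
  by rewrite /F /G -mulrDl -natrD subnKC // -ltnS ltn_ord.
have F0 : F 0%N = 0 by rewrite /F mulr0n mul0r.
have G0 : G n.+1 = 0 by rewrite /G subnn mulr0n mul0r.
rewrite [\sum_(i < n.+2) F i]big_ord_recl F0 add0r.
rewrite [\sum_(i < n.+2) G i]big_ord_recr /= G0 addr0 -big_split /=.
apply: eq_bigr => i _; rewrite /F /G /bump /= add1n subSS.
have lein : (i <= n)%N by rewrite -ltnS.
have := cbinSl a i; have := cbinSl b (n - i)%N; rewrite subSn // natrB //.
set x := cbin a i.+1; set y := cbin b _.+1 => ey ex.
transitivity (i.+1%:R * x * cbin b (n - i)%N + (n - i).+1%:R * y * cbin a i).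
  by rewrite ex ey; ring.
by ring.
Qed.

End Binomials.

Section PowerSeriesAction.
Variables (R : realType) (X : lmodType R[i]).
Local Notation C := R[i].

Lemma fin_comp_addn (g : nat -> X) i : fin g -> fin (fun j => g (i + j)%N).
Proof.
by move=> /natfin[n gn]; apply: (@fin_nat _ _ n) => j nj; rewrite gn // (leq_trans nj) ?leq_addl.
Qed.

Lemma fsum_antidiag (c : nat -> nat -> C) (g : nat -> X) : fin g ->
  fsum (fun i => fsum (fun j => c i j *: g (i + j)%N)) =
  fsum (fun n => (\sum_(i < n.+1) c i (n - i)%N) *: g n).
Proof.
move=> gf; have [N gN] := natfin gf.
pose h i n := if (i <= n)%N then c i (n - i)%N *: g n else 0.
transitivity (fsum (fun i => fsum (fun n => h i n))).
  apply: eq_fsum => i; rewrite [RHS](@fsum_shiftn _ i); first last.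
  - apply: (@fin_nat _ _ N) => n nN; rewrite /h gN // scaler0; exact: if_same.
  - by move=> n ni; rewrite /h leqNgt ni.
  by apply: eq_fsum => j; rewrite /h leq_addr addKn.
rewrite (@fsum_exch _ _ _ _ (iota 0 N) (iota 0 N)); last first.
  move=> i n; rewrite /h; case: leqP => // ni; rewrite !mem_iota !add0n !leq0n /=.
  by case: (ltnP n N) => [nN _|/gN->]; rewrite ?scaler0 // (leq_ltn_trans ni).
apply: eq_fsum => n; rewrite (@fsum_ord _ _ n.+1); last first.
  by move=> i ni; rewrite /h leqNgt ni.
rewrite scaler_suml; apply: eq_bigr => i _.
by rewrite /h -ltnS ltn_ord.
Qed.

Lemma fsum_cauchy (k l : nat -> C) (g : nat -> X) : fin g ->
  fsum (fun i => k i *: fsum (fun j => l j *: g (i + j)%N)) =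
  fsum (fun n => (\sum_(i < n.+1) k i * l (n - i)%N) *: g n).
Proof.
move=> gf; rewrite -(fsum_antidiag (fun i j => k i * l j)) //.
apply: eq_fsum => i; rewrite -fsumZ; last exact/finZ/fin_comp_addn.
by apply: eq_fsum => j; rewrite scalerA.
Qed.

(** (1 + c S)^a (1 + c S)^b = (1 + c S)^(a+b), with S the shift acting on [g]. Additivity of
    exponents for [Sl], [Up] and [Lo] reduces to this. *)
Lemma fsum_Vandermonde (a b c : C) (g : nat -> X) : fin g ->
  fsum (fun i => (cbin a i * c ^+ i) *: fsum (fun j => (cbin b j * c ^+ j) *: g (i + j)%N)) =
  fsum (fun n => (cbin (a + b) n * c ^+ n) *: g n).
Proof.
move=> gf; rewrite (fsum_cauchy (fun i => cbin a i * c ^+ i) (fun i => cbin b i * c ^+ i) gf).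
apply: eq_fsum => n; congr (_ *: _); rewrite cbin_Vandermonde mulr_suml.
apply: eq_bigr => i _; rewrite mulrACA -exprD subnKC //.
by rewrite -ltnS ltn_ord.
Qed.

End PowerSeriesAction.

(** * Operators on formal series *)

Lemma nat_gt (x : rat) : exists n : nat, x < n%:R.
Proof.
by exists (Num.bound `|x|); apply: le_lt_trans (ler_norm _) (archi_boundP (normr_ge0 _)).
Qed.

Section Operators.
Variables (R : realType) (X : lmodType R[i]).
Local Notation C := R[i].
Implicit Types (f g : rat -> X) (F G : rat -> rat -> X).

(* multiplication by the formal series sum_i k_i x^(r_i) *)
Definition Op (k : nat -> C) (r : nat -> rat) f : rat -> X :=
  fun e => fsum (fun i => k i *: f (e - r i)).

Definition Op1 k r F : rat -> rat -> X := fun b c => Op k r (F^~ c) b.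
Definition Op2 k r F : rat -> rat -> X := fun b => Op k r (F b).

(* multiplication by zeta + x1 - x2 *)
Definition Dl (zeta : C) F : rat -> rat -> X :=
  fun b c => zeta *: F b c + F (b - 1) c - F b (c - 1).

(* coefficient of x0^t in F(x2 + x0, x2) *)
Definition Dt (t : nat) F : rat -> X :=
  fun e => \sum_(p \in [set: rat]) cbin (ratr p : C) t *: F p (e + t%:R - p).

Lemma nat_le_seq (x : rat) : exists s : seq nat, forall i, i%:R <= x -> i \in s.
Proof.
exists (iota 0 (Num.bound x).+1) => i ix; rewrite mem_iota add0n leq0n ltnS /=.
rewrite -(ler_nat rat); apply: le_trans ix _.
have [x0|x0] := leP 0 x; first exact/ltW/archi_boundP.
exact: le_trans (ltW x0) (ler0n _ _).
Qed.

Lemma fin_le f (x : nat -> rat) (N : rat) :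
  (forall i, f (x i) <> 0 -> i%:R <= N) -> fin (fun i => f (x i)).
Proof.
move=> H; apply: finN0; have [s Hs] := nat_le_seq N.
by exists s => i /H /Hs.
Qed.

Lemma eq_Op k r f g : f =1 g -> Op k r f =1 Op k r g.
Proof. by move=> fg e; apply: eq_fsum => i; rewrite fg. Qed.

Lemma Op_exch k r k' r' F b c (s t : seq nat) :
  (forall i j, F (b - r i) (c - r' j) <> 0 -> i \in s /\ j \in t) ->
  Op1 k r (Op2 k' r' F) b c = Op2 k' r' (Op1 k r F) b c.
Proof.
move=> Fst; pose G i j := (k i * k' j) *: F (b - r i) (c - r' j).
have Gst i j : G i j <> 0 -> i \in s /\ j \in t.
  by move=> Gij; apply: Fst => F0; apply: Gij; rewrite /G F0 scaler0.
have f2 i : fin (fun j => F (b - r i) (c - r' j)).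
  by apply: finN0; exists t => j /Fst[].
have f1 j : fin (fun i => F (b - r i) (c - r' j)).
  by apply: finN0; exists s => i /Fst[].
rewrite /Op1 /Op2 /Op.
transitivity (fsum (fun i => fsum (fun j => G i j))).
  apply: eq_fsum => i; rewrite -fsumZ; last exact: finZ.
  by apply: eq_fsum => j; rewrite scalerA.
rewrite (fsum_exch Gst); apply: eq_fsum => j.
rewrite -fsumZ; last exact: finZ.
by apply: eq_fsum => i; rewrite scalerA [k' j * _]mulrC.
Qed.

Lemma Op_lin k r f g (x y : C) e :
  fin (fun i => f (e - r i)) -> fin (fun i => g (e - r i)) ->
  Op k r (fun e => x *: f e + y *: g e) e = x *: Op k r f e + y *: Op k r g e.
Proof.
move=> ff gf; rewrite /Op -!fsumZ; try exact: finZ.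
rewrite -fsumD; try exact/finZ/finZ.
apply: eq_fsum => i; rewrite scalerDr !scalerA.
by rewrite [k i * x]mulrC [k i * y]mulrC.
Qed.

Lemma Op1_Dl k r zeta F b c :
  (forall b c, fin (fun i => F (b - r i) c)) ->
  Op1 k r (Dl zeta F) b c = Dl zeta (Op1 k r F) b c.
Proof.
move=> Ff; rewrite /Op1 /Op /Dl.
have f1 b' c' : fin (fun i => k i *: F (b' - r i) c') by apply: finZ.
have f2 : fin (fun i => zeta *: (k i *: F (b - r i) c)) by apply: finZ.
rewrite -fsumZ // -fsumD // -fsumB //; last exact: finD.
apply: eq_fsum => i; rewrite scalerBr scalerDr !scalerA [zeta * _]mulrC.
by rewrite [b - r i - 1]addrAC.
Qed.

Lemma Op2_Dl k r zeta F b c :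
  (forall b c, fin (fun i => F b (c - r i))) ->
  Op2 k r (Dl zeta F) b c = Dl zeta (Op2 k r F) b c.
Proof.
move=> Ff; rewrite /Op2 /Op /Dl.
have f1 b' c' : fin (fun i => k i *: F b' (c' - r i)) by apply: finZ.
have f2 : fin (fun i => zeta *: (k i *: F b (c - r i))) by apply: finZ.
rewrite -fsumZ // -fsumD // -fsumB //; last exact: finD.
apply: eq_fsum => i; rewrite scalerBr scalerDr !scalerA [zeta * _]mulrC.
by rewrite [c - r i - 1]addrAC.
Qed.

(** Powers of x2 are untouched by the substitution x1 = x2 + x0, so they pass through the extraction
    of x0^t. *)
Lemma Dt_Op2 t k r F e (s : seq rat) (s' : seq nat) :
  (forall p i, F p (e + t%:R - p - r i) <> 0 -> p \in s /\ i \in s') ->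
  Dt t (Op2 k r F) e = Op k r (Dt t F) e.
Proof.
move=> Fs; pose G p i := (cbin (ratr p : C) t * k i) *: F p (e + t%:R - p - r i).
have Gs p i : G p i <> 0 -> p \in s /\ i \in s'.
  by move=> Gij; apply: Fs => F0; apply: Gij; rewrite /G F0 scaler0.
have f2 p : fin (fun i => F p (e + t%:R - p - r i)).
  by apply: finN0; exists s' => i /Fs[].
have f1 i : fin (fun p => F p (e + t%:R - p - r i)).
  by apply: finN0; exists s => p /Fs[].
rewrite /Dt /Op2 /Op.
transitivity (fsum (fun p => fsum (fun i => G p i))).
  apply: eq_fsum => p; rewrite -fsumZ; last exact: finZ.
  by apply: eq_fsum => i; rewrite scalerA.
rewrite (fsum_exch Gs); apply: eq_fsum => i; rewrite -fsumZ.
  apply: eq_fsum => p; rewrite scalerA mulrC; congr (_ *: F p _); ring.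
apply: finZ; have [s1 H1] := f1 i; exists s1 => p /H1; congr (F p _ = 0); ring.
Qed.

(** Leibniz rule: x1^r becomes (x2 + x0)^r = sum_j binom(r, j) x2^(r-j) x0^j, and j is the share of
    x0^t taken from this factor. *)
Lemma Dt_Op1 t k r F e (s : seq rat) (s' : seq nat) :
  (forall p i, F (p - r i) (e + t%:R - p) <> 0 -> p \in s /\ i \in s') ->
  Dt t (Op1 k r F) e =
  \sum_(j < t.+1) fsum (fun i => (k i * cbin (ratr (r i)) j) *:
                          Dt (t - j) F (e + j%:R - r i)).
Proof.
move=> Fs.
pose G p i := (cbin (ratr p : C) t * k i) *: F (p - r i) (e + t%:R - p).
have Gs p i : G p i <> 0 -> p \in s /\ i \in s'.
  by move=> Gij; apply: Fs => F0; apply: Gij; rewrite /G F0 scaler0.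
have f2 p : fin (fun i => F (p - r i) (e + t%:R - p)).
  by apply: finN0; exists s' => i /Fs[].
have E (i : nat) (p : rat) : e + t%:R - (p + r i) = e - r i + t%:R - p by ring.
have f1 i : fin (fun p => F p (e - r i + t%:R - p)).
  apply: finN0; exists [seq p - r i | p <- s] => p.
  rewrite -E -{1}[p](addrK (r i)) => /Fs[ps _].
  by apply/mapP; exists (p + r i) => //; rewrite addrK.
have f0 i p : i \notin s' -> F p (e - r i + t%:R - p) = 0.
  move=> si; apply: contrapT; rewrite -E -{1}[p](addrK (r i)) => /Fs[_].
  exact/negP.
transitivity (fsum (fun p => fsum (fun i => G p i))).
  rewrite /Dt /Op1 /Op; apply: eq_fsum => p; rewrite -fsumZ; last exact: finZ.
  by apply: eq_fsum => i; rewrite scalerA.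
rewrite (fsum_exch Gs).
pose H (j : 'I_t.+1) i := (k i * cbin (ratr (r i)) j) *:
                          Dt (t - j) F (e + j%:R - r i).
have HE (j : 'I_t.+1) i p : e + j%:R - r i + (t - j)%:R - p = e - r i + t%:R - p.
  by have jt : (j <= t)%N by [rewrite -ltnS]; rewrite natrB //; ring.
transitivity (fsum (fun i => \sum_(j < t.+1) H j i)).
  apply: eq_fsum => i; rewrite /H /Dt.
  transitivity (fsum (fun p => \sum_(j < t.+1) (k i * cbin (ratr (r i)) j) *:
     (cbin (ratr p : C) (t - j) *: F p (e - r i + t%:R - p)))).
    rewrite -[LHS](fsum_shift (r i)); apply: eq_fsum => p.
    rewrite /G addrK E rmorphD /= addrC cbin_Vandermonde !mulr_suml scaler_suml.
    apply: eq_bigr => j _; rewrite scalerA; congr (_ *: _); ring.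
  rewrite fsum_sum; last by move=> j; apply/finZ/finZ.
  apply: eq_bigr => j _; rewrite fsumZ; last exact/finZ.
  by congr (_ *: _); apply: eq_fsum => p; rewrite HE.
rewrite fsum_sum // => j; exists s' => i si; rewrite /H /Dt fsum0 ?scaler0 // => p.
by rewrite HE f0 ?scaler0.
Qed.

End Operators.

Local Opaque cbin.

(** Meant for a sum over a coset of the integers that splits into two half-lines, with a gap between
    them on which the summand vanishes. *)
Lemma fsum_cover (I J K : choiceType) (X : nmodType) (F : K -> X)
    (h1 : I -> K) (h2 : J -> K) :
  injective h1 -> injective h2 -> (forall i j, h1 i <> h2 j) ->
  (forall k, F k <> 0 -> (exists i, k = h1 i) \/ (exists j, k = h2 j)) ->
  fin F -> fsum F = fsum (fun i => F (h1 i)) + fsum (fun j => F (h2 j)).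
Proof.
move=> i1 i2 h12 cov Ff.
have E k : F k = patch (fun=> 0) (range h1) F k + patch (fun=> 0) (range h2) F k.
  rewrite /patch; case: ifP => [|n1]; rewrite ?inE.
    move=> [i _ <-]; rewrite ifF ?addr0 //; apply/negP; rewrite inE.
    by move=> [j _ /esym/h12].
  case: ifP => [|n2]; first by rewrite add0r.
  rewrite addr0; apply: contrapT => /cov[[i ki]|[j kj]].
    by move/negP: n1; apply; rewrite inE ki; exists i.
  by move/negP: n2; apply; rewrite inE kj; exists j.
have pf A : fin (patch (fun=> 0) A F).
  case: Ff => s Fs; exists s => i /Fs F0; rewrite /patch; by case: ifP.
rewrite (eq_fsum E) fsumD // -!fsbig_mkcond.
by congr (_ + _); apply: fsbig_image => x y _ _; [apply: i1|apply: i2].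
Qed.

(** * Jacobi identity, locality and the iterate formula *)

Section BorcherdsIdentity.
Variables (R : realType) (X : lmodType R[i]).
Local Notation C := R[i].
Implicit Types (F Z : rat -> rat -> X) (n k : int) (b c : rat).

(* (x1 - x2)^n F in the expansion |x1| > |x2| *)
Definition Sl n F b c : X :=
  fsum (fun i : nat => ((-1) ^+ i * cbin n%:~R i : C) *:
                         F (b - (n%:~R - i%:R)) (c - i%:R)).

(* (x1 - x2)^n F in the expansion |x2| > |x1| *)
Definition Sr n F b c : X :=
  fsum (fun i : nat => ((-1) ^ n * (-1) ^+ i * cbin n%:~R i : C) *:
                         F (b - i%:R) (c - (n%:~R - i%:R))).

Definition flip F : rat -> rat -> X := fun b c => F c b.

Lemma SrE n F b c : Sr n F b c = ((-1) ^ n : C) *: Sl n (flip F) c b.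
Proof.
have s0 : ((-1) ^ n : C) != 0 by rewrite expfz_neq0 // oppr_eq0 oner_eq0.
have [f|nf] := pselect (fin (fun i : nat => ((-1) ^+ i * cbin n%:~R i : C) *:
    F (b - i%:R) (c - (n%:~R - i%:R)))).
  rewrite /Sl -fsumZ; last exact: f.
  by apply: eq_fsum => i; rewrite scalerA -mulrA.
(* Without finite support both sums take the default value 0, and the nonzero sign does not change
   the support. *)
rewrite /Sr /Sl !fsum_dflt ?scaler0 //.
move=> [s Hs]; apply: nf; exists s => i /Hs /eqP.
by rewrite -mulrA -scalerA scaler_eq0 (negbTE s0) => /eqP.
Qed.

(** Finiteness along antidiagonals in the direction in which [Sl] sums; for [Sr] the same is asked
    of [flip F]. *)
Definition dfin F := forall b c, fin (fun i : nat => F (b + i%:R) (c - i%:R)).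

Lemma SlE n F b c : Sl n F b c = fsum (fun i : nat =>
  (cbin n%:~R i * (-1) ^+ i : C) *: F (b - n%:~R + i%:R) (c - i%:R)).
Proof.
by apply: eq_fsum => i; rewrite mulrC; congr (_ *: F _ _); ring.
Qed.

Lemma SlD k n F b c : dfin F -> Sl k (Sl n F) b c = Sl (k + n) F b c.
Proof.
move=> Ff; rewrite [RHS]SlE !intrD.
pose g i := F (b - (k%:~R + n%:~R) + i%:R) (c - i%:R).
have gf : fin g by exact: Ff.
rewrite -[RHS](@fsum_Vandermonde R X k%:~R n%:~R (-1) g gf) SlE; apply: eq_fsum => i; rewrite SlE; congr (_ *: _).
apply: eq_fsum => j; rewrite /g natrD; congr (_ *: F _ _); ring.
Qed.

Lemma Sl0 F b c : Sl 0 F b c = F b c.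
Proof.
rewrite SlE (@fsum1 _ _ 0%N); last first.
  by case=> // i _; rewrite cbin0l mul0r scale0r.
by rewrite cbin0 mul1r scale1r; congr (F _ _); ring.
Qed.

Lemma Sl1 F b c : Sl 1 F b c = Dl 0 F b c.
Proof.
rewrite SlE (@fsum_ord _ _ 2); last first.
  by move=> i i2; rewrite (@cbin_small _ 1) ?mul0r ?scale0r.
rewrite !big_ord_recl big_ord0 /= /Dl scale0r add0r !addr0 cbin0 mul1r scale1r.
rewrite cbin11 expr1 mul1r scaleN1r.
by congr (_ - F _ _); rewrite subrK.
Qed.

Lemma Dl_flip (zeta : C) m F : iter m (Dl zeta) (flip F) =
  (fun b c => ((-1) ^+ m : C) *: iter m (Dl (- zeta)) F c b).
Proof.
elim: m => [|m IH]; first by apply: funext2 => b c /=; rewrite expr0 scale1r.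
rewrite iterS IH; apply: funext2 => b c /=.
move: (iter m _ F) => G; rewrite /Dl exprS -scalerA; set s := (-1) ^+ m : C.
rewrite !scalerA [zeta * s]mulrC -!scalerA -scalerDr -scalerBr scaleN1r -scalerN.
congr (_ *: _); rewrite scaleNr opprB opprD opprK.
by rewrite [RHS]addrC addrAC.
Qed.

Lemma dfin_Sl n F : dfin F -> dfin (Sl n F).
Proof.
move=> Ff b c; have /natfin[N FN] := Ff (b - n%:~R) c.
apply: (@fin_nat _ _ N) => i iN; rewrite SlE; apply: fsum0 => j.
rewrite -[RHS](scaler0 _ (cbin n%:~R j * (-1) ^+ j : C)); congr (_ *: _).
rewrite -(FN (i + j)%N (leq_trans iN (leq_addr _ _))) natrD; congr (F _ _); ring.
Qed.

Lemma SlZ n (a : C) F b c : dfin F ->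
  Sl n (fun b c => a *: F b c) b c = a *: Sl n F b c.
Proof.
move=> Ff; rewrite !SlE -fsumZ; last exact/finZ/Ff.
by apply: eq_fsum => i; rewrite !scalerA mulrC.
Qed.

Lemma Sl_nat m F b c : dfin F -> Sl m%:Z F b c = iter m (Dl 0) F b c.
Proof.
move=> Ff; elim: m b c => [|m IH] b c; first exact: Sl0.
rewrite (_ : m.+1%:Z = 1 + m%:Z) // -SlD // Sl1 iterS /=.
by rewrite /Dl !IH.
Qed.

Lemma cbin_natC (i j : nat) : cbin ((i + j)%:R : C) i = cbin (i + j)%:R j.
Proof.
have h (k l : nat) : cbin ((k + l)%:R : C) k = (k + l)`!%:R / l`!%:R / k`!%:R.
  by rewrite cbinE -ffall_nat mulfK // fact_neq0.
by rewrite h [in RHS]addnC h mulrAC addnC.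
Qed.

Lemma cbin_negC (t i : nat) : (-1) ^+ i * cbin (- t%:R - 1 : C) i = cbin (t + i)%:R t.
Proof. by rewrite cbin_neg mulrA -expr2 sqrr_sign mul1r -natrD -cbin_natC. Qed.

Lemma Dl_out (g : rat) m F : (forall b c, b - g \isn't a Num.int -> F b c = 0) ->
  forall b c, b - g \isn't a Num.int -> iter m (Dl 0) F b c = 0.
Proof.
move=> F0; elim: m => [|m IH] b c bg /=; first exact: F0.
have b1 : b - 1 - g \isn't a Num.int.
  apply: contra bg => bg; rewrite (_ : b - g = b - 1 - g + 1); last by ring.
  by rewrite rpredD.
by rewrite {1}/Dl !IH // scaler0 addr0 subrr.
Qed.

Lemma intrN1 (K : pzRingType) (t : nat) : (- t%:Z - 1)%:~R = - t%:R - 1 :> K.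
Proof. by rewrite rmorphB rmorphN /=. Qed.

Lemma signzN1 (t : nat) : (-1) ^ (- t%:Z - 1) = - (-1) ^+ t :> C.
Proof.
rewrite (_ : - t%:Z - 1 = - (t.+1%:Z)); last by lia.
by rewrite -exprz_inv invrN1 -exprnP exprS mulN1r.
Qed.

(* The difference of the two expansions of (x1 - x2)^(-1-t) Z is a derivative
   of the delta function. *)
Lemma Sl_sub_Sr (g : rat) t Z b c :
  (forall b c, b - g \isn't a Num.int -> Z b c = 0) ->
  (forall e, fin (fun p => Z p (e - p))) -> b - g \is a Num.int ->
  Sl (- t%:Z - 1) Z b c - Sr (- t%:Z - 1) Z b c =
  \sum_(j < t.+1) cbin (- ratr b - 1 : C) j *: Dt (t - j) Z (b + c + 1 + j%:R).
Proof.
move=> Zg Zf bg.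
have Fb : fin (fun i : nat => Z (b - i%:R) (c + 1 + t%:R + i%:R)).
  apply: (@fin_sub _ _ _ _ _ (fun i : nat => b - i%:R) _ _ _ (Zf (b + c + 1 + t%:R))).
    by move=> i j /addrI/oppr_inj/eqP; rewrite eqr_nat => /eqP.
  move=> i; rewrite (_ : b + c + _ + _ - _ = c + 1 + t%:R + i%:R) //; ring.
(* The first expansion lives on p >= b+1+t and the second on p <= b. With its minus sign included,
   each has coefficient binom(p-b-1, t), a polynomial in p which vanishes on the gap b < p <=
   b+t. *)
transitivity (fsum (fun p => cbin (ratr p - ratr b - 1 : C) t *:
                             Z p (b + c + 1 + t%:R - p))).
  rewrite (@fsum_cover _ _ _ _ _ (fun i : nat => b + 1 + t%:R + i%:R)
             (fun i : nat => b - i%:R)); last exact: finZ.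
  - congr (_ + _).
      apply: eq_fsum => i; rewrite intrN1 cbin_negC intrN1.
      by congr (cbin _ _ *: Z _ _); ring.
    rewrite /Sr -fsumN; last first.
      apply/finZ; have [s Hs] := Fb; exists s => i /Hs; congr (Z _ _ = 0).
      rewrite intrN1; ring.
    apply: eq_fsum => i; rewrite signzN1 !intrN1 -scaleNr !mulNr opprK.
    congr (_ *: Z _ _); last by ring.
    rewrite -mulrA cbin_negC (_ : _ - _ - 1 = - i%:R - 1 :> C); last first.
      by ring.
    by rewrite addnC -cbin_natC -cbin_negC mulrA -expr2 sqrr_sign mul1r.
  - by move=> i j /addrI/eqP; rewrite eqr_nat => /eqP.
  - by move=> i j /addrI/oppr_inj/eqP; rewrite eqr_nat => /eqP.
  - move=> i j /eqP; rewrite -subr_eq0.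
    have -> : b + 1 + t%:R + i%:R - (b - j%:R) = (1 + t + i + j)%:R :> rat.
      by rewrite !natrD; ring.
    by rewrite pnatr_eq0.
  - move=> p Fp.
    have /intrP[k Ek] : p - b \is a Num.int.
      have pg : p - g \is a Num.int.
        by apply: contrapT => /negP/Zg Z0; apply: Fp; rewrite Z0 scaler0.
      have -> : p - b = (p - g) - (b - g) by rewrite opprB addrA subrK.
      by rewrite rpredB.
    have {Ek} Ep : p = b + k%:~R by rewrite -Ek addrC subrK.
    have [k0|k0] := leP k 0.
      right; exists `|k|%N; rewrite Ep; congr (b + _).
      have Ek : k = - (`|k|%N)%:Z by lia.
      by rewrite [in LHS]Ek rmorphN.
    have [kt|kt] := leP (t.+1%:Z) k.
      left; exists `|k - t.+1%:Z|%N; rewrite Ep -!addrA; congr (b + _).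
      have Ek : k = (1 + t + `|k - t.+1%:Z|)%N%:Z by lia.
      by rewrite [in LHS]Ek -pmulrn !natrD addrA.
    exfalso; apply: Fp; rewrite Ep rmorphD /=.
    have -> : ratr b + ratr k%:~R - ratr b - 1 = (`|k|.-1)%:R :> C.
      have Ek : k = (1 + `|k|.-1)%N%:Z by lia.
      rewrite [in LHS]Ek ratr_int -pmulrn natrD; ring.
    by rewrite cbin_small ?scale0r //; lia.
(* Vandermonde for p-b-1 = (-b-1) + p isolates the dependence on p in the binomials occurring in
   [Dt]. *)
transitivity (fsum (fun p => \sum_(j < t.+1) cbin (- ratr b - 1 : C) j *:
     (cbin (ratr p : C) (t - j) *: Z p (b + c + 1 + t%:R - p)))).
  apply: eq_fsum => p; rewrite (_ : ratr p - _ - _ = (- ratr b - 1) + ratr p); last by ring.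
  rewrite cbin_Vandermonde scaler_suml; apply: eq_bigr => j _.
  by rewrite scalerA.
rewrite fsum_sum; last by move=> j; apply/finZ/finZ.
apply: eq_bigr => j _; rewrite fsumZ; last exact: finZ.
congr (_ *: _); apply: eq_fsum => p; congr (_ *: Z p _).
have jt : (j <= t)%N by rewrite -ltnS.
rewrite natrB //; ring.
Qed.

Variables (g : rat) (m : nat) (F1 F2 : rat -> rat -> X) (F3 : int -> rat -> X).
Hypotheses (F1fin : dfin F1) (F2fin : dfin (flip F2)).
Hypothesis F1g : forall b c, b - g \isn't a Num.int -> F1 b c = 0.
Hypothesis F3m : forall n, n < - m%:Z -> forall e, F3 n e = 0.
Let Z := iter m (Dl 0) F1.
Hypothesis Zfin : forall e, fin (fun p => Z p (e - p)).

(** The coefficient of x0^(-n-1) x1^b x2^c in the Jacobi identity, with [F1] and [F2] the two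
    products and [F3 n e] the coefficient of x0^n x2^e in the iterate. *)
Definition Borcherds n b c := Sl n F1 b c - Sr n F2 b c =
  if b - g \is a Num.int then
    fsum (fun i : nat => ((-1) ^+ i * cbin (ratr (b + i%:R)) i : C) *:
                         F3 (- n - 1 - i%:Z) (b + c + 1 + i%:R))
  else 0.

Lemma Sr_nat (n : nat) F b c : dfin (flip F) -> Sr n%:Z F b c = iter n (Dl 0) F b c.
Proof.
move=> Ff; rewrite SrE Sl_nat // Dl_flip oppr0 -exprnP scalerA -expr2 sqrr_sign.
by rewrite scale1r.
Qed.

Lemma SrD k n F b c : dfin (flip F) -> Sr k (Sr n F) b c = Sr (k + n) F b c.
Proof.
move=> Ff; rewrite !SrE.
have -> : flip (Sr n F) = fun b c => ((-1) ^ n : C) *: Sl n (flip F) b c.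
  by apply: funext2 => b' c'; rewrite /flip SrE.
rewrite -SlD // expfzDr ?oppr_eq0 ?oner_eq0 // -scalerA; congr (_ *: _).
by rewrite SlZ //; apply: dfin_Sl.
Qed.

(** Truncation of [F3] stops the sum at t, and upper negation of the binomial gives it the shape
    produced by [Sl_sub_Sr]. *)
Lemma F3_rhs t b c :
  fsum (fun i : nat => ((-1) ^+ i * cbin (ratr (b + i%:R)) i : C) *:
                       F3 (t%:Z - m%:Z - i%:Z) (b + c + 1 + i%:R)) =
  \sum_(j < t.+1) cbin (- ratr b - 1 : C) j *:
                       F3 ((t - j)%:Z - m%:Z) (b + c + 1 + j%:R).
Proof.
rewrite (@fsum_ord _ _ t.+1); last first.
  by move=> i ti; rewrite F3m ?scaler0 //; lia.
apply: eq_bigr => i _; rewrite rmorphD /= rmorph_nat -cbin_neg.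
by congr (_ *: F3 _ _); have := ltn_ord i; lia.
Qed.

Section Implies.
Hypothesis F12 : iter m (Dl 0) F2 = Z.

(** The exponent is split as (-1-t) + m. The factor (x1-x2)^m turns both products into the same [Z],
    and the difference of the two expansions of (x1-x2)^(-1-t) [Z] is a combination of the [Dt] of
    [Z]. *)
Lemma Borcherds_neg t b c : Borcherds (m%:Z - 1 - t%:Z) b c <->
  (b - g \is a Num.int ->
  \sum_(j < t.+1) cbin (- ratr b - 1 : C) j *: Dt (t - j) Z (b + c + 1 + j%:R) =
  \sum_(j < t.+1) cbin (- ratr b - 1 : C) j *:
                       F3 ((t - j)%:Z - m%:Z) (b + c + 1 + j%:R)).
Proof.
rewrite /Borcherds (_ : m%:Z - 1 - t%:Z = (- t%:Z - 1) + m%:Z); last by lia.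
rewrite -SlD // -SrD //.
have -> : Sl m%:Z F1 = Z by apply: funext2 => x y; exact: Sl_nat.
have -> : Sr m%:Z F2 = Z.
  by rewrite -F12; apply: funext2 => x y; exact: Sr_nat.
have Zg := Dl_out m F1g.
case: ifPn => bg; last first.
  split=> // _; rewrite /Sl /Sr !fsum0 ?subrr // => i;
    rewrite (_ : Z _ _ = 0) ?scaler0 //; apply: Zg; apply: contra bg => bg.
    rewrite (_ : b - g = b - i%:R - g + i%:R); last by ring.
    by rewrite rpredD // intr_nat.
  rewrite (_ : b - g = b - ((- t%:Z - 1 : int)%:~R - i%:R) - g + ((- t%:Z - 1 : int)%:~R - i%:R)); last by ring.
  by rewrite rpredD // rpredB ?intr_int ?intr_nat.
rewrite (Sl_sub_Sr _ _ Zg) // -F3_rhs.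
have E i : - (- t%:Z - 1 + m%:Z) - 1 - i = t%:Z - m%:Z - i by lia.
by under eq_fsum do rewrite E; split=> [H _|H]; [exact: H|exact: H].
Qed.

Lemma Dt_Borcherds : (forall t e, F3 (t%:Z - m%:Z) e = Dt t Z e) ->
  forall n b c, Borcherds n b c.
Proof.
move=> F3E n b c.
have [nm|mn] := ltP n m%:Z.
  have -> : n = m%:Z - 1 - (absz (m%:Z - 1 - n)%R)%:Z by lia.
  by apply/Borcherds_neg => _; apply: eq_bigr => j _; rewrite F3E.
(* For n >= m the remaining factor (x1-x2)^(n-m) is a polynomial applied to the same [Z], and the
   right side vanishes by truncation. *)
have En : n = (absz (n - m%:Z)%R)%:Z + m%:Z by lia.
rewrite /Borcherds.
rewrite fsum0; last by move=> i; rewrite F3m ?scaler0 //; lia.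
rewrite if_same En -SlD // -SrD //.
have -> : Sl m%:Z F1 = Z by apply: funext2 => x y; exact: Sl_nat.
have -> : Sr m%:Z F2 = Z.
  by rewrite -F12; apply: funext2 => x y; exact: Sr_nat.
rewrite Sl_nat ?Sr_nat ?subrr // => b' c'.
  apply: (@fin_sub _ _ _ _ _ (fun i : nat => c' - i%:R) _ _ _ (Zfin (b' + c'))).
    by move=> i j /addrI/oppr_inj/eqP; rewrite eqr_nat => /eqP.
  by move=> i; rewrite /flip (_ : b' + c' - (c' - i%:R) = b' + i%:R) //; ring.
apply: (@fin_sub _ _ _ _ _ (fun i : nat => b' + i%:R) _ _ _ (Zfin (b' + c'))).
  by move=> i j /addrI/eqP; rewrite eqr_nat => /eqP.
by move=> i; rewrite (_ : b' + c' - (b' + i%:R) = c' - i%:R) //; ring.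
Qed.

End Implies.

(** At n = m the right side involves only coefficients of [F3] below -m. *)
Lemma Borcherds_Dl : (forall b c, Borcherds m%:Z b c) ->
  iter m (Dl 0) F2 = Z.
Proof.
move=> H; apply: funext2 => b c.
have := H b c; rewrite /Borcherds Sl_nat // Sr_nat // fsum0; last first.
  by move=> i; rewrite F3m ?scaler0 //; lia.
by rewrite if_same => /eqP; rewrite subr_eq0 => /eqP/esym.
Qed.

(** The identities at n = m-1-t form a triangular system in t: the term j = 0 contains the new
    coefficient, the others are known by induction. *)
Lemma Borcherds_Dt : (forall n b c, Borcherds n b c) ->
  forall t e, F3 (t%:Z - m%:Z) e = Dt t Z e.
Proof.
move=> H; have F12 := Borcherds_Dl (H m%:Z).
elim/ltn_ind => t IH e.
(* Taking b = g puts b in the coset, and c is then fixed by b + c + 1 = e. *)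
have := H (m%:Z - 1 - t%:Z) g (e - g - 1) => /(Borcherds_neg F12).
rewrite subrr => /(_ isT); rewrite !big_ord_recl /= !cbin0 !scale1r subn0 addr0.
have -> : g + (e - g - 1) + 1 = e by ring.
have -> : \sum_(i < t) cbin (- ratr g - 1 : C) (bump 0 i) *:
     F3 ((t - bump 0 i)%:Z - m%:Z) (e + (bump 0 i)%:R) =
  \sum_(i < t) cbin (- ratr g - 1 : C) (bump 0 i) *:
     Dt (t - bump 0 i) Z (e + (bump 0 i)%:R).
  apply: eq_bigr => i _; rewrite IH // /bump /= add1n.
  by have := ltn_ord i; lia.
by move/addIr.
Qed.

End BorcherdsIdentity.

Lemma fsum_neq0 (I : choiceType) (X : nmodType) (F : I -> X) :
  fsum F <> 0 -> exists i, F i <> 0.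
Proof.
by move=> F0; apply: contrapT => nF; apply: F0; apply: fsum0 => i;
  apply: contrapT => Fi; apply: nF; exists i.
Qed.

(** * Powers of linear forms *)

Section BinomialSeries.
Variables (R : realType) (X : lmodType R[i]).
Local Notation C := R[i].
Implicit Types (f : rat -> X) (F Z : rat -> rat -> X) (a b g : rat).
Implicit Types (xi : C) (chi : rat -> C).

(** [Up] reads [f] at increasing exponents and [Lo] at decreasing ones; [ub] and [lb] make the
    respective sums finite. *)
Definition ub f := forall e, fin (fun i : nat => f (e + i%:R)).
Definition lb f := forall e, fin (fun i : nat => f (e - i%:R)).

Section Up.
Variable xi : C.

(* (x + xi)^a, expanded in powers of xi *)
Definition upk a (i : nat) : C := cbin (ratr a) i * xi ^+ i.
Definition upr a (i : nat) : rat := a - i%:R.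
Definition Up a : (rat -> X) -> rat -> X := Op (upk a) (upr a).

Lemma ub_upr a f e : ub f -> fin (fun i => f (e - upr a i)).
Proof.
move=> /(_ (e - a))[s Hs]; exists s => i /Hs; rewrite /upr.
by congr (f _ = 0); ring.
Qed.

Lemma ub_Up a f : ub f -> ub (Up a f).
Proof.
move=> fb e; have /natfin[N HN] := ub_upr a e fb.
apply: (@fin_nat _ _ N) => i Ni; apply: fsum0 => j.
rewrite -[RHS](scaler0 _ (upk a j)); congr (_ *: _).
rewrite -(HN (i + j)%N (leq_trans Ni (leq_addr _ _))) /upr natrD; congr (f _); ring.
Qed.

Lemma UpD a b f : ub f -> Up b (Up a f) = Up (b + a) f.
Proof.
move=> fb; apply/funext => e; rewrite /Up /Op /upk.
have gf := ub_upr (b + a) e fb.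
rewrite rmorphD /= -[RHS](@fsum_Vandermonde R X _ _ xi _ gf).
apply: eq_fsum => i; congr (_ *: _); apply: eq_fsum => j; congr (_ *: f _).
rewrite /upr natrD; ring.
Qed.

Lemma Up0 f : Up 0 f = f.
Proof.
apply/funext => e; rewrite /Up /Op (@fsum1 _ _ 0%N); last first.
  by case=> // i _; rewrite /upk rmorph0 cbin0l mul0r scale0r.
by rewrite /upk cbin0 mul1r scale1r /upr !subr0.
Qed.

Lemma Up1 f : Up 1 f = fun e => f (e - 1) + xi *: f e.
Proof.
apply/funext => e; rewrite /Up /Op (@fsum_ord _ _ 2); last first.
  by move=> i i2; rewrite /upk rmorph1 (@cbin_small _ 1) ?mul0r ?scale0r.
rewrite !big_ord_recl big_ord0 /= /upk rmorph1 cbin0 cbin11 !mul1r expr1 scale1r addr0.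
by rewrite /upr /bump /= addn0 subrr !subr0.
Qed.

End Up.

Section Lo.
Variable chi : rat -> C.
Hypotheses (chi0 : chi 0 = 1) (chiD : forall a b, chi (a + b) = chi a * chi b).
Local Notation xi := (chi 1).

(* (xi + x)^a, expanded in powers of x, where xi^a stands for chi a *)
Definition lok a (i : nat) : C := chi a * (cbin (ratr a) i * xi^-1 ^+ i).
Definition lor (i : nat) : rat := i%:R.
Definition Lo a : (rat -> X) -> rat -> X := Op (lok a) lor.

Lemma chi_neq0 a : chi a != 0.
Proof.
apply: contra_eq_neq (chi0) => ca; rewrite -(subrr a) chiD ca mul0r eq_sym.
exact: oner_neq0.
Qed.

Lemma chi_nat (n : nat) : chi n%:R = xi ^+ n.
Proof.
elim: n => [|n IH]; first by rewrite expr0 -chi0.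
by rewrite -natr1 chiD IH exprSr.
Qed.

Lemma chiB a (n : nat) : chi (a - n%:R) = chi a * xi^-1 ^+ n.
Proof.
rewrite -[in RHS](subrK n%:R a) [in RHS]chiD chi_nat -mulrA -exprMn divff ?expr1n ?mulr1 //.
exact: chi_neq0.
Qed.

Lemma lb_Lo a f : lb f -> lb (Lo a f).
Proof.
move=> fb e; have /natfin[N HN] := fb e.
apply: (@fin_nat _ _ N) => i Ni; apply: fsum0 => j.
rewrite -[RHS](scaler0 _ (lok a j)); congr (_ *: _).
rewrite -(HN (i + j)%N (leq_trans Ni (leq_addr _ _))) /lor natrD; congr (f _); ring.
Qed.

Lemma LoE a f e : lb f -> Lo a f e =
  chi a *: fsum (fun i : nat => (cbin (ratr a) i * xi^-1 ^+ i) *: f (e - i%:R)).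
Proof.
move=> fb; rewrite -fsumZ; last exact/finZ/fb.
by apply: eq_fsum => i; rewrite scalerA.
Qed.

Lemma LoD a b f : lb f -> Lo b (Lo a f) = Lo (b + a) f.
Proof.
move=> fb; apply/funext => e; rewrite LoE; last exact: lb_Lo.
rewrite [RHS]LoE // chiD -scalerA; congr (_ *: _).
pose S i := fsum (fun j : nat =>
  (cbin (ratr a) j * xi^-1 ^+ j) *: f (e - (i + j)%:R)).
have Sf : fin S.
  have /natfin[N HN] := fb e; apply: (@fin_nat _ _ N) => i Ni.
  by apply: fsum0 => j; rewrite HN ?scaler0 // (leq_trans Ni) // leq_addr.
transitivity (fsum (fun i => chi a *: ((cbin (ratr b) i * xi^-1 ^+ i) *: S i))).
  apply: eq_fsum => i; rewrite LoE // !scalerA [X in X *: _ = _]mulrC; congr (_ *: _).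
  apply: eq_fsum => j; congr (_ *: f _); rewrite natrD; ring.
rewrite [LHS]fsumZ; last exact: finZ.
congr (_ *: _); rewrite rmorphD /=.
exact: (@fsum_Vandermonde R X _ _ xi^-1 _ (fb e)).
Qed.

Lemma Lo0 f : Lo 0 f = f.
Proof.
apply/funext => e; rewrite /Lo /Op (@fsum1 _ _ 0%N); last first.
  by case=> // i _; rewrite /lok rmorph0 cbin0l mul0r mulr0 scale0r.
by rewrite /lok cbin0 chi0 !mul1r scale1r /lor subr0.
Qed.

Lemma Lo1 f : Lo 1 f = fun e => f (e - 1) + xi *: f e.
Proof.
apply/funext => e; rewrite /Lo /Op (@fsum_ord _ _ 2); last first.
  by move=> i i2; rewrite /lok rmorph1 (@cbin_small _ 1) ?mul0r ?mulr0 ?scale0r.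
rewrite !big_ord_recl big_ord0 /= /lok rmorph1 cbin0 cbin11 !mul1r expr1 addr0.
rewrite mulr1 mulfV ?chi_neq0 // scale1r addrC.
by congr (_ + _ *: f _); rewrite /lor /= ?subr0 ?addr0.
Qed.

Lemma LoK a f : lb f -> Lo (- a) (Lo a f) = f.
Proof. by move=> fb; rewrite LoD // addNr Lo0. Qed.

(** For a natural exponent both expansions are the same polynomial. This is the bridge between the
    two directions of expansion. *)
Lemma Up_Lo_nat (n : nat) f : ub f -> lb f -> Up xi n%:R f = Lo n%:R f.
Proof.
move=> fu fl; elim: n => [|n IH]; first by rewrite Up0 Lo0.
by rewrite -natr1 addrC -UpD // IH -LoD // Up1 Lo1.
Qed.

End Lo.

Definition upper (g : rat) Z := exists N : rat, forall b c, Z b c <> 0 ->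
  [/\ b - g \is a Num.int, b <= N & c <= N].
Definition lower (g : rat) Z := exists N : rat, forall b c, Z b c <> 0 ->
  [/\ b - g \is a Num.int, N <= b & N <= c].

Lemma Op_neq0 k r f e : Op k r f e <> 0 -> exists i, f (e - r i) <> 0.
Proof.
by move=> /fsum_neq0[i Hi]; exists i => f0; apply: Hi; rewrite f0 scaler0.
Qed.

Lemma upper_Up2 xi a g Z : upper g Z -> upper g (Op2 (upk xi a) (upr a) Z).
Proof.
move=> [N ZN]; exists (N + `|a|) => b c /Op_neq0[i /ZN[bg bN cN]]; split=> //.
  by apply: le_trans bN _; rewrite lerDl.
have := ler0n rat i; have := ler_norm a; move: cN; rewrite /upr; lra.
Qed.

Lemma lower_Lo2 chi a g Z : lower g Z -> lower g (Op2 (lok chi a) lor Z).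
Proof.
move=> [N ZN]; exists N => b c /Op_neq0[i /ZN[bg bN cN]]; split=> //.
by apply: le_trans cN _; rewrite /lor gerBl.
Qed.

Lemma Dt_neq0 t Z e : Dt t Z e <> 0 -> exists p, Z p (e + t%:R - p) <> 0.
Proof.
by move=> /fsum_neq0[i Hi]; exists i => f0; apply: Hi; rewrite f0 scaler0.
Qed.

Lemma ub_Dt t g Z : upper g Z -> ub (Dt t Z).
Proof.
move=> [N ZN] e.
apply: (@fin_le _ _ (Dt t Z) (fun i => e + i%:R) (N + N - e)) => i /Dt_neq0[p /ZN[_ pN qN]].
have := ler0n rat t; lra.
Qed.

Lemma lb_Dt t g Z : lower g Z -> lb (Dt t Z).
Proof.
move=> [N ZN] e.
apply: (@fin_le _ _ (Dt t Z) (fun i => e - i%:R) (e + t%:R - (N + N))) => i /Dt_neq0[p /ZN[_ pN qN]].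
by lra.
Qed.

Lemma upper_fin g Z : upper g Z -> forall e, fin (fun p => Z p (e - p)).
Proof.
move=> [N ZN] e; apply: finN0.
have [s Hs] := @lattice_seq 1 g (e - N) N ltr01.
exists s => p /ZN[pg pN eN]; apply: Hs; rewrite ?mul1r //; lra.
Qed.

Lemma lower_fin g Z : lower g Z -> forall e, fin (fun p => Z p (e - p)).
Proof.
move=> [N ZN] e; apply: finN0.
have [s Hs] := @lattice_seq 1 g N (e - N) ltr01.
exists s => p /ZN[pg pN eN]; apply: Hs; rewrite ?mul1r //; lra.
Qed.

Lemma Dt_Up2 xi t a g Z : upper g Z ->
  Dt t (Op2 (upk xi a) (upr a) Z) = Up xi a (Dt t Z).
Proof.
move=> [N ZN]; apply/funext => e.
have [s Hs] := @lattice_seq 1 g (e + t%:R - N - `|a|) N ltr01.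
have [s' Hs'] := nat_le_seq (N + N + `|a| - (e + t%:R)).
apply: (@Dt_Op2 _ _ _ _ _ _ _ s s') => p i /ZN[pg pN qN].
have := ler0n rat i; have := ler_norm a; move: qN; rewrite /upr => qN aa i0.
by split; [apply: Hs; rewrite ?mul1r //; lra|apply: Hs'; lra].
Qed.

Lemma Dt_Lo2 chi t a g Z : lower g Z ->
  Dt t (Op2 (lok chi a) lor Z) = Lo chi a (Dt t Z).
Proof.
move=> [N ZN]; apply/funext => e.
have [s Hs] := @lattice_seq 1 g N (e + t%:R - N) ltr01.
have [s' Hs'] := nat_le_seq (e + t%:R - (N + N)).
apply: (@Dt_Op2 _ _ _ _ _ _ _ s s') => p i /ZN[pg pN qN].
have := ler0n rat i; move: qN; rewrite /lor => qN i0.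
by split; [apply: Hs; rewrite ?mul1r //; lra|apply: Hs'; lra].
Qed.

(* Both formulas expand (x2 + x0 + xi)^a in powers of x0. *)
Lemma Dt_Up xi t a a' g Z e : upper g Z ->
  Dt t (Op1 (upk xi a) (upr a) (Op2 (upk xi a') (upr a') Z)) e =
  \sum_(j < t.+1) cbin (ratr a : C) j *: Up xi (a - j%:R + a') (Dt (t - j) Z) e.
Proof.
move=> Zu; have [N ZN] := upper_Up2 xi a' Zu.
have [s Hs] := @lattice_seq 1 (g + a) (e + t%:R - N) (N + a) ltr01.
have [s' Hs'] := nat_le_seq (N + N + a - (e + t%:R)).
rewrite (@Dt_Op1 _ _ _ _ _ _ _ s s'); last first.
  move=> p i /ZN; rewrite /upr => -[pg pN qN]; have i0 := ler0n rat i.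
  split; [apply: Hs|apply: Hs'; lra]; try lra.
  rewrite (_ : _ - _ = p - (a - i%:R) - g - i%:R); last by ring.
  by rewrite rpredB // intr_nat.
apply: eq_bigr => j _; rewrite (Dt_Up2 _ _ _ Zu).
have ubD := ub_Dt (t - j) Zu.
rewrite -UpD // /Up {3}/Op -fsumZ; last first.
  by apply/finZ/ub_upr/ub_Up.
apply: eq_fsum => i; rewrite scalerA; congr (_ *: Op _ _ _ _).
  rewrite /upk /upr !rmorphB /= !rmorph_nat mulrAC cbin_mulC; ring.
rewrite /upr; ring.
Qed.

Lemma Dt_Lo chi t a a' g Z e :
  chi 0 = 1 -> (forall a b, chi (a + b) = chi a * chi b) -> lower g Z ->
  Dt t (Op1 (lok chi a) lor (Op2 (lok chi a') lor Z)) e =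
  \sum_(j < t.+1) cbin (ratr a : C) j *: Lo chi (a - j%:R + a') (Dt (t - j) Z) e.
Proof.
move=> chi0 chiD Zu; have [N ZN] := lower_Lo2 chi a' Zu.
have [s Hs] := @lattice_seq 1 g N (e + t%:R - N) ltr01.
have [s' Hs'] := nat_le_seq (e + t%:R - (N + N)).
rewrite (@Dt_Op1 _ _ _ _ _ _ _ s s'); last first.
  clear chi0 chiD; move=> p i /ZN; rewrite /lor => -[pg pN qN].
  have i0 := ler0n rat i.
  split; [apply: Hs|apply: Hs'; lra]; try lra.
  rewrite (_ : _ - _ = p - i%:R - g + i%:R); last by ring.
  by rewrite rpredD // intr_nat.
apply: eq_bigr => j _; rewrite (Dt_Lo2 _ _ _ Zu).
have lbD := lb_Dt (t - j) Zu.
rewrite -LoD // {2}/Lo /Op -fsumZ; last exact/finZ/lb_Lo.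
have LbD := lb_Lo chi a' lbD.
(* The Leibniz coefficient is binom(i, j), which is 0 for i < j; after the shift, [cbin_sub]
   extracts binom(a, j). *)
rewrite (@fsum_shiftn _ j); first last.
- have [s1 H1] := LbD (e + j%:R); exists s1 => i /H1; rewrite /lor => ->.
  by rewrite scaler0.
- move=> i ij; rewrite /lor rmorph_nat cbin_small ?mulr0 ?scale0r //.
apply: eq_fsum => i; rewrite scalerA /lor; congr (_ *: Lo _ _ _ _).
  rewrite /lok chiB // !rmorphB /= !rmorph_nat exprD.
  have := cbin_sub (ratr a : C) j i.
  set x := cbin _ (j + i); set y := cbin _ j; set y' := cbin (ratr a) j.
  set w := cbin _ i => E.
  transitivity (chi a * (x * y) * ((chi 1)^-1 ^+ j * (chi 1)^-1 ^+ i)); first by ring.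
  by rewrite E; ring.
by rewrite natrD; ring.
Qed.

End BinomialSeries.

(** * Series in two variables with finite support in quadrants *)

Section Quadrants.
Variables (R : realType) (X : lmodType R[i]).
Local Notation C := R[i].
Implicit Types (F Z : rat -> rat -> X) (a b c g s zeta : rat).

(* finite support in every quadrant (b + s N) x (c + s N); used for s = 1, -1 *)
Definition quad s F := forall b c, exists n : nat, forall i j : nat,
  F (b + s * i%:R) (c + s * j%:R) <> 0 -> (i < n)%N /\ (j < n)%N.

Lemma quad_flip s F : quad s F -> quad s (flip F).
Proof.
by move=> Fq b c; have [n Hn] := Fq c b; exists n => i j /Hn[].
Qed.

(** Iterated truncation suffices: the first exponent has a global bound, so a quadrant meets
    finitely many first exponents, and over these the bounds for the second exponent have a
    maximum. *)
Lemma quad_of s F : s = 1 \/ s = -1 ->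
  (exists N, forall b c, F b c <> 0 -> s * b <= N) ->
  (forall b, exists M, forall c, F b c <> 0 -> s * c <= M) -> quad s F.
Proof.
move=> s1 [N FN] FM b c.
have ss : s * s = 1 by case: s1 => ->; ring.
have [n Hn] : exists n : nat, forall i : nat, s * b + i%:R <= N -> (i < n)%N.
  exists (Num.bound (N - s * b)).+1 => i Hi; rewrite ltnS -(ler_nat rat).
  have i0 := ler0n rat i; apply: le_trans (ltW (archi_boundP _)); lra.
have [m Hm] : exists m : nat, forall i j : nat, (i < n)%N ->
    F (b + s * i%:R) (c + s * j%:R) <> 0 -> (j < m)%N.
  elim: n {Hn} => [|n [m IH]]; first by exists 0%N.
  have [M HM] := FM (b + s * n%:R).
  exists (maxn m (Num.bound (M - s * c)).+1) => i j.
  rewrite ltnS leq_eqVlt => /orP[/eqP -> {i}|/IH h /h]; last first.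
    by move=> jm; rewrite leq_max jm.
  move=> /HM; rewrite mulrDr mulrA ss mul1r => Hj.
  rewrite leq_max; apply/orP; right; rewrite ltnS -(ler_nat rat).
  have j0 := ler0n rat j; apply: le_trans (ltW (archi_boundP _)); lra.
exists (maxn n m) => i j Fij.
have := FN _ _ Fij; rewrite mulrDr mulrA ss mul1r => /Hn ni.
by rewrite !leq_max ni (Hm _ _ ni Fij) orbT.
Qed.

Lemma quad_Dl s (zeta : C) F : quad s F -> quad s (Dl zeta F).
Proof.
move=> Fq b c; have [n1 H1] := Fq b c; have [n2 H2] := Fq (b - 1) c.
have [n3 H3] := Fq b (c - 1).
exists (maxn n1 (maxn n2 n3)) => i j D0; rewrite !leq_max.
have [F1|/H1[-> ->] //] := pselect (F (b + s * i%:R) (c + s * j%:R) = 0).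
have [F2|/H2[-> ->]] := pselect (F (b - 1 + s * i%:R) (c + s * j%:R) = 0); last first.
  by rewrite !orbT.
have [F3|/H3[-> ->]] := pselect (F (b + s * i%:R) (c - 1 + s * j%:R) = 0); last first.
  by rewrite !orbT.
exfalso; apply: D0; rewrite /Dl F1 scaler0 add0r [b + _ - 1]addrAC F2.
by rewrite [c + _ - 1]addrAC F3 subrr.
Qed.

Lemma quad_iter_Dl s (zeta : C) m F : quad s F -> quad s (iter m (Dl zeta) F).
Proof. by move=> Fq; elim: m => //= m; apply: quad_Dl. Qed.

Section Up.
Variables xi xi' : C.
Local Notation Up1 a := (Op1 (upk xi a) (upr a)).
Local Notation Up2 a := (Op2 (upk xi' a) (upr a)).

Lemma quad_Up2 a F : quad 1 F -> quad 1 (Up2 a F).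
Proof.
move=> Fq b c; have [n Hn] := Fq b (c - a); exists n => i j /Op_neq0[k].
rewrite (_ : _ - upr a k = c - a + 1 * (j + k)%N%:R); last first.
  by rewrite /upr natrD; ring.
by case/Hn => -> /(leq_ltn_trans (leq_addr _ _)).
Qed.

Lemma quad_Up_fin1 a F : quad 1 F -> forall b c, fin (fun i => F (b - upr a i) c).
Proof.
move=> Fq b c; have [n Hn] := Fq (b - a) c; apply: (@fin_nat _ _ n) => i ni.
apply: contrapT => Fi; have [] := Hn i 0%N; last by rewrite ltnNge ni.
by rewrite mulr0 addr0 mul1r (_ : _ + _ = b - upr a i) // /upr; ring.
Qed.

Lemma quad_Up_fin2 a F : quad 1 F -> forall b c, fin (fun i => F b (c - upr a i)).
Proof. by move=> /quad_flip/(quad_Up_fin1 a) H b c; apply: H. Qed.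

Lemma Up_exch a a' F : quad 1 F -> Up1 a (Up2 a' F) = Up2 a' (Up1 a F).
Proof.
move=> Fq; apply: funext2 => b c.
have [n Hn] := Fq (b - a) (c - a').
apply: (@Op_exch _ _ _ _ _ _ _ _ _ (iota 0 n) (iota 0 n)) => i j.
rewrite (_ : b - _ = b - a + 1 * i%:R); last by rewrite /upr; ring.
rewrite (_ : c - _ = c - a' + 1 * j%:R); last by rewrite /upr; ring.
by rewrite !mem_iota !add0n; apply: Hn.
Qed.

Lemma Up12_Dl a a' (zeta : C) m F : quad 1 F ->
  Up1 a (Up2 a' (iter m (Dl zeta) F)) = iter m (Dl zeta) (Up1 a (Up2 a' F)).
Proof.
move=> Fq; elim: m => //= m IH; have q := quad_iter_Dl zeta m Fq.
rewrite -IH; apply: funext2 => b c.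
rewrite -Op1_Dl; last exact/quad_Up_fin1/quad_Up2.
rewrite (_ : Op2 _ _ (Dl _ _) = Dl zeta (Up2 a' (iter m (Dl zeta) F))) //.
apply: funext2 => b' c'; rewrite Op2_Dl //.
exact/quad_Up_fin2.
Qed.

End Up.

Section Lo.
Variables (chi chi' : rat -> C).
Hypotheses (chi0 : chi 0 = 1) (chiD : forall a b, chi (a + b) = chi a * chi b).
Hypotheses (chi0' : chi' 0 = 1) (chiD' : forall a b, chi' (a + b) = chi' a * chi' b).
Local Notation Lo1 a := (Op1 (lok chi a) lor).
Local Notation Lo2 a := (Op2 (lok chi' a) lor).

Lemma quad_Lo2 a F : quad (-1) F -> quad (-1) (Lo2 a F).
Proof.
move=> Fq b c; have [n Hn] := Fq b c; exists n => i j /Op_neq0[k].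
rewrite (_ : _ - lor k = c + -1 * (j + k)%N%:R); last first.
  by rewrite /lor natrD; ring.
by case/Hn => -> /(leq_ltn_trans (leq_addr _ _)).
Qed.

Lemma quad_Lo1 a F : quad (-1) F -> quad (-1) (Lo1 a F).
Proof.
move=> Fq b c; have [n Hn] := Fq b c; exists n => i j /Op_neq0[k].
rewrite (_ : _ - lor k = b + -1 * (i + k)%N%:R); last first.
  by rewrite /lor natrD; ring.
by case/Hn => /(leq_ltn_trans (leq_addr _ _)).
Qed.

Lemma quad_Lo_lb1 F : quad (-1) F -> forall c, lb (F^~ c).
Proof.
move=> Fq c b; have [n Hn] := Fq b c; apply: (@fin_nat _ _ n) => i ni.
apply: contrapT => Fi; have [] := Hn i 0%N; last by rewrite ltnNge ni.
by rewrite mulr0 addr0 mulN1r.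
Qed.

Lemma quad_Lo_lb2 F : quad (-1) F -> forall b, lb (F b).
Proof. by move=> /quad_flip/quad_Lo_lb1 H b; apply: H. Qed.

Lemma Lo_exch a a' F : quad (-1) F -> Lo1 a (Lo2 a' F) = Lo2 a' (Lo1 a F).
Proof.
move=> Fq; apply: funext2 => b c.
have [n Hn] := Fq b c.
apply: (@Op_exch _ _ _ _ _ _ _ _ _ (iota 0 n) (iota 0 n)) => i j.
rewrite (_ : b - _ = b + -1 * i%:R); last by rewrite /lor; ring.
rewrite (_ : c - _ = c + -1 * j%:R); last by rewrite /lor; ring.
by rewrite !mem_iota !add0n; apply: Hn.
Qed.

Lemma Lo12_Dl a a' (zeta : C) m F : quad (-1) F ->
  Lo1 a (Lo2 a' (iter m (Dl zeta) F)) = iter m (Dl zeta) (Lo1 a (Lo2 a' F)).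
Proof.
move=> Fq; elim: m => //= m IH; have q := quad_iter_Dl zeta m Fq.
rewrite -IH; apply: funext2 => b c.
rewrite -Op1_Dl; last by move=> b' c'; apply/quad_Lo_lb1/quad_Lo2.
rewrite (_ : Op2 _ _ (Dl _ _) = Dl zeta (Lo2 a' (iter m (Dl zeta) F))) //.
apply: funext2 => b' c'; rewrite Op2_Dl //.
by move=> b'' c''; apply: quad_Lo_lb2.
Qed.

Lemma Lo1_Dl a (zeta : C) m F : quad (-1) F ->
  Lo1 a (iter m (Dl zeta) F) = iter m (Dl zeta) (Lo1 a F).
Proof.
move=> Fq; elim: m => //= m <-.
apply: funext2 => b c; rewrite -Op1_Dl // => b' c'.
exact/quad_Lo_lb1/quad_iter_Dl.
Qed.

Lemma Lo12_inj a a' F G : quad (-1) F -> quad (-1) G ->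
  Lo1 a (Lo2 a' F) = Lo1 a (Lo2 a' G) -> F = G.
Proof.
have K H : quad (-1) H -> Lo2 (- a') (Lo1 (- a) (Lo1 a (Lo2 a' H))) = H.
  move=> Hq; apply: funext2 => b c.
  rewrite (_ : Lo1 (- a) _ = Lo2 a' H).
    by rewrite /Op2 -!/(Lo chi' _) LoK //; apply: quad_Lo_lb2.
  apply: funext2 => b' c'; rewrite /Op1 -!/(Lo chi _).
  by rewrite (LoK chi0 chiD a (quad_Lo_lb1 (quad_Lo2 a' Hq) c')).
by move=> Fq Gq E; rewrite -(K _ Fq) -(K _ Gq) E.
Qed.

End Lo.

(** The nonzero constant term makes zeta + x1 - x2 cancellable: a difference killed by it is
    determined at (b, c) by its values at smaller exponents, which eventually leave the support. *)
Lemma Dl_inj (zeta : C) m F G : zeta != 0 -> quad (-1) F -> quad (-1) G ->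
  iter m (Dl zeta) F = iter m (Dl zeta) G -> F = G.
Proof.
move=> z0; elim: m F G => //= m IH F G Fq Gq E; apply: IH => //.
have {E} : Dl zeta (iter m (Dl zeta) F) = Dl zeta (iter m (Dl zeta) G) by [].
move: (quad_iter_Dl zeta m Fq) (quad_iter_Dl zeta m Gq).
move: (iter m _ F) (iter m _ G) => {Fq Gq}F {}G Fq Gq E.
pose H b c := F b c - G b c.
have HE b c : H b c = zeta^-1 *: (H b (c - 1) - H (b - 1) c).
  have := congr1 (fun K => K b c) E; rewrite /Dl /H => e.
  have e' : zeta *: (F b c - G b c) = F b (c - 1) - G b (c - 1) - (F (b - 1) c - G (b - 1) c).
    rewrite scalerBr; move: e; set x := zeta *: _; set y := zeta *: _ => e.
    have -> : x = y + G (b - 1) c - G b (c - 1) + F b (c - 1) - F (b - 1) c.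
      by rewrite -e subrK addrK.
    rewrite opprB !addrA [LHS](ACl ((1*6)*4*3*2*5)) /= subrr add0r.
    by rewrite addrAC.
  by rewrite -e' scalerA mulVf // scale1r.
(* Iterating the recursion n times expresses [H b c] through the values n steps below; n is then
   chosen so large that one coordinate of each of these points is outside both supports. *)
have H0 n b c : (forall i j : nat, (i + j = n)%N -> H (b - i%:R) (c - j%:R) = 0) -> H b c = 0.
  elim: n b c => [|n IHn] b c Hn; first by have := Hn 0%N 0%N erefl; rewrite !subr0.
  rewrite HE [H b _]IHn ?[H (b - 1) c]IHn ?subrr ?scaler0 // => i j ij.
    rewrite (_ : b - 1 - i%:R = b - i.+1%:R); last by rewrite -natr1; ring.
    by apply: Hn; rewrite addSn ij.
  rewrite (_ : c - 1 - j%:R = c - j.+1%:R); last by rewrite -natr1; ring.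
  by apply: Hn; rewrite addnS ij.
apply: funext2 => b c; apply/eqP; rewrite -subr_eq0; apply/eqP.
have [n1 H1] := Fq b c; have [n2 H2] := Gq b c.
apply: (H0 (n1 + n1 + (n2 + n2))%N) => i j ij; rewrite /H.
have -> : F (b - i%:R) (c - j%:R) = 0.
  by apply: contrapT; rewrite -[- i%:R]mulN1r -[- j%:R]mulN1r => /H1[]; lia.
have -> : G (b - i%:R) (c - j%:R) = 0.
  by apply: contrapT; rewrite -[- i%:R]mulN1r -[- j%:R]mulN1r => /H2[]; lia.
exact: subrr.
Qed.

End Quadrants.

Lemma iter_Dl_neq0 (R : realType) (X : lmodType R[i]) (zeta : R[i]) m
    (F : rat -> rat -> X) b c :
  iter m (Dl zeta) F b c <> 0 ->
  exists i j : nat, [/\ (i <= m)%N, (j <= m)%N & F (b - i%:R) (c - j%:R) <> 0].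
Proof.
elim: m b c => [|m IH] b c; first by exists 0%N, 0%N; rewrite !subr0.
move=> /= D0.
have [F1|/IH[i [j [im jm Hij]]]] := pselect (iter m (Dl zeta) F b c = 0); last first.
  by exists i, j; split=> //; apply: leqW.
have [F2|/IH[i [j [im jm Hij]]]] := pselect (iter m (Dl zeta) F (b - 1) c = 0); last first.
  exists i.+1, j; split; [by []|exact: leqW|].
  by rewrite (_ : b - _ = b - 1 - i%:R) // -natr1; ring.
have [F3|/IH[i [j [im jm Hij]]]] := pselect (iter m (Dl zeta) F b (c - 1) = 0); last first.
  exists i, j.+1; split; [exact: leqW|by []|].
  by rewrite (_ : c - _ = c - 1 - j%:R) // -natr1; ring.
by exfalso; apply: D0; rewrite /Dl F1 F2 F3 scaler0 addr0 subrr.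
Qed.

(** * Regularization *)

Section Regularization.
Variables (R : realType) (W : Type).
Local Notation C := R[i].
Variable chi : rat -> C.
Hypotheses (chi0 : chi 0 = 1) (chiD : forall a b, chi (a + b) = chi a * chi b).
Local Notation xi := (chi 1).
Implicit Types (f g : rat -> W -> C^o) (a p : rat).

Definition UpW a f : rat -> W -> C^o := fun e w => Up xi a (f^~ w) e.
Definition LoW a f : rat -> W -> C^o := fun e w => Lo chi a (f^~ w) e.
Definition ubw f := forall w, ub (f^~ w).
Definition trunc f := exists N : rat, forall e w, e < N -> f e w = 0.

(* g is the expansion in nonnegative powers of x of the function whose
   expansion in nonnegative powers of xi is f, with a pole of exponent in
   - p - N at x = - xi. *)
Definition reg p f g := trunc g /\
  exists k0 : nat, forall k, (k0 <= k)%N -> UpW (p + k%:R) f = LoW (p + k%:R) g.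

Lemma trunc_lb g : trunc g -> forall w, lb (g^~ w).
Proof.
move=> [N gN] w e; apply: (@fin_le _ _ (g^~ w) (fun i => e - i%:R) (e - N)) => i gi.
rewrite leNgt; apply/negP => lt; apply: gi; apply: gN; lra.
Qed.

Lemma ubw_UpW a f : ubw f -> ubw (UpW a f).
Proof. by move=> fb w; apply: ub_Up. Qed.

Lemma UpWD a b f : ubw f -> UpW b (UpW a f) = UpW (b + a) f.
Proof.
by move=> fb; apply: funext2 => e w; rewrite {1}/UpW UpD.
Qed.

Lemma LoWD a b f : trunc f -> LoW b (LoW a f) = LoW (b + a) f.
Proof.
move=> /trunc_lb fb; apply: funext2 => e w; rewrite {1}/LoW.
by rewrite LoD.
Qed.

Lemma LoW0 f : LoW 0 f = f.
Proof. by apply: funext2 => e w; rewrite /LoW Lo0. Qed.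

Lemma trunc_LoW a f : trunc f -> trunc (LoW a f).
Proof.
move=> [N fN]; exists N => e w eN; apply: fsum0 => i.
by rewrite fN ?scaler0 // /lor; have := ler0n rat i; lra.
Qed.

Lemma UpW_LoW_nat (n : nat) f : ubw f -> trunc f -> UpW n%:R f = LoW n%:R f.
Proof.
move=> fu /trunc_lb fl; apply: funext2 => e w.
by rewrite /UpW /LoW Up_Lo_nat.
Qed.

(** The inverse power applied to one truncated regularization gives the series. For k' >= k the
    additional factor is a natural power, on which the two expansions agree. *)
Lemma reg_ex p (k : nat) f : ubw f -> trunc (UpW (p + k%:R) f) ->
  reg p f (LoW (- (p + k%:R)) (UpW (p + k%:R) f)).
Proof.
move=> fb ft; split; first exact: trunc_LoW.
exists k => k' kk; rewrite LoWD //.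
have -> : p + k'%:R - (p + k%:R) = (k' - k)%N%:R by rewrite natrB //; ring.
rewrite -UpW_LoW_nat //; last exact: ubw_UpW.
by rewrite UpWD //; congr (UpW _ f); rewrite natrB //; ring.
Qed.

Lemma reg_uniq p f g g' : reg p f g -> reg p f g' -> g = g'.
Proof.
move=> [gt [k1 H1]] [gt' [k2 H2]].
have K h : trunc h -> h = LoW (- (p + (maxn k1 k2)%:R)) (LoW (p + (maxn k1 k2)%:R) h).
  by move=> ht; rewrite LoWD // addNr LoW0.
by rewrite (K g) // (K g') // -H1 ?leq_maxl // -H2 ?leq_maxr.
Qed.

(** [reg] speaks of large k only; uniqueness against [reg_ex] extends the equality to every k for
    which the left side is truncated. *)
Lemma reg_at p (k : nat) f g : ubw f -> reg p f g -> trunc (UpW (p + k%:R) f) ->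
  UpW (p + k%:R) f = LoW (p + k%:R) g.
Proof.
move=> fb fg ft; rewrite (reg_uniq fg (reg_ex fb ft)) LoWD //.
by rewrite subrr LoW0.
Qed.

Lemma reg_trunc p f g : reg p f g ->
  exists k0 : nat, forall k, (k0 <= k)%N -> trunc (UpW (p + k%:R) f).
Proof.
by move=> [gt [k0 H]]; exists k0 => k /H ->; apply: trunc_LoW.
Qed.

Lemma UpW_lin a f g (x : C) : ubw f -> ubw g ->
  UpW a (fun e w => x * f e w + g e w) = fun e w => x * UpW a f e w + UpW a g e w.
Proof.
move=> fb gb; apply: funext2 => e w.
have := @Op_lin R _ (upk xi a) (upr a) (f^~ w) (g^~ w) x 1 e
          (ub_upr _ _ (fb w)) (ub_upr _ _ (gb w)).
by rewrite scale1r /UpW /Up => <-; apply: eq_Op => e'; rewrite scale1r.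
Qed.

Lemma LoW_lin a f g (x : C) : trunc f -> trunc g ->
  LoW a (fun e w => x * f e w + g e w) = fun e w => x * LoW a f e w + LoW a g e w.
Proof.
move=> /trunc_lb fb /trunc_lb gb; apply: funext2 => e w.
have := @Op_lin R _ (lok chi a) lor (f^~ w) (g^~ w) x 1 e (fb w e) (gb w e).
by rewrite scale1r /LoW /Lo => <-; apply: eq_Op => e'; rewrite scale1r.
Qed.

Lemma trunc_lin f g (x : C) : trunc f -> trunc g ->
  trunc (fun e w => x * f e w + g e w).
Proof.
move=> [N fN] [M gM]; exists (Num.min N M) => e w.
by rewrite lt_min => /andP[/fN-> /gM->]; rewrite mulr0 addr0.
Qed.

Lemma reg_lin p f g f' g' (x : C) : ubw f -> ubw f' ->
  reg p f g -> reg p f' g' ->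
  reg p (fun e w => x * f e w + f' e w) (fun e w => x * g e w + g' e w).
Proof.
move=> fb fb' [gt [k1 H1]] [gt' [k2 H2]]; split; first exact: trunc_lin.
exists (maxn k1 k2) => k; rewrite geq_max => /andP[/H1 E1 /H2 E2].
by rewrite UpW_lin // LoW_lin // E1 E2.
Qed.

Lemma reg0 p : reg p (fun _ _ => 0) (fun _ _ => 0).
Proof.
split; first by exists 0.
exists 0%N => k _; apply: funext2 => e w.
by rewrite /UpW /LoW /Up /Lo /Op !fsum0 // => i; rewrite scaler0.
Qed.

(** Only the class of p modulo 1 matters. This is needed because an eigenvalue determines the degree
    j modulo T only. *)
Lemma reg_int p (n : int) f g : reg p f g -> reg (p + n%:~R) f g.
Proof.
move=> [gt [k0 H]]; split=> //; exists (k0 + `|n|)%N => k kk.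
have -> : p + n%:~R + k%:R = p + (absz (n + k%:Z)%R)%:R.
  by rewrite -addrA; congr (_ + _); rewrite !pmulrn -intrD; congr (_ %:~R); lia.
apply: H; lia.
Qed.

Lemma UpW_coset a f (d : rat) :
  (forall e w, f e w <> 0 -> e + d \is a Num.int) ->
  forall e w, UpW a f e w <> 0 -> e + d - a \is a Num.int.
Proof.
move=> fd e w /Op_neq0[i /fd]; rewrite /upr => H.
rewrite (_ : e + d - a = e - (a - i%:R) + d - i%:R); last by ring.
by rewrite rpredB // intr_nat.
Qed.

Lemma LoW_coset a f (d : rat) :
  (forall e w, f e w <> 0 -> e + d \is a Num.int) ->
  forall e w, LoW a f e w <> 0 -> e + d \is a Num.int.
Proof.
move=> fd e w /Op_neq0[i /fd]; rewrite /lor => H.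
rewrite (_ : e + d = e - i%:R + d + i%:R); last by ring.
by rewrite rpredD // intr_nat.
Qed.

(** The factor (x + xi)^p moves the exponents of f from the coset of -(p+q) to that of -q, and
    expansion in powers of x preserves cosets. *)
Lemma reg_coset p q f g : ubw f -> (forall e w, f e w <> 0 -> e + (p + q) \is a Num.int) ->
  reg p f g -> forall e w, g e w <> 0 -> e + q \is a Num.int.
Proof.
move=> fb fd fg; have [k0 /(_ _ (leqnn _)) H] := reg_trunc fg.
rewrite (reg_uniq fg (reg_ex fb H)); apply: LoW_coset => e w.
move/(UpW_coset fd); rewrite (_ : e + (p + q) - _ = e + q - k0%:R); last by ring.
by move=> H0; rewrite -(subrK k0%:R (e + q)) rpredD // intr_nat.
Qed.

Section Family.
Variables (p : rat) (Eu : rat -> W -> W) (gv : rat -> W -> C^o).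
Variable h : rat -> rat -> W -> C^o.
Hypothesis gv_trunc : trunc gv.
Hypothesis gh : forall c, reg p (fun b w => gv c (Eu b w)) (h c).

Lemma reg_family_glb : exists N : rat, forall b c w, c < N -> h c b w = 0.
Proof.
have [N HN] := gv_trunc; exists N => b c w cN.
have := gh c; rewrite (_ : (fun b w => _) = fun _ _ => 0); last first.
  by apply: funext2 => e w'; rewrite HN.
by move=> /(reg_uniq (reg0 p)) <-.
Qed.

(** The regularized family is truncated in c uniformly in b, since it inherits the zeros of [gv] by
    uniqueness, and truncated in b for each fixed c. *)
Lemma reg_family_quad w : quad (-1) (fun b c => h c b w).
Proof.
apply: (@quad_flip _ _ _ (fun c b => h c b w)); apply: quad_of; first by right.
  have [N HN] := reg_family_glb; exists (- N) => c b h0; rewrite mulN1r lerN2 leNgt.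
  by apply/negP => /HN.
move=> c; have [N HN] := proj1 (gh c); exists (- N) => b h0; rewrite mulN1r lerN2.
by rewrite leNgt; apply/negP => /HN.
Qed.

End Family.

End Regularization.

Section Linearity.
Variables (R : realType) (W : lmodType R[i]).
Local Notation C := R[i].
Variable chi : rat -> C.
Implicit Types (f : rat -> W -> C^o).

Lemma scalar_UpW a f : ubw f -> (forall e, scalar (f e)) ->
  forall e, scalar (UpW chi a f e).
Proof.
move=> fb fl e x w w'; rewrite /UpW /Up.
have := @Op_lin R _ (upk (chi 1) a) (upr a) (f^~ w) (f^~ w') x 1 e
          (ub_upr _ _ (fb w)) (ub_upr _ _ (fb w')).
by rewrite scale1r => <-; apply: eq_Op => e'; rewrite fl scale1r.
Qed.

Lemma scalar_LoW a f : trunc f -> (forall e, scalar (f e)) ->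
  forall e, scalar (LoW chi a f e).
Proof.
move=> /trunc_lb fb fl e x w w'; rewrite /LoW /Lo.
have := @Op_lin R _ (lok chi a) lor (f^~ w) (f^~ w') x 1 e (fb w e) (fb w' e).
by rewrite scale1r => <-; apply: eq_Op => e'; rewrite fl scale1r.
Qed.

Lemma functional0 (f : W -> C^o) : scalar f -> f 0 = 0.
Proof. by move=> fl; have := fl (-1) 0 0; rewrite scaler0 addr0 mulN1r addNr. Qed.

Lemma functionalD (f : W -> C^o) : scalar f -> {morph f : x y / x + y}.
Proof. by move=> fl x y; have := fl 1 x y; rewrite scale1r mul1r. Qed.

Lemma functionalZ (f : W -> C^o) : scalar f -> forall a x, f (a *: x) = a * f x.
Proof. by move=> fl a x; have := fl a x 0; rewrite addr0 (functional0 fl) addr0. Qed.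

Lemma functionalB (f : W -> C^o) : scalar f -> forall x y, f (x - y) = f x - f y.
Proof.
by move=> fl x y; rewrite functionalD // -scaleN1r functionalZ // mulN1r.
Qed.

End Linearity.

(** * Contragredient operators and closure of the space under their regularizations *)

Section OneSided.
Variables (R : realType) (V : lmodType R[i]) (A : vertex_algebra V).
Variable (W : lmodType R[i]).
Local Notation C := R[i].
Variable chi : rat -> C.
Hypotheses (chi0 : chi 0 = 1) (chiD : forall a b, chi (a + b) = chi a * chi b).
Local Notation xi := (chi 1).
Variables (E : V -> rat -> W -> W) (H : rat -> rat -> V -> Prop).
Implicit Types (f : W -> C^o) (g : rat -> W -> C^o) (u v : V) (a p q : rat).
Local Notation Up1 a := (Op1 (upk xi a) (upr a)).
Local Notation Up2 a := (Op2 (upk xi a) (upr a)).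
Local Notation Lo1 a := (Op1 (lok chi a) lor).
Local Notation Lo2 a := (Op2 (lok chi a) lor).

Definition dl v f : rat -> W -> C^o := fun e w => f (E v e w).
(** The contragredient operator of u applied to that of v applied to f: dualizing reverses the
    order, so [E u] acts on w before [E v]. *)
Definition dl2 u v f w : rat -> rat -> C^o := fun b c => f (E v c (E u b w)).

(** [H p q v] says that v is homogeneous with exponent p at the pole - xi and q at the other finite
    pole; together they determine the coset of exponents at infinity. *)
Record presystem : Prop := PreSystem {
  sys_lin : forall v e, linear (E v e);
  sys_ub : forall v w, exists N : rat, forall e, N < e -> E v e w = 0;
  sys_coset : forall p q v e w, H p q v -> E v e w <> 0 ->
    e + (p + q) \is a Num.int
}.

Section PreSystem.
Hypothesis preE : presystem.

Lemma sys_lin0 v e : E v e 0 = 0.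
Proof. exact: linear_fun0 (sys_lin preE v e). Qed.

Lemma dl_neq0 v f e w : scalar f -> dl v f e w <> 0 -> E v e w <> 0.
Proof. by move=> fl f0 E0; apply: f0; rewrite /dl E0 functional0. Qed.

Lemma dl_ub v f : scalar f -> ubw (dl v f).
Proof.
move=> fl w e; have [N HN] := sys_ub preE v w.
apply: (@fin_le _ _ ((dl v f)^~ w) (fun i => e + i%:R) (N - e)) => i /(dl_neq0 fl) Ei.
by rewrite leNgt; apply/negP => lt; apply: Ei; apply: HN; lra.
Qed.

Lemma dl_coset p q v f e w : scalar f -> H p q v ->
  dl v f e w <> 0 -> e + (p + q) \is a Num.int.
Proof. by move=> fl vH /(dl_neq0 fl)/(sys_coset preE vH). Qed.

Lemma dl_scalar v f e : scalar f -> scalar (dl v f e).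
Proof. by move=> fl x w w'; rewrite /dl (sys_lin preE) fl. Qed.

Lemma dl2_neq0 u v f w b c : scalar f -> dl2 u v f w b c <> 0 ->
  E u b w <> 0 /\ E v c (E u b w) <> 0.
Proof.
move=> fl f0; split=> E0; apply: f0; rewrite /dl2 E0 ?sys_lin0; exact: functional0.
Qed.

Lemma quad_dl2 u v f w : scalar f -> quad 1 (dl2 u v f w).
Proof.
move=> fl; apply: quad_of; first by left.
  have [N HN] := sys_ub preE u w; exists N => b c /(dl2_neq0 fl)[Ei _].
  by rewrite mul1r leNgt; apply/negP => /HN.
move=> b; have [N HN] := sys_ub preE v (E u b w); exists N => c.
by move=> /(dl2_neq0 fl)[_ Ei]; rewrite mul1r leNgt; apply/negP => /HN.
Qed.

(** Each order of the operators bounds the exponent of the one acting first; locality lets the same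
    series have both bounds. *)
Lemma upper_dl2 p q p' q' u v f w m : scalar f -> H p q u -> H p' q' v ->
  iter m (Dl 0) (dl2 u v f w) = iter m (Dl 0) (flip (dl2 v u f w)) ->
  upper (- (p + q)) (iter m (Dl 0) (dl2 u v f w)).
Proof.
move=> fl uH vH D12.
have [N HN] := sys_ub preE u w; have [M HM] := sys_ub preE v w.
have h1 : N <= Num.max N M by rewrite le_max lexx.
have h2 : M <= Num.max N M by rewrite le_max lexx orbT.
exists (Num.max N M + m%:R) => b c Z0; split.
- have [i [j [im jm /(dl2_neq0 fl)[Eu _]]]] := iter_Dl_neq0 Z0.
  have := sys_coset preE uH Eu => Hi.
  by rewrite opprK -(subrK i%:R b) addrAC rpredD // intr_nat.
- have [i [j [im jm /(dl2_neq0 fl)[Eu _]]]] := iter_Dl_neq0 Z0.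
  have im' : i%:R <= m%:R :> rat by rewrite ler_nat.
  have : b - i%:R <= N by rewrite leNgt; apply/negP => /HN.
  lra.
rewrite D12 in Z0; have [i [j [im jm /(dl2_neq0 fl)[Ev _]]]] := iter_Dl_neq0 Z0.
have jm' : j%:R <= m%:R :> rat by rewrite ler_nat.
have : c - j%:R <= M by rewrite leNgt; apply/negP => /HM.
lra.
Qed.

End PreSystem.

(** Membership in the regular space seen from one pole. Integrality of exponents follows from
    [sys_coset], so truncation, uniform in w, is what remains of the Laurent condition. *)
Definition inD f := scalar f /\ forall p q v, H p q v ->
  exists k : nat, trunc (UpW chi (p + k%:R) (dl v f)).

(* The contragredient operators f |-> f \o E v e satisfy a twisted Jacobi
   identity, stated as locality together with the iterate formula. *)
Record system : Prop := System {
  sys_pre :> presystem;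
  sys_comm : forall p q p' q' u v, H p q u -> H p' q' v -> exists m : nat,
    (forall j, j < - m%:Z -> A u j v = 0) /\
    forall f w, scalar f ->
      iter m (Dl 0) (dl2 u v f w) = iter m (Dl 0) (flip (dl2 v u f w)) /\
      forall t e, f (E (A u (t%:Z - m%:Z) v) e w) =
                  Dt t (iter m (Dl 0) (dl2 u v f w)) e
}.

Hypothesis sysE : system.

Definition glb2 (G : rat -> rat -> W -> C^o) :=
  exists N : rat, forall b c w, c < N -> G b c w = 0.
Definition slb1 (G : rat -> rat -> W -> C^o) :=
  forall c, exists M : rat, forall b w, b < M -> G b c w = 0.

Lemma slb1_below G : glb2 G -> slb1 G ->
  forall c, exists M : rat, forall (j : nat) b w, b < M -> G b (c - j%:R) w = 0.
Proof.
move=> [N GN] Gs c.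
have [n Hn] : exists n : nat, c - n%:R < N by have [n] := nat_gt (c - N); exists n; lra.
have [M HM] : exists M : rat, forall (j : nat), (j < n)%N -> forall b w, b < M ->
    G b (c - j%:R) w = 0.
  elim: n {Hn} => [|n [M HM]]; first by exists 0.
  have [M' HM'] := Gs (c - n%:R); exists (Num.min M M') => j.
  rewrite ltnS leq_eqVlt => /orP[/eqP->|/HM H0] b w; rewrite lt_min => /andP[h1 h2].
    exact: HM'.
  exact: H0.
exists M => j b w bM; have [jn|nj] := ltnP j n; first exact: HM.
apply: GN; have : n%:R <= j%:R :> rat by rewrite ler_nat.
by move: Hn; lra.
Qed.

(** Multiplication by x1 - x2 gives G(b-1, c) as its own coefficient at (b, c) plus G(b, c-1). The
    induction starts at exponents c so small that G vanishes. *)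
Lemma slb1_Dl G : glb2 G -> slb1 (fun b c w => Dl 0 (fun b c => G b c w) b c) -> slb1 G.
Proof.
move=> [N GN] Ds c.
have [n Hn] : exists n : nat, c - n%:R < N by have [n] := nat_gt (c - N); exists n; lra.
elim: n c Hn => [|n IH] c Hn.
  by exists 0 => b w _; apply: GN; move: Hn; rewrite subr0.
have [|M HM] := IH (c - 1); first by move: Hn; rewrite -natr1; lra.
have [M' HM'] := Ds c; exists (Num.min M M' - 1) => b w.
rewrite ltrBrDr lt_min => /andP[b1 b2].
have := HM' _ w b2; rewrite /Dl scale0r add0r addrK HM //.
by rewrite subr0.
Qed.

Lemma slb1_iter_Dl m G : glb2 G ->
  slb1 (fun b c w => iter m (Dl 0) (fun b c => G b c w) b c) -> slb1 G.
Proof.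
elim: m G => [|m IH] G GN Gs //; apply: slb1_Dl => //.
apply: IH; last by move: Gs; under eq_fun do under eq_fun do under eq_fun do rewrite iterSr.
have [N HN] := GN; exists N => b c w cN.
have c1 : c - 1 < N by lra.
by rewrite /Dl !HN // scaler0 addr0 subrr.
Qed.

Lemma Up12_glb2 a a' u v f : scalar f -> trunc (UpW chi a' (dl v f)) ->
  glb2 (fun b c w => Up1 a (Up2 a' (dl2 u v f w)) b c).
Proof.
move=> fl [N HN]; exists N => b c w cN; apply: fsum0 => i.
rewrite (_ : Op2 _ _ _ _ _ = 0) ?scaler0 //.
exact: (HN c (E u _ w)).
Qed.

(** After multiplication by (x1-x2)^m the order can be reversed, and then [dl u f] is evaluated at
    vectors of W, where its truncation is uniform. The factor is removed by [slb1_iter_Dl]. *)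
Lemma Up12_slb1 p q p' q' a a' u v f : scalar f -> H p q u -> H p' q' v ->
  trunc (UpW chi a (dl u f)) -> trunc (UpW chi a' (dl v f)) ->
  slb1 (fun b c w => Up1 a (Up2 a' (dl2 u v f w)) b c).
Proof.
move=> fl uH vH ut vt; have [m [_ Hm]] := sys_comm sysE uH vH.
apply: (@slb1_iter_Dl m); first exact: Up12_glb2.
have [N HN] := Up12_glb2 a' v fl ut.
move=> c; exists N => b w bN.
rewrite -Up12_Dl; last exact: (quad_dl2 sysE).
have [-> _] := Hm f w fl.
have fq : quad 1 (flip (dl2 v u f w)) by apply/quad_flip/(quad_dl2 sysE).
rewrite Up12_Dl // Up_exch //.
apply: contrapT => /iter_Dl_neq0[i [j [_ _]]]; apply.
apply: (HN (c - j%:R) (b - i%:R) w).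
by have := ler0n rat i; lra.
Qed.

(* Locality makes the pole order at x1 = - xi of E u applied to the
   coefficients of Y(v, x2) f independent of the coefficient. *)
Lemma reg_closed p q p' q' a u v f gv : scalar f -> H p q u -> H p' q' v ->
  trunc (UpW chi a (dl u f)) -> reg chi p' (dl v f) gv ->
  forall c, trunc (UpW chi a (dl u (gv c))).
Proof.
move=> fl uH vH ut fg c; have [k0 /(_ _ (leqnn _)) vt] := reg_trunc fg.
have fb := dl_ub sysE v fl.
rewrite (reg_uniq chi0 chiD fg (reg_ex chi0 chiD fb vt)).
move: (p' + k0%:R) vt => a' vt.
pose G b c w := Up1 a (Up2 a' (dl2 u v f w)) b c.
(* One bound must serve all exponents c - j at once, because the inverse power in x2 mixes them. *)
have [M HM] := slb1_below (Up12_glb2 a u fl vt) (Up12_slb1 fl uH vH ut vt) c.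
exists M => b w bM.
pose K b c := UpW chi a' (dl v f) c (E u b w).
have -> : UpW chi a (dl u (LoW chi (- a') (UpW chi a' (dl v f)) c)) b w =
    Op1 (upk xi a) (upr a) (Op2 (lok chi (- a')) lor K) b c by [].
have [N HN] := vt; have [L HL] := sys_ub sysE u w.
have [s1 H1] := nat_le_seq (L - b + a); have [s2 H2] := nat_le_seq (c - N).
rewrite (@Op_exch _ _ _ _ _ _ _ _ _ s1 s2); last first.
  move=> i j K0; split; [apply: H1|apply: H2]; rewrite leNgt; apply/negP => lt; apply: K0.
    rewrite /K HL; last by rewrite /upr; lra.
    apply: fsum0 => n; by rewrite /dl (sys_lin0 sysE) (functional0 fl) scaler0.
  by apply: HN; rewrite /lor; lra.
apply: fsum0 => j; rewrite (_ : Op1 _ _ _ _ _ = 0) ?scaler0 //.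
exact: (HM j b w bM).
Qed.

Lemma reg_scalar p v f g : scalar f -> reg chi p (dl v f) g -> forall c, scalar (g c).
Proof.
move=> fl fg; have [k0 /(_ _ (leqnn _)) vt] := reg_trunc fg.
have fb := dl_ub sysE v fl; rewrite (reg_uniq chi0 chiD fg (reg_ex chi0 chiD fb vt)).
by apply: scalar_LoW => //; apply: scalar_UpW => // e; apply: (dl_scalar sysE).
Qed.

Lemma inD_reg p q v f g : inD f -> H p q v -> reg chi p (dl v f) g ->
  forall c, inD (g c).
Proof.
move=> [fl fD] vH fg c; split; first exact: reg_scalar fg c.
move=> p' q' u uH; have [k uk] := fD _ _ _ uH; exists k.
exact: reg_closed fl uH vH uk fg c.
Qed.

Lemma inD_ex p q v f : inD f -> H p q v -> exists g, reg chi p (dl v f) g.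
Proof.
move=> [fl fD] /fD[k vk]; exists (LoW chi (- (p + k%:R)) (UpW chi (p + k%:R) (dl v f))).
by apply: reg_ex => //; apply: (dl_ub sysE).
Qed.

Section TwoOperators.
Variables (p q p' q' : rat) (u v : V) (f : W -> C^o).
Hypotheses (fD : inD f) (uH : H p q u) (vH : H p' q' v).
Variables (gu gv : rat -> W -> C^o) (h h' : rat -> rat -> W -> C^o).
Hypotheses (fgu : reg chi p (dl u f) gu) (fgv : reg chi p' (dl v f) gv).
Hypothesis gh : forall c, reg chi p (dl u (gv c)) (h c).

Let fl : scalar f := proj1 fD.

(** The two regularizations are undone one at a time. For u the same k works on every coefficient
    [gv c] by [reg_closed], so the operation in x1 can be carried out on the whole family. *)
Lemma Lo12_h (k k' : nat) w :
  trunc (UpW chi (p + k%:R) (dl u f)) -> trunc (UpW chi (p' + k'%:R) (dl v f)) ->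
  Lo2 (p' + k'%:R) (Lo1 (p + k%:R) (fun b c => h c b w)) =
  Up1 (p + k%:R) (Up2 (p' + k'%:R) (dl2 u v f w)).
Proof.
move=> ut vt.
have E1 : Lo1 (p + k%:R) (fun b c => h c b w) =
          Up1 (p + k%:R) (fun b c => gv c (E u b w)).
  apply: funext2 => b c.
  have ht := reg_closed fl uH vH ut fgv c.
  have gl := reg_scalar fl fgv c.
  have := reg_at chi0 chiD (dl_ub sysE u gl) (gh c) ht.
  by move=> /(congr1 (fun K => K b w)).
rewrite E1.
have [N HN] := proj1 fgv; have [L HL] := sys_ub sysE u w.
apply: funext2 => b c.
have [s1 H1] := nat_le_seq (L - b + (p + k%:R)).
have [s2 H2] := nat_le_seq (c - N).
rewrite -(@Op_exch _ _ _ _ _ _ _ _ _ s1 s2); last first.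
  move=> i j K0; split; [apply: H1|apply: H2]; rewrite leNgt; apply/negP => lt; apply: K0.
    by rewrite HL; [exact/functional0/(reg_scalar fl fgv)|rewrite /upr; lra].
  by rewrite HN // /lor; lra.
congr (Op1 _ _ _ b c); apply: funext2 => b' c'.
have := reg_at chi0 chiD (dl_ub sysE v fl) fgv vt.
by move=> /(congr1 (fun K => K c' (E u b' w)))/esym.
Qed.

Lemma h_coset b c w : h c b w <> 0 -> b + q \is a Num.int.
Proof.
have gl := reg_scalar fl fgv c.
move=> h0; apply: (reg_coset chi0 chiD (dl_ub sysE u gl) _ (gh c) h0) => e w'.
exact: (dl_coset sysE).
Qed.

End TwoOperators.

End OneSided.

Lemma eventually_ord (P : nat -> nat -> Prop) n :
  (forall j, (j < n)%N -> exists k0 : nat, forall k, (k0 <= k)%N -> P j k) ->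
  exists k0 : nat, forall j k, (j < n)%N -> (k0 <= k)%N -> P j k.
Proof.
elim: n => [|n IH] Hn; first by exists 0%N.
have [|k1 H1] := IH; first by move=> j /ltnW/Hn.
have [k2 H2] := Hn n (leqnn _); exists (maxn k1 k2) => j k.
rewrite ltnS leq_eqVlt geq_max => /orP[/eqP->|jn] /andP[h1 h2]; first exact: H2.
exact: H1.
Qed.

Lemma le_subn (x y : rat) (n : nat) : x <= y - n%:R -> x <= y.
Proof. by move/le_trans; apply; rewrite gerBl. Qed.

(** * Locality and iterate formula for regularized operators *)

Section OneSidedIterate.
Variables (R : realType) (V : lmodType R[i]) (A : vertex_algebra V).
Variable (W : lmodType R[i]).
Local Notation C := R[i].
Variable chi : rat -> C.
Hypotheses (chi0 : chi 0 = 1) (chiD : forall a b, chi (a + b) = chi a * chi b).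
Local Notation xi := (chi 1).
Variables (E : V -> rat -> W -> W) (H : rat -> rat -> V -> Prop).
Hypothesis sysE : system A E H.
Local Notation Up1 a := (Op1 (upk xi a) (upr a)).
Local Notation Up2 a := (Op2 (upk xi a) (upr a)).
Local Notation Lo1 a := (Op1 (lok chi a) lor).
Local Notation Lo2 a := (Op2 (lok chi a) lor).
Local Notation dl := (dl E).
Local Notation dl2 := (dl2 E).

Variables (p q p' q' : rat) (u v : V) (f : W -> C^o).
Hypotheses (fD : inD chi E H f) (uH : H p q u) (vH : H p' q' v).
Variables (gu gv : rat -> W -> C^o) (h h' : rat -> rat -> W -> C^o).
Hypotheses (fgu : reg chi p (dl u f) gu) (fgv : reg chi p' (dl v f) gv).
Hypothesis gh : forall c, reg chi p (dl u (gv c)) (h c).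
Hypothesis gh' : forall b, reg chi p' (dl v (gu b)) (h' b).
Variable m : nat.
Hypothesis Hm : forall f w, scalar f ->
  iter m (Dl 0) (dl2 u v f w) = iter m (Dl 0) (flip (dl2 v u f w)) /\
  forall t e, f (E (A u (t%:Z - m%:Z) v) e w) =
              Dt t (iter m (Dl 0) (dl2 u v f w)) e.

Let fl : scalar f := proj1 fD.
Let F w b c := h c b w.
Let F' w b c := h' b c w.
Let Z w := iter m (Dl 0) (F w).

Lemma quad_F w : quad (-1) (F w).
Proof. exact: (reg_family_quad chi0 chiD (proj1 fgv) gh). Qed.

Lemma Lo12_Z (k k' : nat) w :
  trunc (UpW chi (p + k%:R) (dl u f)) -> trunc (UpW chi (p' + k'%:R) (dl v f)) ->
  Lo1 (p + k%:R) (Lo2 (p' + k'%:R) (Z w)) =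
  Up1 (p + k%:R) (Up2 (p' + k'%:R) (iter m (Dl 0) (dl2 u v f w))).
Proof.
move=> ut vt; have q0 := quad_F w.
rewrite Lo12_Dl // Lo_exch //.
rewrite (Lo12_h chi0 chiD sysE fD uH vH fgv gh w ut vt).
by rewrite Up12_Dl //; apply: (quad_dl2 sysE).
Qed.

(** Both sides have the same double regularization, namely that of (x1-x2)^m times the
    contragredient product, where locality is known; double regularization is injective. *)
Lemma reg_comm w : iter m (Dl 0) (F w) = iter m (Dl 0) (F' w).
Proof.
have [k ut] := reg_trunc fgu; have {}ut := ut _ (leqnn _).
have [k' vt] := reg_trunc fgv; have {}vt := vt _ (leqnn _).
have q1 := quad_F w.
have q2 : quad (-1) (F' w).
  apply: (@quad_flip _ _ _ (fun c b => h' b c w)).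
  exact: (reg_family_quad chi0 chiD (proj1 fgu) gh').
apply: (@Lo12_inj _ _ chi chi chi0 chiD chi0 chiD (p + k%:R) (p' + k'%:R));
  try exact: quad_iter_Dl.
rewrite (Lo12_Z w ut vt) (proj1 (Hm w fl)) Lo12_Dl //.
have q3 : quad 1 (flip (dl2 v u f w)) by apply/quad_flip/(quad_dl2 sysE).
rewrite Up12_Dl //; congr (iter m (Dl 0) _); rewrite Up_exch //.
have := Lo12_h chi0 chiD sysE fD vH uH fgu gh' w vt ut.
by move=> /(congr1 (@flip R _))/esym.
Qed.

(** The bound on c comes from the order in which v acts on f first, the bound on b from the opposite
    order. Neither depends on w. *)
Lemma Z_lower : exists N : rat, forall w b c, Z w b c <> 0 ->
  [/\ b - (- q) \is a Num.int, N <= b & N <= c].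
Proof.
have [N HN] := reg_family_glb chi0 chiD (proj1 fgv) gh.
have [M HM] := reg_family_glb chi0 chiD (proj1 fgu) gh'.
have h1 : Num.min N M <= N by rewrite ge_min lexx.
have h2 : Num.min N M <= M by rewrite ge_min lexx orbT.
exists (Num.min N M) => w b c Z0; rewrite opprK.
have [i [j [_ _ Fij]]] := iter_Dl_neq0 Z0.
have := Z0; rewrite /Z reg_comm => /iter_Dl_neq0[i' [j' [_ _ Fij']]].
split.
- have := h_coset chi0 chiD sysE fD uH fgv gh Fij => Hi.
  rewrite (_ : b + q = b - i%:R + q + i%:R); last by ring.
  by rewrite rpredD // intr_nat.
- apply: le_trans h2 _; apply: (@le_subn _ _ i').
  by rewrite leNgt; apply/negP => lt; apply: Fij'; apply: HM.
apply: le_trans h1 _; apply: (@le_subn _ _ j).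
by rewrite leNgt; apply/negP => lt; apply: Fij; apply: HN.
Qed.

Lemma trunc_Dt t : trunc (fun e w => Dt t (Z w) e).
Proof.
have [N HN] := Z_lower; exists (N + N - t%:R) => e w eN.
apply: contrapT => /Dt_neq0[b /HN[_ b1 b2]].
by lra.
Qed.

(* Expanding (x2 + x0 + xi)^a B(x2 + x0, x2) in powers of x0 on both sides,
   all terms but the first agree by induction. *)
Lemma reg_iter t :
  reg chi (p + p') (dl (A u (t%:Z - m%:Z) v) f) (fun e w => Dt t (Z w) e).
Proof.
elim/ltn_ind: t => t IH; split; first exact: trunc_Dt.
pose P j k := UpW chi (p + p' + k%:R) (dl (A u (j%:Z - m%:Z) v) f) =
              LoW chi (p + p' + k%:R) (fun e w => Dt j (Z w) e).
have [|K HK] := @eventually_ord P t; first by move=> j /IH[].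
have [k ut] := reg_trunc fgu; have [k' vt] := reg_trunc fgv.
(* n is divided as (n - k') for u and k' for v. The summand t leaves room for the loss of at most t
   in the lower terms, so that these stay above K. *)
exists (K + t + k + k')%N => n nK.
apply: funext2 => e w.
have := Lo12_Z w (ut (n - k')%N _) (vt k' (leqnn _)).
have -> : (k <= n - k')%N by lia.
move=> /(_ isT)/(congr1 (fun G => Dt t G e)).
have [N HN] := Z_lower.
have Zl : lower (- q) (Z w) by exists N => b c; apply: HN.
rewrite (Dt_Lo _ _ _ _ chi0 chiD Zl).
have Zu := upper_dl2 sysE fl uH vH (proj1 (Hm w fl)).
rewrite (Dt_Up _ _ _ _ _ Zu) !big_ord_recl !cbin0 !scale1r !subr0 subn0.
have E0 : p + (n - k')%N%:R + (p' + k'%:R) = p + p' + n%:R.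
  by rewrite natrB; [ring|lia].
rewrite E0 => EL.
have ED j : Dt j (iter m (Dl 0) (dl2 u v f w)) = (dl (A u (j%:Z - m%:Z) v) f)^~ w.
  by apply/funext => e'; rewrite -(proj2 (Hm w fl)).
have ES : \sum_(i < t) cbin (ratr (p + (n - k')%N%:R) : C) (lift ord0 i) *:
    Lo chi (p + (n - k')%N%:R - (lift ord0 i)%:R + (p' + k'%:R))
      (Dt (t - lift ord0 i) (Z w)) e =
  \sum_(i < t) cbin (ratr (p + (n - k')%N%:R) : C) (lift ord0 i) *:
    Up xi (p + (n - k')%N%:R - (lift ord0 i)%:R + (p' + k'%:R))
      (Dt (t - lift ord0 i) (iter m (Dl 0) (dl2 u v f w))) e.
  apply: eq_bigr => i _; congr (_ *: _); rewrite /lift /= /bump /= add1n.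
  have it := ltn_ord i.
  have -> : p + (n - k')%N%:R - i.+1%:R + (p' + k'%:R) = p + p' + (n - i.+1)%N%:R.
    by rewrite !natrB; [ring|lia|lia].
  rewrite ED; have := HK (t - i.+1)%N (n - i.+1)%N.
  rewrite /P => /(_ _ _)/(congr1 (fun G => G e w)).
  by move=> /(_ _ _)/esym; apply; lia.
move: EL; rewrite ES => /addIr; rewrite ED => EL.
by rewrite /UpW /LoW -EL.
Qed.

End OneSidedIterate.

(** * Exponentials and roots of unity *)

Section ComplexExponential.
Variable R : realType.
Local Notation C := R[i].

Lemma cexpD (x y : C) : cexp (x + y) = cexp x * cexp y.
Proof.
case: x y => [a b] [c d]; rewrite /cexp /= expRD cosD sinD.
by apply/eqP; rewrite eq_complex /=; apply/andP; split; apply/eqP; ring.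
Qed.

Lemma cexp0 : cexp (0 : C) = 1.
Proof.
by rewrite /cexp /= expR0 cos0 sin0 mul1r; apply/eqP; rewrite eq_complex /= !eqxx.
Qed.

Lemma cexpi (t : R) : cexp (0 +i* t) = cos t +i* sin t.
Proof. by rewrite /cexp /= expR0 mul1r. Qed.

Lemma eT0 T : eT R T 0 = 1.
Proof. by rewrite /eT mulr0 mul0r -[RHS]cexp0; congr cexp. Qed.

Lemma eTD T i j : eT R T (i + j) = eT R T i * eT R T j.
Proof.
rewrite /eT -cexpD; congr cexp; apply/eqP; rewrite eq_complex /= addr0 eqxx /=.
by apply/eqP; rewrite intrD; ring.
Qed.

Lemma eTN T j : eT R T (- j) * eT R T j = 1.
Proof. by rewrite -eTD addNr eT0. Qed.

End ComplexExponential.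

(** * Contragredient vertex operators *)

Section RightTwistedSystem.
Variables (R : realType) (V : lmodType R[i]) (A : vertex_algebra V).
Variables (T : nat) (sigma sigma1 sigma2 : va_aut A) (W : lmodType R[i]).
Variable YW : right_twisted_module sigma T W.
Local Notation C := R[i].
Hypothesis sigmaK : cancel (sigma1 \o sigma2) sigma.
Implicit Types (u v : V) (f : W -> C^o).

Definition bigr (p q : rat) (v : V) := exists j1 j2 : int,
  [/\ in_bigraded T sigma1 sigma2 j1 j2 v, p = j1%:~R / T%:R & q = j2%:~R / T%:R].

Lemma in_bigradedY j1 j2 k1 k2 u v n :
  in_bigraded T sigma1 sigma2 j1 j2 u -> in_bigraded T sigma1 sigma2 k1 k2 v ->
  in_bigraded T sigma1 sigma2 (j1 + k1) (j2 + k2) (A u n v).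
Proof.
have AZ (a : C) u' v' : A (a *: u') n v' = a *: A u' n v'.
  exact: linear_funZ (va_linear A n v') a u'.
move=> [u1 u2] [v1 v2]; split; rewrite /in_eigenspace va_aut_Y eTD.
  by rewrite u1 v1 AZ linearZ scalerA.
by rewrite u2 v2 AZ linearZ scalerA.
Qed.

Lemma in_bigraded_sigma j1 j2 v : in_bigraded T sigma1 sigma2 j1 j2 v ->
  in_eigenspace T sigma (- (j1 + j2)) v.
Proof.
move=> [v1 v2]; have := sigmaK v; rewrite /= v2 linearZ /= v1 !linearZ /= scalerA.
rewrite mulrC -eTD => /(congr1 ( *:%R (eT R T (- (j1 + j2))))).
by rewrite scalerA eTN scale1r.
Qed.

Lemma YW_linl e w : linear (fun v => YW v e w).
Proof. exact: rtw_linear. Qed.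

Lemma YW0l e w : YW 0 e w = 0.
Proof. exact: linear_fun0 (YW_linl e w). Qed.

(** The axioms bound the exponents but do not name their coset. It is read off the Jacobi identity
    of v and the vacuum at n = -1, c = 0: the left side is the single term [YW v e w], and off the
    coset the right side is 0. *)
Lemma YW_eigen_coset j v e w : in_eigenspace T sigma j v -> YW v e w <> 0 ->
  e - j%:~R / T%:R \is a Num.int.
Proof.
move=> vj; apply: contra_notT => ej.
have := rtw_jacobi YW (vacuum A) w (-1) (e - 1) 0 vj.
rewrite /jacobi_rhs ifN; last first.
  apply: contra ej => ej; rewrite (_ : e - _ = e - 1 - j%:~R / T%:R + 1); last by ring.
  by rewrite rpredD.
rewrite (@fsum1 _ _ 0%N); last first.
  move=> i i0; rewrite rtw_vacuum ifF ?scaler0 //.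
  by apply/negP; rewrite subr_eq0 eq_sym pnatr_eq0 => /eqP.
rewrite [X in _ - X]fsum0; last first.
  move=> i; rewrite rtw_vacuum ifF ?linear0 ?scaler0 //.
  rewrite (_ : 0 - _ = i.+1%:R); last by rewrite -natr1 rmorphN1; ring.
  by rewrite pnatr_eq0.
rewrite subr0 rtw_vacuum subr0 eqxx cbin0 expr0 mulr1 scale1r => <-.
by congr (YW v _ w); rewrite rmorphN1; ring.
Qed.

Lemma YW_presystem : presystem (fun v e w => YW v e w) bigr.
Proof.
split; first by move=> v e a w1 w2; rewrite linearP.
  exact: rtw_truncation.
move=> p q v e w [j1 [j2 [/in_bigraded_sigma vj -> ->]]] /(YW_eigen_coset vj).
by rewrite -mulrDl -intrD mulrNz mulNr opprK.
Qed.

Local Notation dl2W := (dl2 (fun v e w => YW v e w)).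

Lemma fin_YW u w (b : rat) (G : nat -> W -> W) : (forall i, G i 0 = 0) ->
  fin (fun i : nat => G i (YW u (b + i%:R) w)).
Proof.
move=> G0; have [N HN] := rtw_truncation YW u w.
have [n Hn] := nat_gt (N - b).
apply: (@fin_nat _ _ n) => i ni; rewrite HN ?G0 //.
by have : n%:R <= i%:R :> rat; [rewrite ler_nat|lra].
Qed.

(** Applying f to the right Jacobi identity gives [Borcherds] for the contragredient products, since
    duality undoes the reversed order in a right module. The exponent m comes from the truncation of
    Y(u, x0)v, hence it is independent of f and w. *)
Lemma YW_system : system A (fun v e w => YW v e w) bigr.
Proof.
split; first exact: YW_presystem.
move=> p q p' q' u v uH vH.
have [N HN] := va_truncation A u v.
exists `|N|%N; split; first by move=> j jN; apply: HN; lia.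
move=> f w fl; set m := `|N|%N.
have f0 := functional0 fl.
have fsumf (F : nat -> W) : fin F -> f (fsum F) = fsum (fun i => f (F i)).
  by apply: fsum_morph => //; apply: functionalD.
have dfinW u' v' : dfin (dl2W u' v' f w).
  move=> b c; apply: (@fin_sub _ _ _ W _ id (fun i => YW v' (c - i%:R) (YW u' (b + i%:R) w))) => //.
    by move=> i f1 E0; apply: f1; rewrite /dl2 E0.
  by apply: (@fin_YW u' w b (fun i => YW v' (c - i%:R))) => i; rewrite linear0.
have [j1 [j2 [uj _ _]]] := uH.
pose g : rat := (- (j1 + j2))%:~R / T%:R.
pose F3 n e := f (YW (A u n v) e w).
have F3m n : n < - m%:Z -> forall e, F3 n e = 0.
  by move=> nm e; rewrite /F3 HN ?YW0l //; lia.
have cos b w' : YW u b w' <> 0 -> b - g \is a Num.int.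
  exact/YW_eigen_coset/in_bigraded_sigma.
have F1g b c : b - g \isn't a Num.int -> dl2W u v f w b c = 0.
  move=> bg; rewrite /dl2 (_ : YW u b w = 0) ?linear0 //.
  by apply: contrapT => /cos; apply/negP.
have bor n b c : Borcherds g (dl2W u v f w) (flip (dl2W v u f w)) F3 n b c.
  have := rtw_jacobi YW v w n b c (in_bigraded_sigma uj).
  move=> /(congr1 f); rewrite (functionalB fl).
  rewrite !fsumf; first last.
  - apply: finZ; apply: (@fin_sub _ _ _ W _ id (fun i : nat =>
      YW v (c - i%:R) (YW u (b - n%:~R + i%:R) w))) => //.
      by move=> i; rewrite (_ : b - (n%:~R - i%:R) = b - n%:~R + i%:R) //; ring.
    by apply: (@fin_YW u w (b - n%:~R) (fun i => YW v (c - i%:R))) => i; rewrite linear0.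
  - apply: finZ; apply: (@fin_sub _ _ _ W _ id (fun i : nat =>
      YW u (b - i%:R) (YW v (c - n%:~R + i%:R) w))) => //.
      by move=> i; rewrite (_ : c - (n%:~R - i%:R) = c - n%:~R + i%:R) //; ring.
    by apply: (@fin_YW v w (c - n%:~R) (fun i => YW u (b - i%:R))) => i; rewrite linear0.
  rewrite /jacobi_rhs (fun_if f) f0 fsumf; last first.
    apply: (@fin_nat _ _ (absz (n + 1 + N)%R).+1) => i ni.
    by rewrite HN ?YW0l ?scaler0 //; lia.
  rewrite /Borcherds /Sl /Sr /flip /dl2 => E; rewrite -/g in E.
  move: E; under eq_fsum => i do rewrite (functionalZ fl).
  under [X in _ - X = _ -> _]eq_fsum => i do rewrite (functionalZ fl).
  move=> ->; case: ifP => // _.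
  by apply: eq_fsum => i; rewrite (functionalZ fl).
have F12 := Borcherds_Dl (dfinW u v) (dfinW v u) F3m (fun b c => bor m%:Z b c).
have Zfin := upper_fin (upper_dl2 YW_presystem fl uH vH (esym F12)).
split=> // t e.
have := Borcherds_Dt (dfinW u v) (dfinW v u) F1g F3m Zfin bor.
by move=> /(_ t e).
Qed.

(** Only p + q enters a system, so the two finite poles may exchange their roles. *)
Lemma system_flip (E : V -> rat -> W -> W) H : system A E H ->
  system A E (fun p q => H q p).
Proof.
move=> [[l b c] comm]; split; first split=> //.
  by move=> p q v e w /c h /h; rewrite addrC [p + q]addrC addrC.
by move=> p q p' q' u v uH vH; exact: comm uH vH.
Qed.

End RightTwistedSystem.

(** * Translation *)

Section Translation.
Variables (R : realType) (X : lmodType R[i]).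
Local Notation C := R[i].
Implicit Types (f : rat -> X) (F Z : rat -> rat -> X) (a b g : rat) (z : C).

Definition trk z (e : rat) (i : nat) : C := cbin (ratr (e + i%:R)) i * z ^+ i.

(* substitution of x + z for x, expanded in powers of z *)
Definition Tr z f : rat -> X := fun e => fsum (fun i => trk z e i *: f (e + i%:R)).

Definition Tr1 z F : rat -> rat -> X := fun b c => Tr z (F^~ c) b.
Definition Tr2 z F : rat -> rat -> X := fun b => Tr z (F b).

Lemma Tr_neq0 z f e : Tr z f e <> 0 -> exists i : nat, f (e + i%:R) <> 0.
Proof.
by move=> /fsum_neq0[i Hi]; exists i => f0; apply: Hi; rewrite f0 scaler0.
Qed.

Lemma ub_Tr z f : ub f -> ub (Tr z f).
Proof.
move=> fb e; have /natfin[N HN] := fb e.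
apply: (@fin_nat _ _ N) => i Ni; apply: fsum0 => j.
by rewrite -addrA -natrD HN ?scaler0 // (leq_trans Ni) ?leq_addr.
Qed.

(** Substitution is multiplicative: (x+z)^b f(x+z) is x^b f(x) with x + z in place of x. *)
Lemma Up_Tr z b f : ub f -> Up z b (Tr z f) = Tr z (fun e => f (e - b)).
Proof.
move=> fb; apply/funext => e; rewrite /Up /Op /Tr.
pose g n := f (e - b + n%:R).
pose c i j : C := cbin (ratr b) i * z ^+ i *
                  (cbin (ratr (e - b + (i + j)%N%:R)) j * z ^+ j).
transitivity (fsum (fun i => fsum (fun j => c i j *: g (i + j)%N))).
  apply: eq_fsum => i; rewrite -fsumZ; last exact/finZ/fb.
  apply: eq_fsum => j; rewrite scalerA /g /upk /trk /c.
  by rewrite (_ : e - upr b i + j%:R = e - b + (i + j)%N%:R) // /upr natrD; ring.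
rewrite fsum_antidiag; last exact: fb.
apply: eq_fsum => n; rewrite /g /trk addrAC; congr (_ *: _).
have -> : ratr (e + n%:R) = ratr b + ratr (e - b + n%:R) :> C by ring.
rewrite cbin_Vandermonde mulr_suml; apply: eq_bigr => i _.
have ni : (i <= n)%N by rewrite -ltnS.
by rewrite /c subnKC // mulrACA -exprD subnKC.
Qed.

Lemma cbinnn n : cbin (n%:R : C) n = 1.
Proof. by have := cbin_natC R n 0; rewrite addn0 cbin0. Qed.

Lemma cbinN1 i : cbin (- 1 : C) i = (-1) ^+ i.
Proof. by have := cbin_neg (0 : C) i; rewrite oppr0 !add0r cbinnn mulr1. Qed.

Lemma TrK z f : ub f -> Tr z (Tr (- z) f) = f.
Proof.
move=> fb; apply/funext => e; rewrite /Tr.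
pose g n := f (e + n%:R).
pose c i j : C := trk z e i * (cbin (ratr (e + (i + j)%N%:R)) j * (- z) ^+ j).
transitivity (fsum (fun i => fsum (fun j => c i j *: g (i + j)%N))).
  apply: eq_fsum => i; rewrite -fsumZ; last first.
    by apply: finZ; have := fb (e + i%:R).
  by apply: eq_fsum => j; rewrite scalerA /g /trk /c natrD addrA.
rewrite fsum_antidiag; last exact: fb.
rewrite (@fsum1 _ _ 0%N).
  rewrite big_ord1 /c /trk /g /= subnn addn0 !cbin0 !expr0 !mulr1 addr0.
  by rewrite scale1r.
move=> n n0; rewrite [X in X *: _](_ : _ = 0) ?scale0r //.
pose x : C := ratr (e + n%:R).
(* Up to a common factor the coefficient of g n is the Vandermonde sum for binom(n-1, n), which is 0
   for n > 0. *)
transitivity (\sum_(i < n.+1) (cbin x n * ((-1) ^+ n * z ^+ n)) *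
                 (cbin (- 1 : C) i * cbin (n%:R : C) (n - i))).
  apply: eq_bigr => i _; have ni : (i <= n)%N by rewrite -ltnS.
  rewrite /c subnKC // -/x /trk.
  have -> : ratr (e + i%:R) = x - (n - i)%N%:R :> C by rewrite natrB // /x; ring.
  have := cbin_sub x (n - i) i; rewrite subnK // => Ex.
  rewrite cbinN1 [(- z) ^+ _]exprNn.
  transitivity (cbin x (n - i) * cbin (x - (n - i)%:R) i * (-1) ^+ (n - i) * (z ^+ i * z ^+ (n - i))); first by ring.
  rewrite -Ex -exprD subnKC // -signr_odd oddB // signr_addb !signr_odd; ring.
rewrite -mulr_sumr -cbin_Vandermonde.
have -> : -1 + n%:R = n.-1%:R :> C.
  by case: n n0 {x} => // n _; rewrite -natr1 addrC addrK.
by rewrite cbin_small ?mulr0 //; case: n n0 {x}.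
Qed.

Lemma Tr_mulx z f e : ub f ->
  Tr z (fun e => f (e - 1)) e = Tr z f (e - 1) + z *: Tr z f e.
Proof. by move=> fb; rewrite -Up_Tr // Up1. Qed.

Lemma Tr_lin z f h (x y : C) e : ub f -> ub h ->
  Tr z (fun e => x *: f e + y *: h e) e = x *: Tr z f e + y *: Tr z h e.
Proof.
move=> fb hb; rewrite /Tr -!fsumZ; try exact: finZ.
rewrite -fsumD; try exact/finZ/finZ.
apply: eq_fsum => i; rewrite scalerDr !scalerA.
by rewrite [trk _ _ _ * x]mulrC [trk _ _ _ * y]mulrC.
Qed.

Lemma quad_ub1 F : quad 1 F -> forall c, ub (F^~ c).
Proof.
move=> Fq c b; have [n Hn] := Fq b c; apply: (@fin_nat _ _ n) => i ni.
apply: contrapT => Fi; have [] := Hn i 0%N; last by rewrite ltnNge ni.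
by rewrite mulr0 addr0 mul1r.
Qed.

Lemma quad_ub2 F : quad 1 F -> forall b, ub (F b).
Proof. by move=> /quad_flip/quad_ub1 H b; apply: H. Qed.

Lemma quad_Tr1 z F : quad 1 F -> quad 1 (Tr1 z F).
Proof.
move=> Fq b c; have [n Hn] := Fq b c; exists n => i j /Tr_neq0[k].
rewrite -addrA (_ : 1 * i%:R + k%:R = 1 * (i + k)%N%:R); last first.
  by rewrite natrD; ring.
by case/Hn => /(leq_ltn_trans (leq_addr _ _)).
Qed.

Lemma quad_Tr2 z F : quad 1 F -> quad 1 (Tr2 z F).
Proof. by move=> /quad_flip/(quad_Tr1 z)/quad_flip. Qed.

Lemma Tr1_Dl z zeta m F : quad 1 F ->
  Tr1 z (iter m (Dl zeta) F) = iter m (Dl (zeta + z)) (Tr1 z F).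
Proof.
move=> Fq; elim: m => //= m IH; rewrite -IH.
have := quad_iter_Dl zeta m Fq; move: (iter m _ F) => G Gq.
apply: funext2 => b c; rewrite /Tr1 /Dl.
have u1 := quad_ub1 Gq c; have u2 := quad_ub1 Gq (c - 1).
have u3 : ub (fun b => G (b - 1) c).
  move=> e; have [s Hs] := u1 (e - 1); exists s => i /Hs.
  by rewrite addrAC.
transitivity (zeta *: Tr z (G^~ c) b + (Tr z (fun b => G (b - 1) c) b - Tr z (G^~ (c - 1)) b)).
  have u4 : ub (fun b => 1 *: G (b - 1) c + (-1) *: G b (c - 1)).
    by move=> e; apply: finD; apply: finZ; [apply: u3|apply: u2].
  rewrite -scaleN1r -[Tr z (fun b => G (b - 1) c) b]scale1r -Tr_lin //.
  rewrite -[X in _ = _ + X]scale1r -Tr_lin //.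
  by apply: eq_fsum => i; congr (_ *: _); rewrite !scale1r scaleN1r addrA.
rewrite (Tr_mulx z b u1) scalerDl !addrA; congr (_ - _).
by rewrite -!addrA; congr (_ + _); rewrite addrC.
Qed.

Lemma Tr2_Dl z zeta m F : quad 1 F ->
  Tr2 z (iter m (Dl zeta) F) = iter m (Dl (zeta - z)) (Tr2 z F).
Proof.
move=> Fq; elim: m => //= m IH; rewrite -IH.
have := quad_iter_Dl zeta m Fq; move: (iter m _ F) => G Gq.
apply: funext2 => b c; rewrite /Tr2 /Dl.
have u1 := quad_ub2 Gq b; have u2 := quad_ub2 Gq (b - 1).
have u3 : ub (fun c => G b (c - 1)).
  move=> e; have [s Hs] := u1 (e - 1); exists s => i /Hs.
  by rewrite addrAC.
transitivity (zeta *: Tr z (G b) c + (Tr z (G (b - 1)) c - Tr z (fun c => G b (c - 1)) c)).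
  have u4 : ub (fun c => 1 *: G (b - 1) c + (-1) *: G b (c - 1)).
    by move=> e; apply: finD; apply: finZ; [apply: u2|apply: u3].
  rewrite -scaleN1r -[Tr z (G (b - 1)) c]scale1r -Tr_lin //.
  rewrite -[X in _ = _ + X]scale1r -Tr_lin //.
  by apply: eq_fsum => i; congr (_ *: _); rewrite !scale1r scaleN1r addrA.
rewrite (Tr_mulx z c u1) scalerBl opprD !addrA.
by rewrite [LHS](ACl (1*4*2*3)).
Qed.

Lemma Tr_exch z F : quad 1 F -> Tr1 z (Tr2 z F) = Tr2 z (Tr1 z F).
Proof.
move=> Fq; apply: funext2 => b c; rewrite /Tr1 /Tr2 /Tr.
have [n Hn] := Fq b c.
pose G i j := (trk z b i * trk z c j) *: F (b + i%:R) (c + j%:R).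
have Gs i j : G i j <> 0 -> i \in iota 0 n /\ j \in iota 0 n.
  rewrite !mem_iota !add0n => G0; apply: Hn; rewrite !mul1r => F0; apply: G0.
  by rewrite /G F0 scaler0.
transitivity (fsum (fun i => fsum (fun j => G i j))).
  apply: eq_fsum => i; rewrite -fsumZ; last exact/finZ/(quad_ub2 Fq).
  by apply: eq_fsum => j; rewrite scalerA.
rewrite (fsum_exch Gs); apply: eq_fsum => j; rewrite -fsumZ.
  by apply: eq_fsum => i; rewrite scalerA [trk z c j * _]mulrC.
exact/finZ/(quad_ub1 Fq).
Qed.

(** Translating both variables by z leaves x0 = x1 - x2 fixed, so it commutes with the extraction of
    x0^t and acts on x2 alone. *)
Lemma Dt_Tr z t g Z : upper g Z -> Dt t (Tr1 z (Tr2 z Z)) = Tr z (Dt t Z).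
Proof.
move=> [N ZN]; apply/funext => e.
pose G p i := fsum (fun j => (cbin (ratr p : C) t * trk z p i * trk z (e + t%:R - p) j) *:
                 Z (p + i%:R) (e + t%:R - p + j%:R)).
have [s1 H1] := @lattice_seq 1 g (e + t%:R - N) N ltr01.
have [s2 H2] := nat_le_seq (N + N - (e + t%:R)).
have Z2 p : ub (Z p).
  by move=> c; apply: (@fin_le _ _ (Z p) (fun i => c + i%:R) (N - c)) => i /ZN[_ _]; lra.
have intB (x : rat) (i : nat) : x + i%:R - g \is a Num.int -> x - g \is a Num.int.
  move=> H; rewrite (_ : x - g = x + i%:R - g - i%:R); last by ring.
  by rewrite rpredB // intr_nat.
have Gs p i : G p i <> 0 -> p \in s1 /\ i \in s2.
  move=> /fsum_neq0[j Hj].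
  have /ZN[pg pN qN] : Z (p + i%:R) (e + t%:R - p + j%:R) <> 0.
    by move=> Z0; apply: Hj; rewrite Z0 scaler0.
  have i0 := ler0n rat i; have j0 := ler0n rat j.
  clear Hj; split; last by apply: H2; lra.
  by apply: H1; [rewrite mul1r; exact: intB pg|lra|lra].
transitivity (fsum (fun p => fsum (fun i => G p i))).
  apply: eq_fsum => p; rewrite /Tr1 /Tr2 /Tr -fsumZ; last first.
    apply: finN0; have [s Hs] := nat_le_seq (N - p); exists s => i Hi; apply: Hs.
    have [j /ZN[_ pN _]] : exists j : nat, Z (p + i%:R) (e + t%:R - p + j%:R) <> 0.
      by apply: (@Tr_neq0 z); rewrite /Tr => T0; apply: Hi; rewrite T0 scaler0.
    by lra.
  apply: eq_fsum => i; rewrite scalerA /G -fsumZ; last exact/finZ/Z2.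
  by apply: eq_fsum => j; rewrite scalerA.
rewrite (fsum_exch Gs).
transitivity (fsum (fun i : nat => fsum (fun p => G (p - i%:R) i))).
  by apply: eq_fsum => i; rewrite (fsum_shift (- i%:R) (G^~ i)).
rewrite (@fsum_exch _ _ _ _ s2 s1); last first.
  move=> i p /fsum_neq0[j Hj].
  have /ZN[pg pN qN] : Z (p - i%:R + i%:R) (e + t%:R - (p - i%:R) + j%:R) <> 0.
    by move=> Z0; apply: Hj; rewrite Z0 scaler0.
  have i0 := ler0n rat i; have j0 := ler0n rat j; rewrite subrK in pg pN.
  clear Hj; split; first by apply: H2; lra.
  by apply: H1; [rewrite mul1r|lra|lra].
pose G2 p n := (trk z e n * cbin (ratr p : C) t) *: Z p (e + n%:R + t%:R - p).
transitivity (fsum (fun p => fsum (fun n => G2 p n))).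
  apply: eq_fsum => p.
  pose c i j : C := cbin (ratr (p - i%:R)) t * trk z (p - i%:R) i *
    (cbin (ratr (e + t%:R - p + (i + j)%N%:R)) j * z ^+ j).
  transitivity (fsum (fun i => fsum (fun j => c i j *: Z p (e + t%:R - p + (i + j)%N%:R)))).
    apply: eq_fsum => i; apply: eq_fsum => j; rewrite /c subrK {2}/trk.
    by rewrite (_ : e + t%:R - (p - i%:R) + j%:R = e + t%:R - p + (i + j)%N%:R) // natrD; ring.
  rewrite (fsum_antidiag c (Z2 p (e + t%:R - p))); apply: eq_fsum => n.
  rewrite /G2; congr (_ *: Z p _); last by ring.
  (* The exponent e + n is the sum of p - t, what is left of x1^p once x0^t is removed, and the
     exponent of x2; Vandermonde distributes the shift over the two. *)
  rewrite /trk mulrAC (_ : ratr (e + n%:R) = (ratr p - t%:R) + ratr (e + t%:R - p + n%:R)); last by ring.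
  rewrite cbin_Vandermonde !mulr_suml; apply: eq_bigr => i _.
  have ni : (i <= n)%N by rewrite -ltnS.
  rewrite /c subnKC // /trk subrK.
  have -> : ratr (p - i%:R) = ratr p - i%:R :> C by ring.
  have := cbin_mulC (ratr p : C) i t => Ec.
  transitivity (cbin (ratr p : C) i * cbin (ratr p - i%:R) t *
    cbin (ratr (e + t%:R - p + n%:R)) (n - i) * (z ^+ i * z ^+ (n - i))); first by ring.
  by rewrite Ec -exprD subnKC //; ring.
rewrite (@fsum_exch _ _ _ _ s1 s2); last first.
  move=> p n Hn.
  have /ZN[pg pN qN] : Z p (e + n%:R + t%:R - p) <> 0.
    by move=> Z0; apply: Hn; rewrite /G2 Z0 scaler0.
  have n0 := ler0n rat n.
  clear Hn; split; last by apply: H2; lra.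
  by apply: H1; [rewrite mul1r|lra|lra].
apply: eq_fsum => n; rewrite -fsumZ; last first.
  exact/finZ/(upper_fin (ex_intro _ N ZN)).
by apply: eq_fsum => p; rewrite /G2 scalerA.
Qed.

End Translation.

Section TranslatedSystem.
Variables (R : realType) (V : lmodType R[i]) (A : vertex_algebra V).
Variable (W : lmodType R[i]).
Local Notation C := R[i].
Variables (E : V -> rat -> W -> W) (H : rat -> rat -> V -> Prop) (z : C).
Implicit Types (f : W -> C^o) (u v : V) (a p q : rat).

Definition TE v e w : W := Tr z (fun e => E v e w) e.

Hypothesis sysE : system A E H.

Lemma E_ub v w : ub (fun e => E v e w).
Proof.
move=> e; have [N HN] := sys_ub sysE v w.
apply: (@fin_le _ _ (fun e => E v e w) (fun i => e + i%:R) (N - e)) => i Ei.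
by rewrite leNgt; apply/negP => lt; apply: Ei; apply: HN; lra.
Qed.

Lemma dl_TE v f e w : scalar f -> dl TE v f e w = Tr z (fun e => dl E v f e w) e.
Proof.
move=> fl; rewrite /dl /TE /Tr (fsum_morph (functional0 fl) (functionalD fl)).
  by apply: eq_fsum => i; rewrite (functionalZ fl).
exact/finZ/E_ub.
Qed.

Lemma scalar_comp f v e : scalar f -> scalar (fun w => f (E v e w)).
Proof. exact: (dl_scalar sysE). Qed.

Lemma dl2_TE u v f w : scalar f ->
  dl2 TE u v f w = Tr1 z (Tr2 z (dl2 E u v f w)).
Proof.
move=> fl; rewrite Tr_exch; last exact: (quad_dl2 sysE).
apply: funext2 => b c.
rewrite /dl2 -[LHS]/(dl TE v f c (TE u b w)) dl_TE //.
apply: eq_fsum => j; congr (_ *: _); rewrite /dl.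
exact: (dl_TE u b w (scalar_comp v (c + j%:R) fl)).
Qed.

(** The two shifts cancel in x1 - x2, so locality keeps its m, and [Dt_Tr] carries the iterate
    formula over. *)
Lemma system_TE : system A TE H.
Proof.
split; first split.
- move=> v e x w w'.
  have := @Tr_lin R W z _ _ x 1 e (E_ub v w) (E_ub v w').
  rewrite scale1r /TE => <-; apply: eq_fsum => i; congr (_ *: _).
  by rewrite (sys_lin sysE) scale1r.
- move=> v w; have [N HN] := sys_ub sysE v w; exists N => e Ne.
  apply: fsum0 => i; rewrite HN ?scaler0 //.
  by have := ler0n rat i; lra.
- move=> p q v e w vH /Tr_neq0[i /(sys_coset sysE vH)] Hi.
  rewrite (_ : e + (p + q) = e + i%:R + (p + q) - i%:R); last by ring.
  by rewrite rpredB // intr_nat.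
move=> p q p' q' u v uH vH; have [m [Hm0 Hm]] := sys_comm sysE uH vH.
exists m; split=> // f w fl; have [H1 H2] := Hm f w fl.
have TD F : quad 1 F -> iter m (Dl 0) (Tr1 z (Tr2 z F)) = Tr1 z (Tr2 z (iter m (Dl 0) F)).
  move=> Fq; rewrite Tr2_Dl // Tr1_Dl; last exact: quad_Tr2.
  by rewrite sub0r addNr.
have q1 := quad_dl2 sysE u v w fl; have q2 := quad_dl2 sysE v u w fl.
have q3 := quad_flip q2.
have -> : flip (dl2 TE v u f w) = Tr1 z (Tr2 z (flip (dl2 E v u f w))).
  by rewrite Tr_exch // dl2_TE.
rewrite dl2_TE // !TD //; split; first by rewrite H1.
move=> t e; rewrite (Dt_Tr z t (upper_dl2 sysE fl uH vH H1)).
have := @dl_TE (A u (t%:Z - m%:Z) v) f e w fl; rewrite /dl => ->.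
by congr (Tr z _ e); apply/funext => e'; rewrite H2.
Qed.

End TranslatedSystem.

Lemma TEK (R : realType) (V : lmodType R[i]) (A : vertex_algebra V)
    (W : lmodType R[i]) (E : V -> rat -> W -> W) H (z : R[i]) :
  system A E H -> TE (TE E z) (- z) = E.
Proof.
move=> sysE; apply: funext2 => v e; apply/funext => w.
have := TrK (- z) (E_ub sysE v w); rewrite opprK => /(congr1 (fun G => G e)).
by [].
Qed.

(** * Equivalence of the truncation conditions at the two poles *)

Section Transfer.
Variables (R : realType) (W : Type).
Local Notation C := R[i].
Variables (chi chi' : rat -> C).
Hypothesis chiN : chi 1 = - chi' 1.
Implicit Types (f : rat -> W -> C^o).

(** Put a = p + k. For large l the series x^(q+l) (x-z)^a f(x) has nonnegative integral exponents
    only, a property kept by x -> x + z since binom(n, i) = 0 for i > n. The translate is x^a times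
    (x+z)^(q+l) f(x+z), whence the bound -a. *)
Lemma trunc_transfer p q (k : nat) f : ubw f ->
  (forall e w, f e w <> 0 -> e + (p + q) \is a Num.int) ->
  trunc (UpW chi (p + k%:R) f) ->
  exists l : nat, trunc (UpW chi' (q + l%:R) (fun e w => Tr (chi' 1) (f^~ w) e)).
Proof.
move=> fb fc [N HN]; have gc := UpW_coset (chi := chi) fc.
set a := p + k%:R in HN; set z := chi' 1.
pose g w e := UpW chi a f e w.
have gb w : ub (g w) by apply: ubw_UpW.
have [l Hl] := nat_gt (- (N + q)); exists l.
exists (- a) => e w ea.
pose h e := Tr z (f^~ w) e.
have hb : ub h by apply: ub_Tr.
have hE e' : h e' = Tr z (g w) (e' + a).
  have -> : g w = Tr (- z) (fun e => h (e - a)).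
    rewrite -Up_Tr // -chiN.
    have := TrK (- z) (fb w); rewrite opprK -/h -chiN => ->.
    by [].
  rewrite TrK ?addrK //.
  by move=> x; have [s Hs] := hb (x - a); exists s => i /Hs; rewrite addrAC.
have -> : UpW chi' (q + l%:R) (fun e w => Tr z (f^~ w) e) e w =
          Up z (q + l%:R) (Tr z (g w)) (e + a).
  apply: eq_fsum => i; rewrite -/h; congr (_ *: _).
  by rewrite -[LHS]/(h _) hE addrAC.
rewrite Up_Tr //; apply: fsum0 => i; rewrite /trk.
set e' := e + a + i%:R.
have [->|ge0] := pselect (g w (e' - (q + l%:R)) = 0); first by rewrite scaler0.
have ei : e' \is a Num.int.
  have := gc _ _ _ ge0 => Hi.
  rewrite (_ : e' = e' - (q + l%:R) + (p + q) - a + (l%:R + k%:R)); last by rewrite /a; ring.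
  by rewrite rpredD // rpredD // intr_nat.
have e0 : 0 <= e'.
  have : N <= e' - (q + l%:R).
    by rewrite leNgt; apply/negP => lt; apply: ge0; apply: HN.
  by lra.
have [n En] : exists n : nat, e' = n%:R.
  by move: ei e0 => /intrP[[n|n] ->]; [exists n|rewrite ler0z].
have ni : (n < i)%N.
  by rewrite -(ltr_nat rat) -En /e'; lra.
by rewrite En ratr_nat cbin_small // mul0r scale0r.
Qed.

End Transfer.

Lemma inD_transfer (R : realType) (V : lmodType R[i]) (A : vertex_algebra V)
    (W : lmodType R[i]) (E : V -> rat -> W -> W) H (chi chi' : rat -> R[i])
    (f : W -> R[i]^o) :
  chi 1 = - chi' 1 -> system A E H -> inD chi E H f ->
  inD chi' (TE E (chi' 1)) (fun p q => H q p) f.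
Proof.
move=> chiN sysE [fl fD]; split=> // q p v vH; have [k Hk] := fD _ _ _ vH.
have [l Hl] := trunc_transfer chiN (dl_ub sysE v fl)
  (fun e w => dl_coset sysE fl vH (e := e) (w := w)) Hk.
exists l; rewrite (_ : dl _ _ _ = fun e w => Tr (chi' 1) (fun e => dl E v f e w) e) //.
by apply: funext2 => e w; exact: (dl_TE _ sysE).
Qed.

(** Only the m+1 slices c, ..., c-m matter, so a property holding eventually for each slice can be
    used for all of them with a common exponent. *)
Lemma iter_Dl_slices (R : realType) (X : lmodType R[i]) (zeta : R[i]) m
    (F F' : rat -> rat -> X) b c :
  (forall (j : nat) b, (j <= m)%N -> F b (c - j%:R) = F' b (c - j%:R)) ->
  iter m (Dl zeta) F b c = iter m (Dl zeta) F' b c.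
Proof.
elim: m b c => [|m IH] b c FF'; first by have := FF' 0%N b (leqnn _); rewrite subr0.
rewrite /= /Dl !(IH _ c); try by move=> j b' /leqW; apply: FF'.
rewrite (IH _ (c - 1)) // => j b' jm; have := FF' j.+1 b' jm.
by rewrite (_ : c - 1 - j%:R = c - j.+1%:R) // -natr1; ring.
Qed.

Lemma ub_iter_Dl (R : realType) (X : lmodType R[i]) (zeta : R[i]) m
    (F : rat -> rat -> X) :
  (forall c, ub (F^~ c)) -> forall c, ub ((iter m (Dl zeta) F)^~ c).
Proof.
move=> Fu; elim: m => // m u c e; rewrite /= /Dl; apply: finD; first apply: finD.
- exact/finZ/u.
- by have [s Hs] := u c (e - 1); exists s => i /Hs; rewrite addrAC.
- exact/finN/u.
Qed.

Lemma Up1_iter_Dl (R : realType) (X : lmodType R[i]) (xi zeta : R[i]) a m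
    (F : rat -> rat -> X) : (forall c, ub (F^~ c)) ->
  Op1 (upk xi a) (upr a) (iter m (Dl zeta) F) =
  iter m (Dl zeta) (Op1 (upk xi a) (upr a) F).
Proof.
move=> Fu; elim: m => //= m <-.
apply: funext2 => b c; rewrite -Op1_Dl // => b' c'.
by apply: (@ub_upr R X a ((iter m (Dl zeta) F)^~ c')); apply: ub_iter_Dl.
Qed.

Lemma reg_sum (R : realType) (W : Type) (chi : rat -> R[i]) p (I : Type) (r : seq I)
    (F G : I -> rat -> W -> R[i]^o) :
  (forall i, ubw (F i)) -> (forall i, reg chi p (F i) (G i)) ->
  ubw (fun e w => \sum_(i <- r) F i e w) /\
  reg chi p (fun e w => \sum_(i <- r) F i e w) (fun e w => \sum_(i <- r) G i e w).
Proof.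
move=> Fb FG.
have E0 (G' : I -> rat -> W -> R[i]^o) :
    (fun e w => \sum_(i <- [::]) G' i e w) = fun _ _ => 0.
  by apply: funext2 => e w; rewrite big_nil.
have ES (G' : I -> rat -> W -> R[i]^o) j s :
    (fun e w => \sum_(i <- j :: s) G' i e w) =
    (fun e w => 1 * G' j e w + \sum_(i <- s) G' i e w).
  by apply: funext2 => e w; rewrite big_cons mul1r.
elim: r => [|j r [b IH]].
  by rewrite !E0; split; [move=> w e; exists [::]|exact: reg0].
rewrite !ES; split; last exact: reg_lin.
by move=> w e; apply: finD; [apply/finZ/Fb|apply: b].
Qed.

Lemma reg_scale (R : realType) (W : Type) (chi : rat -> R[i]) p (x : R[i])
    (f g : rat -> W -> R[i]^o) : ubw f -> reg chi p f g ->
  reg chi p (fun e w => x * f e w) (fun e w => x * g e w).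
Proof.
move=> fb fg; have f0 : ubw (fun (_ : rat) (_ : W) => 0 : R[i]^o) by move=> w e; exists [::].
have := reg_lin x fb f0 fg (reg0 W chi p).
by congr reg; apply: funext2 => e w; rewrite addr0.
Qed.

(** * Commutation of the two expansions *)

Section MixedRegularization.
Variables (R : realType) (W : Type).
Local Notation C := R[i].
Variables chi chi' : rat -> C.
Hypotheses (chi0 : chi 0 = 1) (chiD : forall a b, chi (a + b) = chi a * chi b).
Hypotheses (chi0' : chi' 0 = 1) (chiD' : forall a b, chi' (a + b) = chi' a * chi' b).
Local Notation xi := (chi 1).
Variables (p a' : rat) (k : nat) (Eu : rat -> W -> W) (gv : rat -> W -> C^o).
Variable h : rat -> rat -> W -> C^o.
Local Notation a := (p + k%:R).
Hypothesis gv_trunc : trunc gv.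
Hypothesis gv_ub : forall c, ubw (fun b w => gv c (Eu b w)).
Hypothesis gh : forall c, reg chi p (fun b w => gv c (Eu b w)) (h c).
Variables (m : nat) (zeta : C).

Let K w b c := LoW chi' a' gv c (Eu b w).
Let F w b c := h c b w.
Let B w := iter m (Dl zeta) (Op1 (upk xi a) (upr a) (K w)).
Hypothesis B_lb : forall w c, lb ((B w)^~ c).

(** As [gv] is truncated, at fixed c the power in x2 is a finite combination of coefficients of
    [gv], and regularization in x1 passes through it by linearity. *)
Lemma reg_LoW c : ubw (fun b w => K w b c) /\
  reg chi p (fun b w => K w b c) (fun b w => Op2 (lok chi' a') lor (F w) b c).
Proof.
have [N HN] := gv_trunc; have [N' HN'] := reg_family_glb chi0 chiD gv_trunc gh.
have [n1 Hn1] := nat_gt (c - N); have [n2 Hn2] := nat_gt (c - N').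
pose n := maxn n1 n2; have Hn (i : nat) : (n <= i)%N -> c - i%:R < N /\ c - i%:R < N'.
  rewrite geq_max -!(ler_nat rat) => /andP[h1 h2].
  by move: Hn1 Hn2; split; lra.
have E1 : (fun b w => K w b c) =
    (fun b w => \sum_(i < n) lok chi' a' i * gv (c - lor i) (Eu b w)).
  apply: funext2 => b w; apply: fsum_ord => i /Hn[ci _].
  by rewrite HN ?scaler0.
have E2 : (fun b w => Op2 (lok chi' a') lor (F w) b c) =
    (fun b w => \sum_(i < n) lok chi' a' i * h (c - lor i) b w).
  apply: funext2 => b w; apply: fsum_ord => i /Hn[_ ci].
  by rewrite /F HN' ?scaler0.
rewrite E1 E2; apply: (@reg_sum _ _ _ p 'I_n _ (fun i b w => lok chi' a' i * gv (c - lor i) (Eu b w))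
  (fun i b w => lok chi' a' i * h (c - lor i) b w)) => i.
  by move=> w e; exact/finZ/gv_ub.
exact: reg_scale.
Qed.

(** The exponent from which [gh c] holds may depend on c. At fixed c finitely many slices enter, so
    one more natural power d regularizes them all; it can be cancelled at the end because [B] is
    bounded below in x1, where [Up] and [Lo] of exponent d agree. *)
Lemma Lo12_mixed w :
  Op1 (lok chi a) lor (Op2 (lok chi' a') lor (iter m (Dl zeta) (F w))) = B w.
Proof.
have Fq : quad (-1) (F w) by exact: (reg_family_quad chi0 chiD gv_trunc gh).
have Gq := quad_Lo2 chi' a' Fq; have Hq := quad_Lo1 chi a Gq.
have Ku c : ub ((K w)^~ c) by exact: (proj1 (reg_LoW c)).
have Uu c : ub ((Op1 (upk xi a) (upr a) (K w))^~ c) by apply: ub_Up.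
rewrite Lo12_Dl //; apply: funext2 => b c.
pose P j k0 := UpW chi (p + k0%:R) (fun b w => K w b (c - j%:R)) =
  LoW chi (p + k0%:R) (fun b w => Op2 (lok chi' a') lor (F w) b (c - j%:R)).
have [|d Hd] := @eventually_ord P m.+1.
  by move=> j _; have [_ [k0 Hk]] := proj2 (reg_LoW (c - j%:R)); exists k0.
set X := iter m (Dl zeta) _.
have Xq : quad (-1) X by apply: quad_iter_Dl.
suff : Lo chi d%:R (X^~ c) = Lo chi d%:R ((B w)^~ c).
  move=> /(congr1 (Lo chi (- d%:R))).
  rewrite !LoK //; last exact: quad_Lo_lb1.
  by move=> /(congr1 (fun G => G b)).
have Bu : ub ((B w)^~ c) by apply: ub_iter_Dl.
rewrite -(Up_Lo_nat chi0 chiD d Bu (B_lb w c)).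
apply/funext => b'.
rewrite -[LHS]/(Op1 (lok chi d%:R) lor X b' c) -[RHS]/(Op1 (upk xi d%:R) (upr d%:R) (B w) b' c).
rewrite /B Up1_iter_Dl //.
have -> : Op1 (lok chi d%:R) lor X = iter m (Dl zeta) (Op1 (lok chi d%:R) lor
    (Op1 (lok chi a) lor (Op2 (lok chi' a') lor (F w)))).
  exact: Lo1_Dl.
apply: iter_Dl_slices => j b'' jm.
rewrite -[LHS]/(Lo chi d%:R (Lo chi a (fun b => Op2 (lok chi' a') lor (F w) b (c - j%:R))) b'').
rewrite LoD //; last exact: quad_Lo_lb1.
rewrite -[RHS]/(Up xi d%:R (Up xi a (fun b => K w b (c - j%:R))) b'') UpD //.
have -> : d%:R + a = p + (d + k)%N%:R by rewrite natrD; ring.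
have := Hd j (d + k)%N jm (leq_addr _ _).
by move=> /(congr1 (fun G => G b'' w))/esym.
Qed.

End MixedRegularization.

Lemma lb_of (R : realType) (X : lmodType R[i]) (g : rat -> X) (N : rat) :
  (forall e, g e <> 0 -> N <= e) -> lb g.
Proof.
move=> H e; apply: (@fin_le _ _ g (fun i => e - i%:R) (e - N)) => i /H.
lra.
Qed.

Section Commutation.
Variables (R : realType) (V : lmodType R[i]) (A : vertex_algebra V).
Variable (W : lmodType R[i]).
Local Notation C := R[i].
Variables chiL chiR : rat -> C.
Hypotheses (chiL0 : chiL 0 = 1) (chiLD : forall a b, chiL (a + b) = chiL a * chiL b).
Hypotheses (chiR0 : chiR 0 = 1) (chiRD : forall a b, chiR (a + b) = chiR a * chiR b).
Local Notation z := (chiL 1).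
Variables (E : V -> rat -> W -> W) (H : rat -> rat -> V -> Prop).
Hypothesis sysE : system A E H.
Local Notation E' := (TE E z).

Variables (pu qu pv qv : rat) (u v : V) (f : W -> C^o).
Hypotheses (fD : inD chiR E H f) (uH : H pu qu u) (vH : H pv qv v).
Variables (gu gv : rat -> W -> C^o) (h h' : rat -> rat -> W -> C^o).
Hypotheses (fgu : reg chiL qu (dl E' u f) gu) (fgv : reg chiR pv (dl E v f) gv).
Hypothesis gh : forall c, reg chiL qu (dl E' u (gv c)) (h c).
Hypothesis gh' : forall b, reg chiR pv (dl E v (gu b)) (h' b).

Let fl : scalar f := proj1 fD.
Let sysE' : system A E' H := system_TE z sysE.

Let F1 w b c := f (E v c (E' u b w)).
Let F2 w b c := f (E' u b (E v c w)).

Lemma F1E w : F1 w = Tr1 z (dl2 E u v f w).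
Proof.
apply: funext2 => b c.
exact: (dl_TE z sysE u b w (scalar_comp sysE v c fl)).
Qed.

Lemma F2E w : F2 w = Tr1 z (flip (dl2 E v u f w)).
Proof.
apply: funext2 => b c.
exact: (dl_TE z sysE u b (E v c w) fl).
Qed.

Lemma quad_F1 w : quad 1 (F1 w).
Proof. by rewrite F1E; apply/quad_Tr1/(quad_dl2 sysE). Qed.

Lemma quad_F2 w : quad 1 (F2 w).
Proof. by rewrite F2E; apply/quad_Tr1/quad_flip/(quad_dl2 sysE). Qed.

(* Both composites regularize to the same doubly bounded series, as
   (x1 + z - x2)^m intertwines them. *)
Lemma left_right_comm b c w : h c b w = h' b c w.
Proof.
have [m [_ Hm]] := sys_comm sysE uH vH.
have [k fku] := reg_trunc fgu; have {}fku := fku _ (leqnn _).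
have [k' fkv] := reg_trunc fgv; have {}fkv := fkv _ (leqnn _).
have Ru := reg_at chiL0 chiLD (dl_ub sysE' u fl) fgu fku.
have Rv := reg_at chiR0 chiRD (dl_ub sysE v fl) fgv fkv.
set a := qu + k%:R in fku Ru; set a' := pv + k'%:R in fkv Rv.
(* Only x1 is translated, hence the locality factor becomes (z + x1 - x2)^m. *)
have F12 w' : iter m (Dl z) (F1 w') = iter m (Dl z) (F2 w').
  have T := @Tr1_Dl R _ z 0 m _; rewrite add0r in T.
  rewrite F1E F2E -!T ?(proj1 (Hm f w' fl)) //; last exact: (quad_dl2 sysE).
  exact/quad_flip/(quad_dl2 sysE).
pose G1 w' := Op1 (upk z a) (upr a) (Op2 (upk (chiR 1) a') (upr a') (F1 w')).
pose G2 w' := Op2 (upk (chiR 1) a') (upr a') (Op1 (upk z a) (upr a) (F2 w')).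
have G12 w' : iter m (Dl z) (G1 w') = iter m (Dl z) (G2 w').
  have q1 := quad_F1 w'; have q2 := quad_F2 w'.
  by rewrite /G1 -Up12_Dl // F12 Up12_Dl // Up_exch.
have [N HN] := fku; have [N' HN'] := fkv.
(* [G1] gives the bound in x2 and [G2] the bound in x1; through [G12] their common multiple has
   both, as [Lo12_mixed] requires. *)
have G1_lb w' b' c' : iter m (Dl z) (G1 w') b' c' <> 0 -> N' <= c'.
  move=> /iter_Dl_neq0[i [j [_ _ Gij]]]; apply: (@le_subn _ _ j).
  rewrite leNgt; apply/negP => lt; apply: Gij; apply: fsum0 => n.
  rewrite (_ : Op2 _ _ _ _ _ = 0) ?scaler0 //; exact: (HN' _ (E' u _ w')).
have G2_lb w' b' c' : iter m (Dl z) (G2 w') b' c' <> 0 -> N <= b'.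
  move=> /iter_Dl_neq0[i [j [_ _ Gij]]]; apply: (@le_subn _ _ i).
  rewrite leNgt; apply/negP => lt; apply: Gij; apply: fsum0 => n.
  rewrite (_ : Op1 _ _ _ _ _ = 0) ?scaler0 //; exact: (HN _ (E v _ w')).
have gub c' : ubw (fun b w => gv c' (E' u b w)).
  exact: (dl_ub sysE' u (reg_scalar chiR0 chiRD sysE fl fgv c')).
have gub' b' : ubw (fun c w => gu b' (E v c w)).
  exact: (dl_ub sysE v (reg_scalar chiL0 chiLD sysE' fl fgu b')).
pose F w' b c := h c b w'; pose F' w' b c := h' b c w'.
have q1 : quad (-1) (F w) by exact: (reg_family_quad chiL0 chiLD (proj1 fgv) gh).
have q2 : quad (-1) (F' w).
  apply: (@quad_flip _ _ _ (fun c b => h' b c w)).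
  exact: (reg_family_quad chiR0 chiRD (proj1 fgu) gh').
have E1 : Op1 (lok chiL a) lor (Op2 (lok chiR a') lor (iter m (Dl z) (F w))) =
          iter m (Dl z) (G1 w).
  have := @Lo12_mixed R W chiL chiR chiL0 chiLD qu a' k (E' u) gv h
    (proj1 fgv) gub gh m z.
  rewrite -Rv => -> //.
  by move=> w' c'; rewrite -[iter _ _ _]/(iter m (Dl z) (G1 w')) G12; apply: lb_of => e; exact: G2_lb.
(* The same lemma with the variables exchanged: up to sign the factor reads - z + x2 - x1. *)
have E2 : Op1 (lok chiR a') lor (Op2 (lok chiL a) lor (iter m (Dl (- z)) (flip (F' w)))) =
          iter m (Dl (- z)) (flip (G2 w)).
  have := @Lo12_mixed R W chiR chiL chiR0 chiRD pv a k' (E v) gu h'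
    (proj1 fgu) gub' gh' m (- z).
  rewrite -Ru => -> //.
  move=> w' b'; rewrite -[iter _ _ _]/(iter m (Dl (- z)) (flip (G2 w'))) Dl_flip opprK.
  apply: (@lb_of _ _ _ N') => e h0; apply: (G1_lb w' b'); rewrite G12 => Z0.
  by apply: h0; rewrite Z0 scaler0.
have E3 : iter m (Dl z) (Op2 (lok chiR a') lor (Op1 (lok chiL a) lor (F' w))) =
          iter m (Dl z) (G2 w).
  move: E2; rewrite Lo12_Dl; last exact: quad_flip.
  set K := Op2 (lok chiR a') lor (Op1 (lok chiL a) lor (F' w)).
  rewrite -[Op1 _ _ (Op2 _ _ (flip _))]/(flip K) (Dl_flip (- z) m K).
  rewrite (Dl_flip (- z) m (G2 w)) opprK => E2; apply: funext2 => x y.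
  have := congr1 (fun K => K y x) E2.
  by apply: scalerI; rewrite signr_eq0.
suff : F w = F' w by move=> /(congr1 (fun G => G b c)).
apply: (@Dl_inj _ _ z m) => //; first exact: chi_neq0.
apply: (@Lo12_inj _ _ chiL chiR chiL0 chiLD chiR0 chiRD a a'); try exact: quad_iter_Dl.
rewrite E1 G12 -E3 Lo12_Dl //; congr (iter m _ _).
by rewrite Lo_exch.
Qed.

End Commutation.

(** * Complex powers and eigenspaces *)

Section ComplexPowers.
Variable R : realType.
Local Notation C := R[i].

Lemma polar_form (x : C) : x != 0 ->
  exists t : R, 0 <= t < 2 * pi /\ x = `|x| * cexp (0 +i* t).
Proof.
move=> x0; have pi0 := @pi_gt0 R.
have r0 : 0 < Num.sqrt (complex.Re x ^+ 2 + complex.Im x ^+ 2).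
  rewrite sqrtr_gt0; have [a0|a0] := eqVneq (complex.Re x) 0; last first.
    by rewrite ltr_wpDr ?sqr_ge0 // exprn_even_gt0.
  have [b0|b0] := eqVneq (complex.Im x) 0; last first.
    by rewrite ltr_wpDl ?sqr_ge0 // exprn_even_gt0.
  by move: x0; rewrite eq_complex a0 b0 !eqxx.
rewrite normc_def; set r := Num.sqrt _ in r0 *.
have r2 : r ^+ 2 = complex.Re x ^+ 2 + complex.Im x ^+ 2.
  by rewrite sqr_sqrtr // addr_ge0 ?sqr_ge0.
pose c := complex.Re x / r; pose s := complex.Im x / r.
have cs : c ^+ 2 + s ^+ 2 = 1.
  by rewrite !expr_div_n -mulrDl -r2 divff // expf_neq0 // gt_eqF.
have c1 : -1 <= c <= 1.
  by rewrite -ler_norml -sqrtr_sqr -[X in _ <= X]sqrtr1 ler_wsqrtr // -cs lerDl sqr_ge0.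
suff [t [tb ct st]] : exists t : R, [/\ 0 <= t < 2 * pi, cos t = c & sin t = s].
  exists t; split=> //; rewrite cexpi ct st; apply/eqP; rewrite eq_complex /= !mul0r subr0 addr0.
  have rn : r != 0 by rewrite gt_eqF.
  by rewrite /c /s ![r * _]mulrC !(divfK rn) !eqxx.
have sE : Num.sqrt (1 - c ^+ 2) = `|s|.
  by rewrite -cs addrAC subrr add0r sqrtr_sqr.
have [s0|s0] := leP 0 s.
  exists (acos c); rewrite acosK ?in_itv //= sin_acos // sE ger0_norm //; split=> //.
  rewrite acos_ge0 //=; apply: le_lt_trans (acos_lepi c1) _; lra.
(* At c = 1 the angle 2 pi - acos c would be 2 pi, which the half-open interval excludes; s < 0
   rules this out. *)
have c2 : c < 1.
  have s2 : 0 < s ^+ 2 by rewrite exprn_even_gt0 //= lt_eqF.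
  have c4 : c ^+ 2 < 1 by rewrite -cs ltrDl.
  rewrite ltNge; apply/negP => c3; have := exprn_ege1 2 c3.
  by rewrite leNgt c4.
exists (pi *+ 2 - acos c); split.
- have := acos_gt0 (x := c); have /andP[-> _] := c1; rewrite c2 => /(_ isT) a0.
  by have := acos_lepi c1; rewrite mulr_natl; move: a0 pi0; rewrite -mulr_natr; lra.
- by rewrite cosB cos2pi sin2pi mul1r mul0r addr0 acosK ?in_itv.
- rewrite sinB cos2pi sin2pi mul0r mul1r sub0r sin_acos // sE ltr0_norm //.
  by rewrite opprK.
Qed.

Lemma cexp_clog (x : C) : x != 0 -> cexp (clog x) = x.
Proof.
move=> x0; rewrite /clog /carg.
have [_] := @xgetPex _ 0 _ (polar_form x0); set t := xget _ _ => Ex.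
rewrite [RHS]Ex cexpi /cexp /=; congr (_ * _).
have r0 : 0 < Normc.normc x.
  have : 0 < `|x| by rewrite normr_gt0.
  by rewrite ltcE /= => /andP[].
by rewrite lnK ?posrE // normc_def; case: (x) => a b.
Qed.

Variable z : C.
Hypothesis z0 : z != 0.

Lemma cpowD a b : cpow z (a + b) = cpow z a * cpow z b.
Proof. by rewrite /cpow mulrDl cexpD. Qed.

Lemma cpow0 : cpow z 0 = 1.
Proof. by rewrite /cpow mul0r cexp0. Qed.

Lemma cpow1 : cpow z 1 = z.
Proof. by rewrite /cpow mul1r cexp_clog. Qed.

Lemma cpowB a (i : nat) : cpow z (a - i%:R) = cpow z a * z^-1 ^+ i.
Proof.
elim: i => [|i IH]; first by rewrite subr0 expr0 mulr1.
rewrite -natr1 opprD addrA.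
have := cpowD (a - i%:R - 1) 1; rewrite subrK cpow1 IH => E.
by rewrite exprS [RHS]mulrCA E [RHS]mulrC mulfK.
Qed.

Definition chiL (a : rat) : C := cpow z (ratr a).
(* (- z)^a with log(- z) = log z + pi i *)
Definition chiR (a : rat) : C := cexp (ratr a * (0 +i* pi)) * cpow z (ratr a).

Lemma chiL0 : chiL 0 = 1.
Proof. by rewrite /chiL rmorph0 cpow0. Qed.

Lemma chiLD a b : chiL (a + b) = chiL a * chiL b.
Proof. by rewrite /chiL rmorphD /= cpowD. Qed.

Lemma chiL1 : chiL 1 = z.
Proof. by rewrite /chiL rmorph1 cpow1. Qed.

Lemma chiR0 : chiR 0 = 1.
Proof. by rewrite /chiR rmorph0 cpow0 mul0r cexp0 mulr1. Qed.

Lemma chiRD a b : chiR (a + b) = chiR a * chiR b.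
Proof. by rewrite /chiR rmorphD /= cpowD mulrDl cexpD mulrACA. Qed.

Lemma chiR1 : chiR 1 = - z.
Proof.
rewrite /chiR rmorph1 cpow1 mul1r cexpi cospi sinpi -[RHS]mulN1r; congr (_ * _).
by apply/eqP; rewrite eq_complex /= oppr0 !eqxx.
Qed.

Lemma mul_x_plus_Up (W : Type) chi (c : C) (a : rat) (f : rat -> W -> C^o) :
  chi 1 = c -> mul_x_plus c a f = UpW chi a f.
Proof. by move=> <-. Qed.

Lemma mul_plus_x_chiL (W : Type) (a : rat) (f : rat -> W -> C^o) :
  mul_plus_x z 1 a f = LoW chiL a f.
Proof.
apply: funext2 => e w; apply: eq_fsum => i.
rewrite /lok chiL1 cpowB expr1n mulr1 -[RHS]/(_ * _); congr (_ * _).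
by rewrite mulrCA.
Qed.

(** The phase e^(a pi i) and (z-x)^a combine into (-z+x)^a for the branch [chiR]. Truncation makes
    the sum finite, so that the phase can enter it. *)
Lemma mul_plus_x_chiR (W : Type) (a : rat) (f : rat -> W -> C^o) e w : trunc f ->
  cexp (ratr a * (0 +i* pi)) * mul_plus_x z (-1) a f e w = LoW chiR a f e w.
Proof.
move=> /trunc_lb fl; rewrite /mul_plus_x -[LHS]/(_ *: (_ : C^o)) -fsumZ.
  apply: eq_fsum => i; rewrite /lok chiR1 cpowB invrN -[_ *: _]/(_ * _) -[RHS]/(_ * _).
  by rewrite [(- z^-1) ^+ i]exprNn /chiR /lor; ring.
by apply: (@finZ _ _ C^o) => //; apply: fl.
Qed.

End ComplexPowers.

Section Eigenspaces.
Variable R : realType.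
Local Notation C := R[i].
Variable T : nat.
Hypothesis T0 : (0 < T)%N.

Lemma eT_period : eT R T T = 1.
Proof.
rewrite /eT -mulrA divff ?mulr1; last by rewrite pnatr_eq0 -lt0n.
rewrite cexpi mulr_natl cos2pi sin2pi.
by apply/eqP; rewrite eq_complex /= !eqxx.
Qed.

Lemma eT_mul (k : int) : eT R T (k * T%:Z) = 1.
Proof.
have nat_case (n : nat) : eT R T (n%:Z * T%:Z) = 1.
  elim: n => [|n IH]; first by rewrite mul0r eT0.
  by rewrite intS mulrDl mul1r eTD IH eT_period mulr1.
case: k => n //; have := eTN R T (n.+1%:Z * T%:Z).
by rewrite nat_case mulr1 NegzE mulNr.
Qed.

(** For a remainder 0 < r < T, the half angle y = pi r / T lies strictly between 0 and pi, while
    cos(2y) = 1 would force sin y = 0. *)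
Lemma eT_eq1 (n : int) : eT R T n = 1 -> (T%:Z %| n)%Z.
Proof.
move=> En; have T1 : T%:Z != 0 by rewrite eqz_nat -lt0n.
have Er : eT R T (n %% T)%Z = 1.
  by move: En; rewrite {1}(divz_eq n T) eTD eT_mul mul1r.
apply/dvdz_mod0P; move: Er (modz_ge0 n T1) (ltz_mod n T1).
set r := (n %% T)%Z => Er r0 rT; apply/eqP; rewrite eq_le r0 andbT leNgt.
apply/negP => rpos; move: Er; rewrite /eT cexpi => /eqP; rewrite eq_complex /=.
move=> /andP[/eqP Ec _]; have pi0 := @pi_gt0 R.
pose y : R := pi * r%:~R / T%:R.
have TR : 0 < T%:R :> R by rewrite ltr0n.
have y1 : 0 < y < pi.
  rewrite divr_gt0 ?mulr_gt0 ?ltr0z //= ltr_pdivrMr // ltr_pM2l //.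
  by rewrite -[T%:R]/(T%:Z%:~R) ltr_int.
have := sin_gt0_pi y1; suff -> : sin y = 0 by rewrite ltxx.
have : cos (y *+ 2) = 1 by rewrite -Ec; congr cos; rewrite /y -mulr_natl; ring.
rewrite cos_mulr2n cos2sin2 => H; apply/eqP; rewrite -sqrf_eq0; apply/eqP.
by move: H; rewrite -mulr_natl; lra.
Qed.

Lemma eT_sum (a : nat) : (0 < a < T)%N -> \sum_(j < T) eT R T (- (a%:Z * j%:Z)) = 0.
Proof.
move=> /andP[a0 aT].
have x1 : eT R T (- a%:Z) != 1.
  apply/eqP => /eT_eq1; rewrite dvdzE abszN => /(dvdn_leq a0) /=.
  by rewrite leqNgt aT.
have E (n : nat) : eT R T (- (a%:Z * n%:Z)) = eT R T (- a%:Z) ^+ n.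
  elim: n => [|n IH]; first by rewrite mulr0 oppr0 eT0.
  by rewrite intS mulrDr mulr1 opprD eTD IH exprS.
have := subrX1 (eT R T (- a%:Z)) T; rewrite -E.
have -> : - (a%:Z * T%:Z) = (- a%:Z) * T%:Z by rewrite mulNr.
rewrite eT_mul subrr => /esym/eqP; rewrite mulf_eq0 subr_eq0 (negbTE x1) /=.
by move=> /eqP H; rewrite -[RHS]H; apply: eq_bigr => j _; rewrite E.
Qed.

Section Projection.
Variables (V : lmodType C) (tau : {linear V -> V}).

(** When tau^T = 1 this is the projection onto the eigenspace of degree j, by averaging over the
    cyclic group. *)
Definition eigenproj (j : int) (v : V) : V :=
  T%:R^-1 *: \sum_(a < T) eT R T (- (a%:Z * j)) *: iter a tau v.

Lemma iter_linear a : linear (fun v => iter a tau v).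
Proof. by elim: a => [|a IH] x u v //=; rewrite IH linearP. Qed.

Lemma eigenproj_linear j : linear (eigenproj j).
Proof.
move=> x u v; rewrite /eigenproj scalerA mulrC -scalerA -scalerDr; congr (_ *: _).
rewrite scaler_sumr -big_split /=; apply: eq_bigr => a _.
by rewrite iter_linear scalerDr !scalerA mulrC.
Qed.

Lemma eigenproj_sum v : \sum_(j < T) eigenproj j%:Z v = v.
Proof.
rewrite -scaler_sumr exchange_big /=.
case: (T) T0 (@eT_sum) => // n _ es; rewrite big_ord_recl /=.
rewrite [X in _ + X]big1 ?addr0; last first.
  by move=> a _; rewrite -scaler_suml es ?scale0r //= /bump add1n !ltnS ltn_ord.
rewrite -scaler_suml scalerA (eq_bigr (fun=> 1)); last by move=> i _; rewrite mul0r oppr0 eT0.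
by rewrite sumr_const card_ord mulVf ?scale1r // pnatr_eq0.
Qed.

Lemma eigenproj_comm (g : {linear V -> V}) j v : (forall u, g (tau u) = tau (g u)) ->
  g (eigenproj j v) = eigenproj j (g v).
Proof.
move=> gt; rewrite /eigenproj linearZ linear_sum /=; congr (_ *: _).
apply: eq_bigr => a _; rewrite linearZ /=; congr (_ *: _).
by elim: (nat_of_ord a) => //= n IH; rewrite gt IH.
Qed.

Lemma eigenproj_eigen j v : iter T tau v = v -> tau (eigenproj j v) = eT R T j *: eigenproj j v.
Proof.
move=> per; rewrite /eigenproj linearZ linear_sum /= scalerA mulrC -scalerA; congr (_ *: _).
rewrite scaler_sumr.
case: (T) T0 per (eT_mul) => // n _ per em.
rewrite big_ord_recr [RHS]big_ord_recl /= addrC; congr (_ + _).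
  rewrite linearZ /= -[tau (iter n tau v)]/(iter n.+1 tau v) per scalerA -eTD.
  congr (_ *: _); rewrite mul0r oppr0 addr0.
  have -> : - (n%:Z * j) = j + - j * n.+1%:Z by rewrite intS; ring.
  by rewrite eTD em mulr1.
apply: eq_bigr => a _; rewrite linearZ /= scalerA -eTD; congr (eT _ _ _ *: _).
by rewrite /bump /= add1n intS; ring.
Qed.

Lemma eigen_eq (i j : int) v : tau v = eT R T i *: v -> tau v = eT R T j *: v ->
  v != 0 -> (T%:Z %| i - j)%Z.
Proof.
move=> vi vj v0; apply: eT_eq1; rewrite eTD.
have : (eT R T i - eT R T j) *: v = 0 by rewrite scalerBl -vi -vj subrr.
move=> /eqP; rewrite scaler_eq0 (negbTE v0) orbF subr_eq0 => /eqP ->.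
by rewrite mulrC eTN.
Qed.

End Projection.

End Eigenspaces.

(** * Products of commuting twisted modules *)

Section LowerSystem.
Variables (R : realType) (V : lmodType R[i]) (A : vertex_algebra V).
Variables (D : lmodType R[i]) (Y : V -> rat -> D -> D) (hom : rat -> V -> Prop).

(* A twisted module structure on D, with the Jacobi identity stated as locality
   together with the iterate formula. *)
Record lower_system : Prop := LowerSystem {
  low_linl : forall e f, linear (fun v => Y v e f);
  low_linr : forall v e, linear (Y v e);
  low_trunc : forall q v f, hom q v ->
    exists N : rat, forall e, Y v e f <> 0 -> N <= e;
  low_coset : forall q v e f, hom q v -> Y v e f <> 0 -> e + q \is a Num.int;
  low_comm : forall q q' u v, hom q u -> hom q' v -> exists m : nat,
    (forall j, j < - m%:Z -> A u j v = 0) /\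
    forall f,
      iter m (Dl 0) (fun b c => Y u b (Y v c f)) =
      iter m (Dl 0) (fun b c => Y v c (Y u b f)) /\
      forall t e, Y (A u (t%:Z - m%:Z) v) e f =
                  Dt t (iter m (Dl 0) (fun b c => Y u b (Y v c f))) e
}.

End LowerSystem.

Lemma fsum_pair (I J : choiceType) (X : nmodType) (F : I * J -> X) : fin F ->
  fsum F = fsum (fun i => fsum (fun j => F (i, j))).
Proof.
move=> [s Fs].
pose s1 := undup (map fst s); pose s2 := undup (map snd s).
have F1 i j : i \notin s1 -> F (i, j) = 0.
  rewrite mem_undup => i1; apply: Fs; apply: contra i1.
  by move=> /(map_f fst).
have F2 i j : j \notin s2 -> F (i, j) = 0.
  rewrite mem_undup => j2; apply: Fs; apply: contra j2.
  by move=> /(map_f snd).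
rewrite [RHS](@fsum_seq _ _ s1) ?undup_uniq //; last first.
  by move=> i i1; apply: fsum0 => j; apply: F1.
rewrite (eq_bigr (fun i => \sum_(j <- s2) F (i, j))); last first.
  by move=> i _; apply: fsum_seq; rewrite ?undup_uniq // => j; apply: F2.
rewrite -(@big_allpairs _ _ _ _ _ s1 s2 F); apply: fsum_seq.
  by apply: allpairs_uniq; rewrite ?undup_uniq // => -[i j] [k l].
move=> [i j] ij; have [i1|i1] := boolP (i \in s1); last exact: F1.
have [j2|j2] := boolP (j \in s2); last exact: F2.
by case/negP: ij; apply/allpairsP; exists (i, j).
Qed.

Lemma fin_pair_out (I J : choiceType) (X : nmodType) (F : I -> J -> X) (s : seq I)
    (t : I -> seq J) :
  (forall i j, F i j <> 0 -> i \in s /\ j \in t i) ->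
  fin (fun ij : I * J => F ij.1 ij.2).
Proof.
move=> H; apply: finN0; exists [seq (i, j) | i <- s, j <- t i] => -[i j] /= /H[si tj].
by apply/allpairsPdep; exists i, j.
Qed.

Section Convolution.
Variables (R : realType) (X : lmodType R[i]).
Local Notation C := R[i].
Implicit Types (K : rat -> rat -> rat -> rat -> X) (b c e : rat).

(* [K p q p' q'] is the coefficient of x1^p x2^q y1^p' y2^q'; the variables
   y1, y2 are set equal to x1, x2. *)
Definition dconv K b c : X :=
  fsum (fun pq : rat * rat => K pq.1 pq.2 (b - pq.1) (c - pq.2)).

Definition dconvfin K := forall b c,
  fin (fun pq : rat * rat => K pq.1 pq.2 (b - pq.1) (c - pq.2)).

Definition Dx K p q p' q' : X := Dl 0 (fun p q => K p q p' q') p q.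
Definition Dy K p q p' q' : X := Dl 0 (K p q) p' q'.

Lemma dconvfin_shift K (i j : rat) b c : dconvfin K ->
  fin (fun pq : rat * rat => K (pq.1 - i) (pq.2 - j) (b - pq.1) (c - pq.2)).
Proof.
move=> Kf; apply: (@fin_sub _ _ _ _ _ (fun pq : rat * rat => (pq.1 - i, pq.2 - j))
  _ _ _ (Kf (b - i) (c - j))).
  move=> [p q] [p' q'] [/(congr1 (+%R^~ i)) + /(congr1 (+%R^~ j))].
  by rewrite !subrK => /= -> ->.
by move=> [p q] /=; rewrite (_ : b - i - _ = b - p) 1?(_ : c - j - _ = c - q) //; ring.
Qed.

Lemma dconvfin_Dx K : dconvfin K -> dconvfin (Dx K).
Proof.
move=> Kf b c; rewrite /Dx /Dl.
apply: finD; [apply: finD|apply: finN].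
- by apply: (finZ (fun=> 0)); apply: Kf.
- have := dconvfin_shift 1 0 b c Kf.
  by under eq_fun do rewrite subr0.
have := dconvfin_shift 0 1 b c Kf.
by under eq_fun do rewrite subr0.
Qed.

Lemma dconvfin_Dy K : dconvfin K -> dconvfin (Dy K).
Proof.
move=> Kf b c; rewrite /Dy /Dl.
apply: finD; [apply: finD|apply: finN].
- by apply: (finZ (fun=> 0)); apply: Kf.
- have := Kf (b - 1) c.
  by under eq_fun do rewrite addrAC.
have := Kf b (c - 1).
by under eq_fun do rewrite [c - 1 - _]addrAC.
Qed.

Lemma dconv_shift K (i j : rat) b c :
  fsum (fun pq : rat * rat => K (pq.1 - i) (pq.2 - j) (b - pq.1) (c - pq.2)) =
  dconv K (b - i) (c - j).
Proof.
rewrite [RHS](reindex_fsbigT (fun pq : rat * rat => (pq.1 - i, pq.2 - j))) /=; last first.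
  by exists (fun pq : rat * rat => (pq.1 + i, pq.2 + j)) => -[p q] /=; rewrite ?subrK ?addrK.
by apply: eq_fsum => -[p q] /=; congr (K _ _ _ _); ring.
Qed.

Lemma dconv_Dx K : dconvfin K -> dconv (Dx K) = Dl 0 (dconv K).
Proof.
move=> Kf; apply: funext2 => b c; rewrite /Dl.
have h1 := dconvfin_shift 1 0 b c Kf; have h2 := dconvfin_shift 0 1 b c Kf.
rewrite -[in dconv K (b - 1) _](subr0 c) -[in dconv K _ (c - 1)](subr0 b) -!dconv_shift.
rewrite scale0r add0r -fsumB //; apply: eq_fsum => -[p q] /=.
by rewrite /Dx /Dl scale0r add0r !subr0.
Qed.

Lemma dconv_Dy K : dconvfin K -> dconv (Dy K) = Dl 0 (dconv K).
Proof.
move=> Kf; apply: funext2 => b c; rewrite /Dl /dconv.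
rewrite scale0r add0r -fsumB //; apply: eq_fsum => -[p q] /=.
by rewrite /Dy /Dl scale0r add0r addrAC [c - 1 - _]addrAC.
Qed.

(** The factors x1 - x2 and y1 - y2 become the same factor once y1 = x1 and y2 = x2. *)
Lemma dconv_iter K m n : dconvfin K ->
  dconv (iter m Dx (iter n Dy K)) = iter (m + n) (Dl 0) (dconv K).
Proof.
move=> Kf; have Df : dconvfin (iter n Dy K) by elim: n => // n; apply: dconvfin_Dy.
have -> : dconv (iter m Dx (iter n Dy K)) = iter m (Dl 0) (dconv (iter n Dy K)).
  elim: m => // m IH; rewrite !iterS -IH; apply: dconv_Dx.
  by elim: (m) => // k; apply: dconvfin_Dx.
rewrite iterD; congr iter; elim: n {Df} => // n IH.
by rewrite !iterS -IH; apply: dconv_Dy; elim: (n) => // k; apply: dconvfin_Dy.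
Qed.

(* support bounded below, with p, q and p' in translates of Z *)
Definition lower4 (g h g' : rat) K := exists N N' : rat, forall p q p' q',
  K p q p' q' <> 0 ->
  [/\ p - g \is a Num.int, q - h \is a Num.int, N <= p & N <= q] /\
  [/\ p' - g' \is a Num.int, N' <= p' & N' <= q'].

Lemma lower_dconv g h g' K : lower4 g h g' K -> lower (g + g') (dconv K).
Proof.
move=> [N [N' KN]]; exists (N + N') => b c /fsum_neq0[[p q] /= /KN].
move=> [[pg _ pN qN] [pg' pN' qN']]; split; try lra.
rewrite (_ : b - _ = (p - g) + (b - p - g')); [exact: rpredD|ring].
Qed.

(** Product rule: binom(p+p', t) is expanded by Vandermonde, and s is the part of x0^t that falls on
    the first pair of variables. *)
Lemma Dt_dconv g h g' K t e : lower4 g h g' K ->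
  Dt t (dconv K) e = \sum_(s < t.+1) fsum (fun m => fsum (fun p => fsum (fun p' =>
    (cbin (ratr p) s * cbin (ratr p') (t - s)) *:
      K p (m + s%:R - p) p' (e - m + (t - s)%:R - p')))).
Proof.
move=> [N [N' KN]].
have [s1 Hs1] := @lattice_seq 1 g N (e + t%:R - N - N' - N') ltr01.
have [s2 Hs2] := @lattice_seq 1 h N (e + t%:R - N - N' - N') ltr01.
have [s3 Hs3] := @lattice_seq 1 g' N' (e + t%:R - N - N - N') ltr01.
pose H p q p' := K p q p' (e + t%:R - q - p - p').
have box p q p' : H p q p' <> 0 -> [/\ p \in s1, q \in s2 & p' \in s3].
  move=> /KN[[pg qh pN qN] [pg' pN' qN']].
  by split; [apply: Hs1|apply: Hs2|apply: Hs3]; rewrite ?mul1r //; lra.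
pose G (a : C) (b : rat) (pq : rat * rat) : X := a *: H pq.1 pq.2 (b - pq.1).
pose k1 s b (p : rat) : C := cbin (ratr p) s * cbin (ratr (b - p)) (t - s).
have Gfin (a : rat -> rat * rat -> C) :
    fin (fun x : rat * (rat * rat) => G (a x.1 x.2) x.1 x.2).
  apply: (@fin_pair_out _ _ _ (fun b pq => G (a b pq) b pq)
     [seq p + p' | p <- s1, p' <- s3] (fun=> [seq (p, q) | p <- s1, q <- s2])).
  move=> b [p q]; rewrite /G /= => G0.
  have /box[p1 q2 p3] : H p q (b - p) <> 0 by move=> H0; apply: G0; rewrite H0 scaler0.
  split; last by apply/allpairsP; exists (p, q).
  by apply/allpairsP; exists (p, b - p); split=> //=; ring.
transitivity (fsum (fun b => fsum (fun pq => G (cbin (ratr b) t) b pq))).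
  apply: eq_fsum => b; rewrite /dconv -fsumZ.
    by apply: eq_fsum => -[p q]; rewrite /G /H /=; congr (_ *: K _ _ _ _); ring.
  apply: (@fin_pair_out _ _ _ (fun p q => K p q (b - p) (e + t%:R - b - q)) s1 (fun=> s2)).
  move=> p q K0; have [] // := box p q (b - p).
  by rewrite /H (_ : _ - (b - p) = e + t%:R - b - q) //; ring.
rewrite -(@fsum_pair _ _ _ (fun x : rat * (rat * rat) => G (cbin (ratr x.1) t) x.1 x.2));
  last exact: (Gfin (fun b pq => cbin (ratr b) t)).
transitivity (fsum (fun x : rat * (rat * rat) =>
    \sum_(s < t.+1) G (k1 s x.1 x.2.1) x.1 x.2)).
  apply: eq_fsum => -[b [p q]]; rewrite /G /= -scaler_suml; congr (_ *: _).
  by rewrite -cbin_Vandermonde -rmorphD (_ : p + (b - p) = b) //; ring.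
rewrite fsum_sum; last by move=> s; apply: (Gfin (fun b pq => k1 s b pq.1)).
apply: eq_bigr => s _.
(* The new index m = p + q - s is the x2-exponent of the coefficient of x0^s in the first factor. *)
pose hh (x : rat * (rat * rat)) : rat * (rat * rat) :=
  (x.2.1 + x.2.2, (x.2.1, x.1 + s%:R - x.2.1)).
have hinj : injective hh.
  move=> [m [p p']] [n [q q']] [E1 E2 E3]; move: E1 E3; rewrite /= E2.
  by move=> /addrI-> /addIr/addIr->.
rewrite (reindex_fsbigT hh) /=; last first.
  exists (fun y : rat * (rat * rat) => (y.2.2 + y.2.1 - s%:R, (y.2.1, y.1 - y.2.1))).
    by move=> [m [p p']] /=; congr (_, (_, _)); ring.
  by move=> [b [p q]] /=; rewrite /hh /=; congr (_, (_, _)); ring.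
have Hf : fin (fun x => G (k1 s (hh x).1 (hh x).2.1) (hh x).1 (hh x).2).
  apply: (@fin_sub _ _ _ _ _ hh (fun x => G (k1 s x.1 x.2.1) x.1 x.2) hinj) => //.
  exact: (Gfin (fun b pq => k1 s b pq.1)).
rewrite fsum_pair; last by apply: Hf.
apply: eq_fsum => m; rewrite fsum_pair /=.
  apply: eq_fsum => p; apply: eq_fsum => p'.
  rewrite /G /k1 /H /= (_ : p + p' - p = p'); last by ring.
  have st : (s <= t)%N by rewrite -ltnS.
  by congr (_ *: K _ _ _ _); rewrite natrB //; ring.
apply: (@fin_sub _ _ _ _ _ (fun x => (m, x)) _ _ _ Hf) => //.
by move=> x y [].
Qed.

End Convolution.

Lemma linear_fun_fsum (K : pzRingType) (U U' : lmodType K) (h : U -> U')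
    (I : choiceType) (F : I -> U) : linear h -> fin F ->
  h (fsum F) = fsum (fun i => h (F i)).
Proof.
by move=> hl; apply: fsum_morph; [exact: linear_fun0|exact: linear_funD].
Qed.

Lemma linear_fin (K : pzRingType) (U U' : lmodType K) (h : U -> U')
    (I : choiceType) (F : I -> U) : linear h -> fin F -> fin (fun i => h (F i)).
Proof. by move=> hl [s Hs]; exists s => i /Hs->; exact: linear_fun0. Qed.

Section IteratedDl.
Variables (R : realType) (X Y : lmodType R[i]).

Lemma iter_Dl_morph (h : X -> Y) m (F : rat -> rat -> X) b c : linear h ->
  h (iter m (Dl 0) F b c) = iter m (Dl 0) (fun b c => h (F b c)) b c.
Proof.
move=> hl; elim: m b c => // m IH b c; rewrite !iterS {1}/Dl scale0r add0r.
rewrite -scaleN1r addrC hl scaleN1r addrC !IH.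
by rewrite [RHS]/Dl scale0r add0r.
Qed.

Lemma iter_Dl_lin m x (F G : rat -> rat -> X) b c :
  iter m (Dl 0) (fun b c => x *: F b c + G b c) b c =
  x *: iter m (Dl 0) F b c + iter m (Dl 0) G b c.
Proof.
elim: m b c => // m IH b c; rewrite !iterS /Dl !IH !scale0r !add0r.
by rewrite opprD addrACA scalerBr.
Qed.

Lemma iter_Dx m (K : rat -> rat -> rat -> rat -> X) p q p' q' :
  iter m (@Dx R X) K p q p' q' = iter m (Dl 0) (fun p q => K p q p' q') p q.
Proof.
elim: m p q => // m IH p q; rewrite !iterS /Dx.
by congr (Dl 0 _ p q); apply: funext2 => b c.
Qed.

Lemma iter_Dy m (K : rat -> rat -> rat -> rat -> X) p q :
  iter m (@Dy R X) K p q = iter m (Dl 0) (K p q).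
Proof. by elim: m => // m IH; rewrite !iterS /Dy -IH. Qed.

Lemma dconv_swap (K : rat -> rat -> rat -> rat -> X) b c :
  dconv (fun p q p' q' => K q p q' p') b c = dconv K c b.
Proof.
rewrite /dconv [RHS](reindex_fsbigT (fun pq : rat * rat => (pq.2, pq.1))) //=.
by exists (fun pq : rat * rat => (pq.2, pq.1)) => -[].
Qed.

Lemma dconvfin_swap (K : rat -> rat -> rat -> rat -> X) :
  dconvfin K -> dconvfin (fun p q p' q' => K q p q' p').
Proof.
move=> Kf b c; apply: (@fin_sub _ _ _ _ _ (fun pq : rat * rat => (pq.2, pq.1)) _ _ _ (Kf c b)) => //.
by move=> [p q] [p' q'] [-> ->].
Qed.

End IteratedDl.

Section LowerSystemTheory.
Variables (R : realType) (V : lmodType R[i]) (A : vertex_algebra V).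
Variables (D : lmodType R[i]) (Y : V -> rat -> D -> D) (hom : rat -> V -> Prop).
Hypothesis sysY : lower_system A Y hom.

Lemma low_0 v e : Y v e 0 = 0.
Proof. exact: (linear_fun0 (low_linr sysY v e)). Qed.

Lemma low_neq0 v e f : Y v e f <> 0 -> f <> 0.
Proof. by move=> Y0 f0; apply: Y0; rewrite f0 low_0. Qed.

Lemma iter_Dl_lower q q' u v m f : hom q u -> hom q' v ->
  iter m (Dl 0) (fun b c => Y u b (Y v c f)) =
  iter m (Dl 0) (fun b c => Y v c (Y u b f)) ->
  exists N : rat, forall b c, iter m (Dl 0) (fun b c => Y u b (Y v c f)) b c <> 0 ->
    [/\ b + q \is a Num.int, c + q' \is a Num.int, N <= b & N <= c].
Proof.
move=> uq vq E.
have [N HN] := low_trunc sysY f uq; have [N' HN'] := low_trunc sysY f vq.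
exists (Num.min N N') => b c Z0.
have [i [j [_ _ Fij]]] := iter_Dl_neq0 Z0.
have [i' [j' [_ _ Fij']]] : exists i j : nat, [/\ (i <= m)%N, (j <= m)%N &
    Y v (c - j%:R) (Y u (b - i%:R) f) <> 0].
  by apply: (@iter_Dl_neq0 _ _ 0 _ (fun b c => Y v c (Y u b f))); rewrite -E.
have vc := low_neq0 Fij; have ub' := low_neq0 Fij'.
have int_sub (x y : rat) (n : nat) : x - n%:R + y \is a Num.int -> x + y \is a Num.int.
  move=> xy; rewrite (_ : x + y = x - n%:R + y + n%:R); last by ring.
  by rewrite rpredD // intr_nat.
split.
- exact: int_sub (low_coset sysY uq ub').
- exact: int_sub (low_coset sysY vq vc).
- by apply: le_trans (le_subn (HN _ ub')); rewrite ge_min lexx.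
by apply: le_trans (le_subn (HN' _ vc)); rewrite ge_min lexx orbT.
Qed.

End LowerSystemTheory.

Section Product.
Variables (R : realType) (V : lmodType R[i]) (A : vertex_algebra V).
Variables (D : lmodType R[i]) (L Rt : V -> rat -> D -> D) (homL homR : rat -> V -> Prop).
Hypotheses (sysL : lower_system A L homL) (sysR : lower_system A Rt homR).
Hypothesis LR : forall u v m n f, L u m (Rt v n f) = Rt v n (L u m f).
Local Notation C := R[i].
Implicit Types (u v : V) (f g : D) (b c e p q m : rat).

Definition yt u v e f : D := fsum (fun m => L u m (Rt v (e - m) f)).

(** By commutation either operator may be taken to act first on g, so each exponent is bounded below
    independently of the other. *)
Lemma yt_bound q q' u v g : homL q u -> homR q' v ->
  exists N N' : rat, forall m n, L u m (Rt v n g) <> 0 ->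
    [/\ m + q \is a Num.int, n + q' \is a Num.int, N <= m & N' <= n].
Proof.
move=> uq vq; have [N HN] := low_trunc sysL g uq; have [N' HN'] := low_trunc sysR g vq.
exists N, N' => m n LR0; have R0 := low_neq0 sysL LR0.
have L0 : L u m g <> 0 by apply: (low_neq0 sysR (v := v) (e := n)); rewrite -LR.
split; [exact: (low_coset sysL uq L0)|exact: (low_coset sysR vq R0)|exact: HN|exact: HN'].
Qed.

Lemma yt_box q q' u v g e : homL q u -> homR q' v ->
  exists s : seq rat, forall m, L u m (Rt v (e - m) g) <> 0 -> m \in s.
Proof.
move=> uq vq; have [N [N' HN]] := yt_bound g uq vq.
have [s Hs] := @lattice_seq 1 (- q) N (e - N') ltr01.
by exists s => m /HN[mq _ mN eN]; apply: Hs; rewrite ?mul1r ?opprK //; lra.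
Qed.

Lemma yt_fin q q' u v g e : homL q u -> homR q' v ->
  fin (fun m => L u m (Rt v (e - m) g)).
Proof. by move=> uq vq; apply: finN0; exact: (yt_box g e uq vq). Qed.

Lemma yt_trunc q q' u v f : homL q u -> homR q' v ->
  exists N : rat, forall e, yt u v e f <> 0 -> e + (q + q') \is a Num.int /\ N <= e.
Proof.
move=> uq vq; have [N [N' HN]] := yt_bound f uq vq.
exists (N + N') => e /fsum_neq0[m /HN[mq eq mN eN]]; split; last by lra.
by rewrite (_ : e + _ = m + q + (e - m + q')); [exact: rpredD|ring].
Qed.

Section Four.
Variables (q1 q2 q1' q2' : rat) (u1 u2 v1 v2 : V).
Hypotheses (u1q : homL q1 u1) (u2q : homL q2 u2) (v1q : homR q1' v1) (v2q : homR q2' v2).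

Definition quadruple f p q p' q' := L u1 p (L u2 q (Rt v1 p' (Rt v2 q' f))).

Lemma quadruple_fin f : dconvfin (quadruple f).
Proof.
move=> b c; have [s Hs] := yt_box f c u2q v2q.
have ex q := yt_box (L u2 q (Rt v2 (c - q) f)) b u1q v1q.
(* For each q the admissible p form a finite set depending on q, for which a list is chosen. *)
pose t q := xget [::] [set t : seq rat | forall p,
  L u1 p (Rt v1 (b - p) (L u2 q (Rt v2 (c - q) f))) <> 0 -> p \in t].
have Ht q := xgetPex [::] (ex q).
apply: (@fin_sub _ _ _ _ _ (fun pq : rat * rat => (pq.2, pq.1))
    (fun qp : rat * rat => quadruple f qp.2 qp.1 (b - qp.2) (c - qp.1))) => //.
  by move=> [p q] [p' q'] [-> ->].
apply: (@fin_pair_out _ _ _ (fun q p => quadruple f p q (b - p) (c - q)) s t) => q p.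
rewrite /quadruple LR => K0; split; last exact: (Ht q p K0).
by apply: Hs; apply: (low_neq0 sysR (low_neq0 sysL K0)).
Qed.

Lemma yt_conv f b c : yt u1 v1 b (yt u2 v2 c f) = dconv (quadruple f) b c.
Proof.
rewrite [RHS](fsum_pair (quadruple_fin f b c)); apply: eq_fsum => p /=.
have h := yt_fin f c u2q v2q.
rewrite (linear_fun_fsum (low_linr sysR _ _) h).
rewrite (linear_fun_fsum (low_linr sysL _ _) (linear_fin (low_linr sysR _ _) h)).
by apply: eq_fsum => q; rewrite /quadruple [L u2 q (Rt v1 _ _)]LR.
Qed.

End Four.

(** The exponent m1 + m2 is spent as m1 on the pair of left operators and m2 on the pair of right
    ones. The x0^t coefficient of the product is then the convolution of the two iterate formulas,
    in degrees s and t - s. *)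
Lemma yt_comm q1 q2 q1' q2' u1 u2 v1 v2 :
    homL q1 u1 -> homL q2 u2 -> homR q1' v1 -> homR q2' v2 ->
  exists m1 m2 : nat,
    [/\ forall j, j < - m1%:Z -> A u1 j u2 = 0, forall j, j < - m2%:Z -> A v1 j v2 = 0 &
    forall f, let Z := iter (m1 + m2) (Dl 0) (fun b c => yt u1 v1 b (yt u2 v2 c f)) in
    [/\ iter (m1 + m2) (Dl 0) (fun b c => yt u2 v2 c (yt u1 v1 b f)) = Z,
        lower (- q1 - q1') Z & forall t e,
        Dt t Z e = \sum_(s < t.+1)
          yt (A u1 (s%:Z - m1%:Z) u2) (A v1 ((t - s)%:Z - m2%:Z) v2) e f]].
Proof.
move=> u1q u2q v1q v2q.
have [m1 [A1 H1]] := low_comm sysL u1q u2q; have [m2 [A2 H2]] := low_comm sysR v1q v2q.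
exists m1, m2; split=> // f Z.
pose X g := iter m1 (Dl 0) (fun b c => L u1 b (L u2 c g)).
pose S g := iter m2 (Dl 0) (fun b c => Rt v1 b (Rt v2 c g)).
pose K p q p' q' := X (S f p' q') p q.
have RX v e g p q : Rt v e (X g p q) = X (Rt v e g) p q.
  rewrite (iter_Dl_morph _ _ _ _ (low_linr sysR v e)).
  by congr (iter _ _ _ p q); apply: funext2 => b c; rewrite !LR.
have Xlin p q : linear (fun g => X g p q).
  move=> x g g'; rewrite /X -iter_Dl_lin.
  congr (iter _ _ _ p q); apply: funext2 => b c.
  by rewrite (low_linr sysL u2 c) (low_linr sysL u1 b).
have XS g p q p' q' : X (S g p' q') p q = S (X g p q) p' q'.
  rewrite /S (iter_Dl_morph _ _ _ _ (Xlin p q)).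
  by congr (iter _ _ _ p' q'); apply: funext2 => b c; rewrite !RX.
have LLlin w w' p q : linear (fun g => L w p (L w' q g)).
  by move=> x g g'; rewrite (low_linr sysL w' q) (low_linr sysL w p).
have ZE : Z = dconv K.
  have -> : K = iter m1 (@Dx R D) (iter m2 (@Dy R D) (quadruple u1 u2 v1 v2 f)).
    apply: funext2 => p q; apply: funext2 => p' q'.
    rewrite iter_Dx; congr (iter _ _ _ p q); apply: funext2 => b c.
    by rewrite iter_Dy /S (iter_Dl_morph _ _ _ _ (LLlin u1 u2 b c)).
  rewrite dconv_iter; last exact: (quadruple_fin u1q u2q v1q v2q f).
  congr iter; apply: funext2 => b c.
  exact: (yt_conv u1q u2q v1q v2q f b c).
have Z'E : iter (m1 + m2) (Dl 0) (fun b c => yt u2 v2 c (yt u1 v1 b f)) = dconv K.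
  pose Q p q p' q' := quadruple u2 u1 v2 v1 f q p q' p'.
  have Qfin : dconvfin Q by exact: dconvfin_swap (quadruple_fin u2q u1q v2q v1q f).
  have -> : K = iter m1 (@Dx R D) (iter m2 (@Dy R D) Q).
    apply: funext2 => p q; apply: funext2 => p' q'.
    rewrite iter_Dx /K /X (proj1 (H1 _)).
    congr (iter _ _ _ p q); apply: funext2 => b c.
    by rewrite iter_Dy /S (proj1 (H2 _)) (iter_Dl_morph _ _ _ _ (LLlin u2 u1 c b)).
  rewrite dconv_iter //; congr iter; apply: funext2 => b c.
  by rewrite (yt_conv u2q u1q v2q v1q f c b) -dconv_swap.
have [N HN] := iter_Dl_lower sysL u1q u2q (proj1 (H1 f)).
have [N' HN'] := iter_Dl_lower sysR v1q v2q (proj1 (H2 f)).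
have Klow : lower4 (- q1) (- q2) (- q1') K.
  exists N, N' => p q p' q' K0.
  have /HN' [p'q _ p'N q'N] : S f p' q' <> 0.
    by move=> S0; apply: K0; rewrite /K S0; exact: (linear_fun0 (Xlin p q)).
  have /HN [pq qq pN qN] : X f p q <> 0.
    move=> X0; apply: K0; rewrite /K XS X0 /S; apply: contrapT => /iter_Dl_neq0.
    by move=> [i [j [_ _ +]]]; apply; rewrite !(low_0 sysR).
  by rewrite !opprK.
rewrite Z'E ZE; split=> //; first exact: lower_dconv Klow.
move=> t e; rewrite (Dt_dconv t e Klow); apply: eq_bigr => s _.
have Slow : lower (- q1') (S f).
  by exists N' => b c /HN'[]; rewrite opprK.
apply: eq_fsum => m; rewrite (proj2 (H1 _)) (proj2 (H2 _)); apply: eq_fsum => p.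
have Sfin := finZ (fun p' => cbin (ratr p' : C) (t - s)) (lower_fin Slow (e - m + (t - s)%:R)).
rewrite -[RHS]/(cbin (ratr p) s *: X (Dt (t - s) (S f) (e - m)) p (m + s%:R - p)).
rewrite (linear_fun_fsum (Xlin p _) Sfin) -fsumZ; last exact: linear_fin (Xlin p _) Sfin.
apply: eq_fsum => p'; rewrite (linear_funZ (Xlin p _)) scalerA.
by [].
Qed.

End Product.

(** * Induction on tensors from the universal property *)

Section SpannedSubspace.
Variables (R : realType) (X : lmodType R[i]) (P : X -> Prop).

(* The closure conditions are premises, so that this is a submodule for any [P]. *)
Definition spanP : {pred X} := fun x => `[< P 0 /\
  (forall (a : R[i]) x y, P x -> P y -> P (a *: x + y)) -> P x >].

Lemma spanP_submod : submod_closed spanP.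
Proof.
split; first by apply/asboolP => -[].
move=> a x y /asboolP Px /asboolP Py; apply/asboolP => h.
by apply: (proj2 h); [apply: Px|apply: Py].
Qed.

HB.instance Definition _ := GRing.isSubmodClosed.Build R[i] X spanP spanP_submod.

Record span_type := SpanType { span_val :> X; _ : span_val \in spanP }.

HB.instance Definition _ := [isSub for span_val].
HB.instance Definition _ := [Choice of span_type by <:].
HB.instance Definition _ := [SubChoice_isSubLmodule of span_type by <:].

End SpannedSubspace.

Section TensorInduction.
Variables (R : realType) (U V P : lmodType R[i]) (t : {bilinear U -> V -> P}).
Hypothesis tP : is_tensor_product t.
Variable Q : P -> Prop.
Hypotheses (Q0 : Q 0) (QD : forall (a : R[i]) x y, Q x -> Q y -> Q (a *: x + y)).
Hypothesis Qt : forall u v, Q (t u v).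

Let tS u v : t u v \in spanP Q.
Proof. by apply/asboolP => _. Qed.

Let tQ u v : span_type Q := SpanType (tS u v).

Let tQ_bilinear : bilinear_for (GRing.Scale.Law.clone _ _ *:%R _)
  (GRing.Scale.Law.clone _ _ *:%R _) tQ.
Proof.
split=> [v|u] a x y; apply: val_inj; rewrite /= [LHS]/=.
  by rewrite linearPl.
by rewrite linearPr.
Qed.

HB.instance Definition _ := bilinear_isBilinear.Build R[i] U V (span_type Q) _ _ tQ
  tQ_bilinear.

(** The map into the subspace attached to [Q] induced by [tQ], followed by the inclusion, fixes all
    pure tensors. By uniqueness it is the identity, so every x lies in that subspace. *)
Lemma tensor_ind x : Q x.
Proof.
have [g [gt _]] := tP tQ; have [h [_ hU]] := tP t.
have id_t u v : idfun (t u v) = t u v by [].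
have vg_t u v : (\val \o g) (t u v) = t u v by rewrite /= gt.
have E y : y = val (g y) by have := hU _ id_t y; rewrite -(hU _ vg_t).
by have /asboolP := valP (g x); rewrite -E; apply.
Qed.

End TensorInduction.

Lemma fsum_linear (R : realType) (U X : lmodType R[i]) (I : choiceType) (k : I -> R[i])
    (h : I -> U -> X) (a : R[i]) u v :
  (forall i, linear (h i)) -> fin (fun i => h i u) -> fin (fun i => h i v) ->
  fsum (fun i => k i *: h i (a *: u + v)) =
  a *: fsum (fun i => k i *: h i u) + fsum (fun i => k i *: h i v).
Proof.
move=> hl hu hv; rewrite -fsumZ; last exact: finZ.
rewrite -fsumD; [|exact/finZ/finZ|exact: finZ].
by apply: eq_fsum => i; rewrite hl scalerDr !scalerA mulrC.
Qed.

Lemma Borcherds_linear (R : realType) (U X : lmodType R[i]) (g : rat)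
    (F1 F2 : U -> rat -> rat -> X) (F3 : U -> int -> rat -> X) n b c :
  (forall b c, linear (fun u => F1 u b c)) -> (forall b c, linear (fun u => F2 u b c)) ->
  (forall k e, linear (fun u => F3 u k e)) ->
  (forall u, fin (fun i : nat => F1 u (b - (n%:~R - i%:R)) (c - i%:R))) ->
  (forall u, fin (fun i : nat => F2 u (b - i%:R) (c - (n%:~R - i%:R)))) ->
  (forall u, fin (fun i : nat => F3 u (- n - 1 - i%:Z) (b + c + 1 + i%:R))) ->
  forall (a : R[i]) u v, Borcherds g (F1 u) (F2 u) (F3 u) n b c ->
  Borcherds g (F1 v) (F2 v) (F3 v) n b c ->
  Borcherds g (F1 (a *: u + v)) (F2 (a *: u + v)) (F3 (a *: u + v)) n b c.
Proof.
move=> l1 l2 l3 f1 f2 f3 a u v; rewrite /Borcherds /Sl /Sr.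
pose h1 (i : nat) u := F1 u (b - (n%:~R - i%:R)) (c - i%:R).
pose h2 (i : nat) u := F2 u (b - i%:R) (c - (n%:~R - i%:R)).
pose h3 (i : nat) u := F3 u (- n - 1 - i%:Z) (b + c + 1 + i%:R).
have h1l i : linear (h1 i) by exact: l1.
have h2l i : linear (h2 i) by exact: l2.
have h3l i : linear (h3 i) by exact: l3.
rewrite (fsum_linear _ a h1l (f1 u) (f1 v)) (fsum_linear _ a h2l (f2 u) (f2 v)).
rewrite (fsum_linear _ a h3l (f3 u) (f3 v)) opprD addrACA -scalerBr => -> ->.
by case: ifP => // _; rewrite scaler0 addr0.
Qed.

(** * The regular module *)

Section RegularOperators.
Variables (R : realType) (V : lmodType R[i]) (A : vertex_algebra V).
Variables (T : nat) (sigma sigma1 sigma2 : va_aut A) (W : lmodType R[i]).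
Variables (YW : right_twisted_module sigma T W) (z : R[i]).
Local Notation C := R[i].
Hypothesis T0 : (0 < T)%N.
Hypothesis sigmaC : sigma1 \o sigma2 =1 sigma2 \o sigma1.
Hypotheses (per1 : iter T sigma1 =1 id) (per2 : iter T sigma2 =1 id).
Local Notation D := (frakD sigma1 sigma2 YW z).
Local Notation in_bi := (in_bigraded T sigma1 sigma2).
Implicit Types (u v : V) (f g : D) (w : W).

Lemma frakD_lin (x : C) f g w : (x *: f + g : D) w = x * f w + g w.
Proof. by []. Qed.

Lemma frakDZ (x : C) f w : (x *: f : D) w = x * f w.
Proof. by []. Qed.

Lemma frakDD f g w : (f + g : D) w = f w + g w.
Proof. by []. Qed.

Lemma frakD_inj f g : (forall w, f w = g w) -> f = g.
Proof. by move=> fg; apply: val_inj; apply/funext. Qed.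

Lemma frakD_neq0 f : f <> 0 -> exists w, f w <> 0.
Proof.
move=> f0; apply: contrapT => nw; apply: f0; apply: frakD_inj => w.
by apply: contrapT => fw; apply: nw; exists w.
Qed.

Lemma frakD_scalar f : scalar f.
Proof. by case: f => f /= /asboolP[]. Qed.

Lemma frakD_sum (I : Type) (r : seq I) (F : I -> D) w :
  (\sum_(i <- r) F i : D) w = \sum_(i <- r) F i w.
Proof. by elim: r => [|i r IH]; rewrite ?big_nil // !big_cons frakDD IH. Qed.

Lemma frakD_fsum (I : choiceType) (F : I -> D) w : fin F ->
  (fsum F) w = fsum (fun i => F i w).
Proof. exact: (fsum_morph (h := fun f : D => f w)). Qed.

Lemma frakD_iter_Dl m (zeta : C) (F : rat -> rat -> D) b c w :
  (iter m (Dl zeta) F b c) w = iter m (Dl zeta) (fun b c => F b c w : C^o) b c.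
Proof.
elim: m b c => // m IH b c; rewrite !iterS /Dl -!IH.
by [].
Qed.

Definition pr (j1 j2 : int) v := eigenproj T sigma1 j1 (eigenproj T sigma2 j2 v).

Lemma pr_linear j1 j2 : linear (pr j1 j2).
Proof. by move=> x u v; rewrite /pr !eigenproj_linear. Qed.

Lemma pr_bigraded j1 j2 v : in_bi j1 j2 (pr j1 j2 v).
Proof.
split; first exact: (eigenproj_eigen T0 _ (per1 _)).
rewrite /in_eigenspace /pr eigenproj_comm; last by move=> u; have := sigmaC u.
rewrite (eigenproj_eigen T0 _ (per2 _)).
exact: linear_funZ (eigenproj_linear _ _ _) _ _.
Qed.

Lemma pr_sum v : \sum_(j1 < T) \sum_(j2 < T) pr j1 j2 v = v.
Proof.
rewrite -[RHS](eigenproj_sum T0 sigma1); apply: eq_bigr => j1 _.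
rewrite -(linear_fun_sum (eigenproj_linear T sigma1 j1)); congr (eigenproj _ _ _ _).
exact: eigenproj_sum.
Qed.

Lemma in_bigraded_pr i1 i2 j1 j2 v : in_bi j1 j2 v -> in_bi j1 j2 (pr i1 i2 v).
Proof.
move=> [v1 v2].
have prZ a u : pr i1 i2 (a *: u) = a *: pr i1 i2 u by exact: linear_funZ (pr_linear _ _) a u.
split; rewrite /in_eigenspace -prZ.
  rewrite -[eT _ _ _ *: v]v1 /pr eigenproj_comm //; congr eigenproj.
  by apply: eigenproj_comm => u; exact: sigmaC.
rewrite -[eT _ _ _ *: v]v2 /pr eigenproj_comm; last by move=> u; exact/esym/sigmaC.
by congr eigenproj; apply: eigenproj_comm.
Qed.

Lemma pr_neq0 i1 i2 j1 j2 v : in_bi j1 j2 v -> pr i1 i2 v != 0 ->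
  (T%:Z %| i1 - j1)%Z /\ (T%:Z %| i2 - j2)%Z.
Proof.
move=> /(in_bigraded_pr i1 i2)[a1 a2] v0; have [b1 b2] := pr_bigraded i1 i2 v.
by split; [apply: (eigen_eq T0 b1 a1)|apply: (eigen_eq T0 b2 a2)].
Qed.

Section OneSidedOperators.
Variable chi : rat -> C.
Hypotheses (chi0 : chi 0 = 1) (chiD : forall a b, chi (a + b) = chi a * chi b).
Variables (E : V -> rat -> W -> W) (H : rat -> rat -> V -> Prop).
Hypothesis sysE : system A E H.
Hypothesis E_linl : forall e w, linear (fun v => E v e w).
Hypothesis inDP : forall g : W -> C^o,
  g \in frakD_pred sigma1 sigma2 YW z <-> inD chi E H g.
Variables sel sel' : int -> int -> rat.
Hypothesis selH : forall j1 j2 v, in_bi j1 j2 v -> H (sel j1 j2) (sel' j1 j2) v.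
Hypothesis selD : forall j1 j2 k1 k2,
  sel (j1 + k1) (j2 + k2) = sel j1 j2 + sel k1 k2.
Hypothesis selT : forall j1 j2, (T%:Z %| j1)%Z -> (T%:Z %| j2)%Z ->
  exists n : int, sel j1 j2 = n%:~R.

(** [sel j1 j2] is the exponent at the pole - [chi 1]: j1/T for Y^R and j2/T for Y^L. *)
Definition Ybi (j1 j2 : int) v f : rat -> W -> C^o :=
  xget (fun _ _ => 0) [set g | reg chi (sel j1 j2) (dl E v f) g].

(** The indices below T represent all degrees. The default of [insubd] is never reached, since the
    coefficients lie in the space by [inD_reg]. *)
Definition Yop v e f : D :=
  \sum_(i1 < T) \sum_(i2 < T) insubd (0 : D) (Ybi i1 i2 (pr i1 i2 v) f e).

Lemma frakD_inD f : inD chi E H f.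
Proof. by apply/inDP; case: f. Qed.

Lemma dlf_ub v f : ubw (dl E v f).
Proof. exact: (dl_ub sysE v (frakD_scalar f)). Qed.

Lemma Ybi_reg j1 j2 v f : in_bi j1 j2 v ->
  reg chi (sel j1 j2) (dl E v f) (Ybi j1 j2 v f).
Proof.
move=> /selH vH.
exact: (xgetPex (fun _ _ => 0) (inD_ex chi0 chiD sysE (frakD_inD f) vH)).
Qed.

Lemma Yop_val v e f w : Yop v e f w =
  \sum_(i1 < T) \sum_(i2 < T) Ybi i1 i2 (pr i1 i2 v) f e w.
Proof.
rewrite frakD_sum; apply: eq_bigr => i1 _; rewrite frakD_sum; apply: eq_bigr => i2 _.
rewrite -[frakD_val _]/(val _) insubdK //.
have vi := pr_bigraded i1 i2 v.
by apply/inDP; exact: (inD_reg chi0 chiD sysE (frakD_inD f) (selH vi) (Ybi_reg f vi)).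
Qed.

(** A component of a homogeneous vector is 0 unless the indices agree modulo T, and then the two
    pole exponents differ by an integer, which [reg] tolerates. *)
Lemma Ybi_reg_pr j1 j2 i1 i2 v f : in_bi j1 j2 v ->
  reg chi (sel j1 j2) (dl E (pr i1 i2 v) f) (Ybi i1 i2 (pr i1 i2 v) f).
Proof.
move=> vj; have vi := pr_bigraded i1 i2 v.
have [v0|v0] := eqVneq (pr i1 i2 v) 0.
  have := Ybi_reg f vi; set g := Ybi _ _ _ _.
  have -> : dl E (pr i1 i2 v) f = fun _ _ => 0.
    apply: funext2 => e w; rewrite /dl v0.
    by rewrite (linear_fun0 (E_linl e w)) (functional0 (frakD_scalar f)).
  by move=> /(reg_uniq chi0 chiD (reg0 W chi _)) <-; exact: reg0.
have [d1 d2] := pr_neq0 vj v0.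
have [n En] := selT d1 d2.
rewrite -(subrK (sel i1 i2) (sel j1 j2)) addrC.
have Ei : sel i1 i2 = n%:~R + sel j1 j2 by rewrite -En -selD !subrK.
have -> : sel j1 j2 - sel i1 i2 = (- n)%:~R.
  by rewrite Ei rmorphN opprD addrCA subrr addr0.
exact: reg_int (Ybi_reg f vi).
Qed.

Lemma Yop_reg j1 j2 v f : in_bi j1 j2 v ->
  reg chi (sel j1 j2) (dl E v f) (fun e => Yop v e f).
Proof.
move=> vj.
have -> : dl E v f = fun e w => \sum_(i1 < T) \sum_(i2 < T) dl E (pr i1 i2 v) f e w.
  apply: funext2 => e w.
  rewrite /dl -[in LHS](pr_sum v) (linear_fun_sum (E_linl e w)).
  have fl := frakD_scalar f.
  rewrite (big_morph _ (functionalD fl) (functional0 fl)); apply: eq_bigr => i1 _.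
  rewrite (linear_fun_sum (E_linl e w)).
  exact: (big_morph _ (functionalD fl) (functional0 fl)).
have -> : (fun e => frakD_val (Yop v e f)) = fun e w =>
    \sum_(i1 < T) \sum_(i2 < T) Ybi i1 i2 (pr i1 i2 v) f e w.
  by apply: funext2 => e w; rewrite Yop_val.
have inner (i1 : 'I_T) := @reg_sum R W chi (sel j1 j2) 'I_T (index_enum _)
  (fun i2 => dl E (pr i1 i2 v) f) (fun i2 => Ybi i1 i2 (pr i1 i2 v) f)
  (fun i2 => dlf_ub _ f) (fun i2 => Ybi_reg_pr i1 i2 f vj).
exact: (@reg_sum R W chi (sel j1 j2) 'I_T (index_enum _) _ _
  (fun i1 => proj1 (inner i1)) (fun i1 => proj2 (inner i1))).2.
Qed.

(** [Ybi] is an arbitrary choice; linearity holds because both sides regularize the same series and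
    regularizations are unique. *)
Lemma Yop_linl e f : linear (fun v => Yop v e f).
Proof.
move=> x u v; apply: frakD_inj => w; rewrite frakD_lin !Yop_val mulr_sumr -big_split /=.
apply: eq_bigr => i1 _; rewrite mulr_sumr -big_split /=; apply: eq_bigr => i2 _.
have ui := pr_bigraded i1 i2 u.
have vi := pr_bigraded i1 i2 v.
have uvi := pr_bigraded i1 i2 (x *: u + v).
have := reg_lin x (dlf_ub _ f) (dlf_ub _ f) (Ybi_reg f ui) (Ybi_reg f vi).
have <- : dl E (pr i1 i2 (x *: u + v)) f =
    fun e w => x * dl E (pr i1 i2 u) f e w + dl E (pr i1 i2 v) f e w.
  apply: funext2 => e' w'.
  by rewrite /dl pr_linear E_linl (frakD_scalar f).
by move=> /(reg_uniq chi0 chiD (Ybi_reg f uvi)) ->.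
Qed.

Lemma Yop_linr v e : linear (Yop v e).
Proof.
move=> x f g; apply: frakD_inj => w; rewrite frakD_lin !Yop_val mulr_sumr -big_split /=.
apply: eq_bigr => i1 _; rewrite mulr_sumr -big_split /=; apply: eq_bigr => i2 _.
have vi := pr_bigraded i1 i2 v.
have := reg_lin x (dlf_ub _ f) (dlf_ub _ g) (Ybi_reg f vi) (Ybi_reg g vi).
by move=> /(reg_uniq chi0 chiD (Ybi_reg (x *: f + g) vi)) ->.
Qed.

(* [q] is the exponent for which Y(v, x) takes values in x^(- q) D((x)). *)
Definition homq q v := exists j1 j2, in_bi j1 j2 v /\ q = sel' j1 j2.

Section AnyOperator.
Variable Y : V -> rat -> D -> D.
Hypothesis Y_linl : forall e f, linear (fun v => Y v e f).
Hypothesis Y_reg : forall j1 j2 v f, in_bi j1 j2 v ->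
  reg chi (sel j1 j2) (dl E v f) (fun e => Y v e f).

(** The specification of the operators contains linearity in v only; agreement with [Yop] provides
    linearity in f. *)
Lemma Yop_uniq v e f : Y v e f = Yop v e f.
Proof.
rewrite -(pr_sum v) (linear_fun_sum (Y_linl e f)).
rewrite (linear_fun_sum (Yop_linl e f)); apply: eq_bigr => i1 _.
rewrite (linear_fun_sum (Y_linl e f)) (linear_fun_sum (Yop_linl e f)).
apply: eq_bigr => i2 _; apply: frakD_inj => w.
have vi := pr_bigraded i1 i2 v.
by have /(congr1 (fun G => G e w)) := reg_uniq chi0 chiD (Y_reg f vi) (Yop_reg f vi).
Qed.

Lemma Y_linr v e : linear (Y v e).
Proof. by move=> x f g; rewrite !Yop_uniq Yop_linr. Qed.

Lemma Y_lower_system : lower_system A Y homq.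
Proof.
split=> //; first exact: Y_linr.
- move=> q v f [j1 [j2 [vj _]]]; have [[N HN] _] := Y_reg f vj.
  exists N => e Y0; rewrite leNgt; apply/negP => lt; apply: Y0.
  by apply: frakD_inj => w; rewrite HN.
- move=> q v e f [j1 [j2 [vj ->]]] Y0.
  have [w Yw] := frakD_neq0 Y0; apply: (reg_coset chi0 chiD (dlf_ub v f) _ (Y_reg f vj) Yw) => e' w'.
  exact: (dl_coset sysE (frakD_scalar f) (selH vj)).
move=> q q' u v [j1 [j2 [uj _]]] [k1 [k2 [vk _]]].
have uH := selH uj; have vH := selH vk.
have [m [Hm0 Hm]] := sys_comm sysE uH vH; exists m; split=> // f.
have fD := frakD_inD f.
pose h c b : W -> C^o := Y u b (Y v c f); pose h' b c : W -> C^o := Y v c (Y u b f).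
have gh c : reg chi (sel j1 j2) (dl E u (Y v c f)) (h c) by exact: Y_reg.
have gh' b : reg chi (sel k1 k2) (dl E v (Y u b f)) (h' b) by exact: Y_reg.
have fgu := Y_reg f uj; have fgv := Y_reg f vk.
have comm w := reg_comm chi0 chiD sysE fD uH vH fgu fgv gh gh' Hm w.
split.
  apply: funext2 => b c; apply: frakD_inj => w.
  by rewrite !frakD_iter_Dl; have := congr1 (fun G => G b c) (comm w).
move=> t e; apply: frakD_inj => w.
have := reg_iter chi0 chiD sysE fD uH vH fgu fgv gh gh' Hm t.
(* Degrees add under the products of the vertex algebra, so the operator of the iterate regularizes
   the same series with the same pole exponent p + p'. *)
rewrite -selD => /(reg_uniq chi0 chiD (Y_reg f (in_bigradedY (t%:Z - m%:Z) uj vk))).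
move=> /(congr1 (fun G => G e w)) => ->.
have [N HN] := Z_lower chi0 chiD sysE fD uH vH fgu fgv gh gh' Hm.
rewrite /Dt frakD_fsum.
  by apply: eq_fsum => p; rewrite frakDZ frakD_iter_Dl.
apply: finZ; apply: (@lower_fin _ _ (- sel' j1 j2)).
exists N => b c Z0.
by have [w'] := frakD_neq0 Z0; rewrite frakD_iter_Dl; exact: HN.
Qed.

End AnyOperator.

End OneSidedOperators.

Hypothesis sigmaK : cancel (sigma1 \o sigma2) sigma.
Hypothesis z0 : z != 0.
Local Notation L := (@YL R V A T sigma sigma1 sigma2 W YW z).
Local Notation Rt := (@YR R V A T sigma sigma1 sigma2 W YW z).

Section LeftRight.
Let E : V -> rat -> W -> W := fun v e w => YW v e w.
Let H := bigr T sigma1 sigma2.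
Let H' (p q : rat) := bigr T sigma1 sigma2 q p.
Local Notation E' := (TE E z).
Local Notation cR := (chiR z).
Local Notation cL := (chiL z).

Let sysE : system A E H := YW_system YW sigmaK.

Lemma sysE' : system A E' H'.
Proof. exact/system_TE/system_flip. Qed.

Lemma cRL : cR 1 = - cL 1.
Proof. by rewrite chiR1 // chiL1. Qed.

Lemma laurent_trunc (d : rat) (F : rat -> W -> C^o) : laurent (mulX d F) -> trunc F.
Proof.
move=> [N HN]; exists (N%:~R - d) => e w eN; apply: contrapT => F0.
have [|_] := HN (e + d); last by lra.
by rewrite /mulX addrK => /(congr1 (fun G => G w)).
Qed.

Lemma trunc_laurent (d : rat) (F : rat -> W -> C^o) :
  (forall e w, F e w <> 0 -> e + d \is a Num.int) -> trunc F -> laurent (mulX d F).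
Proof.
move=> Fd [N HN]; exists (Num.floor (N + d)) => e F0.
have [w Fw] : exists w, F (e - d) w <> 0.
  apply: contrapT => nw; apply: F0; apply/funext => w.
  by apply: contrapT => Fw; apply: nw; exists w.
split; first by have := Fd _ _ Fw; rewrite subrK.
apply: le_trans (floor_le _) _; rewrite -lerBrDr leNgt; apply/negP => lt.
by apply: Fw; apply: HN.
Qed.

Lemma R_regularizedE j1 k v (f : W -> C^o) : R_regularized YW z j1 k v f =
  UpW cR (j1%:~R / T%:R + k%:R) (dl E v f).
Proof. by rewrite /R_regularized addrC; apply: mul_x_plus_Up; rewrite chiR1. Qed.

Lemma frakD_inDR (g : W -> C^o) :
  g \in frakD_pred sigma1 sigma2 YW z <-> inD cR E H g.
Proof.
split=> [/asboolP[gl gD]|[gl gD]].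
  split=> // p q v [j1 [j2 [vj -> _]]]; have [k] := gD j1 j2 v vj.
  by rewrite /R_admissible R_regularizedE => /laurent_trunc vk; exists k.
apply/asboolP; split=> // j1 j2 v vj.
have vH : H (j1%:~R / T%:R) (j2%:~R / T%:R) v by exists j1, j2.
have [k vk] := gD _ _ v vH; exists k; rewrite /R_admissible R_regularizedE.
apply: trunc_laurent vk => e w.
move=> /(UpW_coset (fun e w => @dl_coset _ _ _ _ _ sysE _ _ v g e w gl vH)) => Hi.
rewrite (_ : e + _ = e + (j1%:~R / T%:R + j2%:~R / T%:R) - (j1%:~R / T%:R + k%:R) + k%:R).
  by rewrite rpredD // intr_nat.
ring.
Qed.

(** Transfer is used in both directions; on the way back the translation by - z undoes the first
    one. *)
Lemma frakD_inDL (g : W -> C^o) :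
  g \in frakD_pred sigma1 sigma2 YW z <-> inD cL E' H' g.
Proof.
have L1 : cL 1 = z by rewrite chiL1.
rewrite frakD_inDR; split=> gD.
  by have := inD_transfer cRL sysE gD; rewrite L1.
have cLR : cL 1 = - cR 1 by rewrite cRL opprK.
by have := inD_transfer cLR sysE' gD; rewrite cRL L1 (TEK z sysE).
Qed.

Definition selR (j1 j2 : int) : rat := j1%:~R / T%:R.
Definition selL (j1 j2 : int) : rat := j2%:~R / T%:R.

Lemma selRH j1 j2 v : in_bi j1 j2 v -> H (selR j1 j2) (selL j1 j2) v.
Proof. by move=> vj; exists j1, j2. Qed.

Lemma selLH j1 j2 v : in_bi j1 j2 v -> H' (selL j1 j2) (selR j1 j2) v.
Proof. by move=> vj; exists j1, j2. Qed.

Lemma div_int (j : int) : (T%:Z %| j)%Z -> exists n : int, j%:~R / T%:R = n%:~R :> rat.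
Proof.
move=> /dvdzP[n ->]; exists n; rewrite rmorphM /= mulfK //.
by rewrite pnatr_eq0 -lt0n.
Qed.

Lemma selRD j1 j2 k1 k2 : selR (j1 + k1) (j2 + k2) = selR j1 j2 + selR k1 k2.
Proof. by rewrite /selR intrD mulrDl. Qed.

Lemma selLD j1 j2 k1 k2 : selL (j1 + k1) (j2 + k2) = selL j1 j2 + selL k1 k2.
Proof. by rewrite /selL intrD mulrDl. Qed.

Lemma selRT j1 j2 : (T%:Z %| j1)%Z -> (T%:Z %| j2)%Z ->
  exists n : int, selR j1 j2 = n%:~R.
Proof. by move=> /div_int. Qed.

Lemma selLT j1 j2 : (T%:Z %| j1)%Z -> (T%:Z %| j2)%Z ->
  exists n : int, selL j1 j2 = n%:~R.
Proof. by move=> _ /div_int. Qed.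

Lemma E_linl e w : linear (fun v => E v e w).
Proof. exact: YW_linl. Qed.

Lemma E'_linl e w : linear (fun v => E' v e w).
Proof.
move=> x u v; rewrite /TE.
have := @Tr_lin _ _ z (fun e => E u e w) (fun e => E v e w) x 1 e
  (E_ub sysE u w) (E_ub sysE v w).
rewrite scale1r => <-; apply: eq_fsum => i; congr (_ *: _).
by rewrite scale1r; exact: E_linl.
Qed.

Lemma iter_ddx (g : rat -> W -> C^o) i e w :
  iter i (@ddx R W) g e w = ffall (ratr (e + i%:R)) i * g (e + i%:R) w.
Proof.
elim: i e => [|i IH] e; first by rewrite /ffall big_ord0 mul1r addr0.
rewrite iterS /ddx IH /ffall big_ord_recr /= mulrA.
have -> : e + 1 + i%:R = e + i.+1%:R by rewrite -natr1; ring.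
congr (_ * _); rewrite mulrC; congr (_ * _); rewrite -natr1; ring.
Qed.

Lemma exp_ddxE v (f : W -> C^o) : scalar f ->
  exp_ddx z (Ystar YW v f) = dl E' v f.
Proof.
move=> fl; apply: funext2 => e w; rewrite (dl_TE _ sysE) //.
apply: eq_fsum => i; rewrite iter_ddx /trk cbinE -[RHS]/(_ * _) /dl /Ystar.
set x := f _; set y := ffall _ _; set t := i`!%:R; ring.
Qed.

Lemma L_regularizedE j2 l v (f : W -> C^o) : scalar f ->
  L_regularized YW z j2 l v f = UpW cL (j2%:~R / T%:R + l%:R) (dl E' v f).
Proof.
move=> fl; rewrite /L_regularized addrC exp_ddxE //.
by apply: mul_x_plus_Up; rewrite chiL1.
Qed.

Local Notation YopR := (Yop cR E selR).
Local Notation YopL := (Yop cL E' selL).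

Let R0 := chiR0 z.
Let RD := chiRD z.
Let LL0 := chiL0 z.
Let LD := chiLD z.

(** [YR] is a choice among the maps satisfying [is_YR], so a witness must exist before anything can
    be said about it. *)
Lemma is_YR_YopR : is_YR YopR.
Proof.
split.
  exact: (Yop_linl R0 RD sysE E_linl frakD_inDR selRH).
move=> j1 j2 v f k vj ft a e w.
have fb := dl_ub sysE v (frakD_scalar f).
have vr := Yop_reg R0 RD sysE E_linl frakD_inDR selRH selRD selRT f vj.
have vt : trunc (UpW cR (j1%:~R / T%:R + k%:R) (dl E v f)).
  by apply: (@laurent_trunc (j2%:~R / T%:R)); rewrite -R_regularizedE.
have := congr1 (fun G => G e w) (reg_uniq R0 RD vr (reg_ex R0 RD fb vt)) => /= ->.
by rewrite R_regularizedE -(mul_plus_x_chiR z0 _ _ _ vt) /a addrC rmorphN.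
Qed.

Lemma is_YL_YopL : is_YL YopL.
Proof.
split.
  exact: (Yop_linl LL0 LD sysE' E'_linl frakD_inDL selLH).
move=> j1 j2 v f k vj ft a e w.
have fl := frakD_scalar f; have fb := dl_ub sysE' v fl.
have vr := Yop_reg LL0 LD sysE' E'_linl frakD_inDL selLH selLD selLT f vj.
have vt : trunc (UpW cL (j2%:~R / T%:R + k%:R) (dl E' v f)).
  by apply: (@laurent_trunc (j1%:~R / T%:R)); rewrite -L_regularizedE.
have := congr1 (fun G => G e w) (reg_uniq LL0 LD vr (reg_ex LL0 LD fb vt)) => /= ->.
by rewrite L_regularizedE // mul_plus_x_chiL // /a addrC.
Qed.

Lemma is_YR_YR : is_YR Rt.
Proof. exact: (xgetPex _ (ex_intro _ _ is_YR_YopR)). Qed.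

Lemma is_YL_YL : is_YL L.
Proof. exact: (xgetPex _ (ex_intro _ _ is_YL_YopL)). Qed.

Lemma YR_reg j1 j2 v f : in_bi j1 j2 v ->
  reg cR (selR j1 j2) (dl E v f) (fun e => Rt v e f).
Proof.
move=> vj; have [_ YRE] := is_YR_YR.
have fb := dl_ub sysE v (frakD_scalar f).
have [k vk] : exists k, R_admissible YW z j1 j2 k v f.
  by case: f {fb} => f /= /asboolP[_ /(_ _ _ _ vj)].
have vt : trunc (UpW cR (j1%:~R / T%:R + k%:R) (dl E v f)).
  by apply: (@laurent_trunc (j2%:~R / T%:R)); rewrite -R_regularizedE.
rewrite (_ : (fun e => _) = LoW cR (- (selR j1 j2 + k%:R)) (UpW cR (selR j1 j2 + k%:R) (dl E v f))).
  exact: reg_ex.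
apply: funext2 => e w; rewrite (YRE _ _ _ _ _ vj vk).
by rewrite R_regularizedE -(mul_plus_x_chiR z0 _ _ _ vt) addrC rmorphN.
Qed.

Lemma YL_reg j1 j2 v f : in_bi j1 j2 v ->
  reg cL (selL j1 j2) (dl E' v f) (fun e => L v e f).
Proof.
move=> vj; have [_ YLE] := is_YL_YL; have fl := frakD_scalar f.
have fb := dl_ub sysE' v fl.
have [_ fD] : inD cL E' H' f by apply/frakD_inDL; case: (f).
have [k vt] := fD _ _ _ (selLH vj).
have vk : L_admissible YW z j1 j2 k v f.
  rewrite /L_admissible L_regularizedE //; apply: trunc_laurent vt => e w.
  move=> /(UpW_coset (fun e w => @dl_coset _ _ _ _ _ sysE' _ _ v f e w fl (selLH vj))) => Hi.
  rewrite (_ : e + _ = e + (selL j1 j2 + selR j1 j2) - (selL j1 j2 + k%:R) + k%:R).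
    by rewrite rpredD // intr_nat.
  by rewrite /selR /selL; ring.
rewrite (_ : (fun e => _) = LoW cL (- (selL j1 j2 + k%:R)) (UpW cL (selL j1 j2 + k%:R) (dl E' v f))).
  exact: reg_ex.
apply: funext2 => e w; rewrite (YLE _ _ _ _ _ vj vk).
by rewrite L_regularizedE // mul_plus_x_chiL // addrC.
Qed.

Lemma YR_system : lower_system A Rt (homq selL).
Proof.
exact: (Y_lower_system R0 RD sysE E_linl frakD_inDR selRH
  selRD selRT (proj1 is_YR_YR) YR_reg).
Qed.

Lemma YL_system : lower_system A L (homq selR).
Proof.
exact: (Y_lower_system LL0 LD sysE' E'_linl frakD_inDL selLH
  selLD selLT (proj1 is_YL_YL) YL_reg).
Qed.

Lemma YL_YR_bigraded j1 j2 k1 k2 u v m n f : in_bi j1 j2 u -> in_bi k1 k2 v ->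
  L u m (Rt v n f) = Rt v n (L u m f).
Proof.
move=> uj vk; apply: frakD_inj => w.
have fD : inD cR E H f by apply/frakD_inDR; case: (f).
have E1 : cL 1 = z by rewrite chiL1.
pose h c b : W -> C^o := L u b (Rt v c f); pose h' b c : W -> C^o := Rt v c (L u b f).
have gu : reg cL (selL j1 j2) (dl (TE E (cL 1)) u f) (fun e => L u e f).
  by rewrite E1; exact: YL_reg.
have gh c : reg cL (selL j1 j2) (dl (TE E (cL 1)) u (Rt v c f)) (h c).
  by rewrite E1; exact: YL_reg.
have gh' b : reg cR (selR k1 k2) (dl E v (L u b f)) (h' b) by exact: YR_reg.
exact: (left_right_comm LL0 LD R0 RD sysE fD (selRH uj) (selRH vk) gu
  (YR_reg f vk) gh gh' m n w).
Qed.

Lemma YL_YR u v m n f : L u m (Rt v n f) = Rt v n (L u m f).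
Proof.
have lL e g := low_linl YL_system e g; have lR e g := low_linl YR_system e g.
have rL x e := low_linr YL_system x e; have rR x e := low_linr YR_system x e.
rewrite -(pr_sum u) -(pr_sum v).
rewrite !(linear_fun_sum (lL _ _)) (linear_fun_sum (rR _ _)).
apply: eq_bigr => i1 _; rewrite !(linear_fun_sum (lL _ _)) (linear_fun_sum (rR _ _)).
apply: eq_bigr => i2 _; rewrite !(linear_fun_sum (lR _ _)) (linear_fun_sum (rL _ _)).
apply: eq_bigr => i3 _; rewrite !(linear_fun_sum (lR _ _)) (linear_fun_sum (rL _ _)).
apply: eq_bigr => i4 _.
exact: YL_YR_bigraded (pr_bigraded _ _ _)
  (pr_bigraded _ _ _).
Qed.

Lemma vacuum_bigraded : in_bi 0 0 (vacuum A).
Proof. by split; rewrite /in_eigenspace va_aut_vacuum eT0 scale1r. Qed.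

(** A series concentrated in exponent 0 is bounded on both sides, hence it is its own
    regularization. *)
Lemma reg_vacuum (chi : rat -> C) (E0 : V -> rat -> W -> W) f :
  chi 0 = 1 -> (forall a b, chi (a + b) = chi a * chi b) ->
  (forall e w, E0 (vacuum A) e w = if e == 0 then w else 0) ->
  reg chi 0 (dl E0 (vacuum A) f) (fun e => if e == 0 then f else 0 : D).
Proof.
move=> chi0 chiD EV; have fl := frakD_scalar f.
have -> : dl E0 (vacuum A) f = fun e => frakD_val (if e == 0 then f else 0).
  apply: funext2 => e w; rewrite /dl EV.
  by case: eqP => // _; exact: functional0.
have gt : trunc (fun e => frakD_val (if e == 0 then f else 0)).
  by exists 0 => e w; case: eqP => // ->; rewrite ltxx.
split=> //; exists 0%N => k _; rewrite add0r; apply: UpW_LoW_nat => // w e.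
apply: (@fin_le _ _ (fun e => (if e == 0 then f else 0) w : C^o) (fun i => e + i%:R) (- e)).
by move=> i; case: eqP => [ei _|//]; lra.
Qed.

Lemma YR_vacuum e f : Rt (vacuum A) e f = if e == 0 then f else 0.
Proof.
apply: frakD_inj => w; have := YR_reg f vacuum_bigraded.
have := @reg_vacuum cR E f R0 RD (fun e w => rtw_vacuum YW e w).
rewrite /selR mul0r => /(reg_uniq R0 RD) h /h.
by move=> /(congr1 (fun G => G e w)) <-.
Qed.

Lemma YL_vacuum e f : L (vacuum A) e f = if e == 0 then f else 0.
Proof.
apply: frakD_inj => w; have := YL_reg f vacuum_bigraded.
have EV e' w' : E' (vacuum A) e' w' = if e' == 0 then w' else 0.
  rewrite /TE /Tr (@fsum1 _ _ 0%N).
    by rewrite /trk cbin0 expr0 mul1r scale1r addr0; exact: rtw_vacuum.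
  case=> // i _; rewrite /E rtw_vacuum; case: eqP => [ei|_]; last by rewrite scaler0.
  by rewrite /trk ei rmorph0 cbin0l mul0r scale0r.
have := @reg_vacuum cL E' f LL0 LD EV.
rewrite /selL mul0r => /(reg_uniq LL0 LD) h /h.
by move=> /(congr1 (fun G => G e w)) <-.
Qed.

End LeftRight.

(** * The twisted module structure over the tensor product *)

Variables (VV : lmodType R[i]) (AA : vertex_algebra VV).
Variables (tens : {bilinear V -> V -> VV}) (sigma12 : va_aut AA).
Hypothesis tensP : is_tensor_va A A AA tens.
Hypothesis sigma12E : forall u v, sigma12 (tens u v) = tens (sigma1 u) (sigma2 v).
Implicit Types (x y : VV) (b c e : rat).

Lemma bigraded_ind (P : V -> Prop) :
  (forall (a : C) u v, P u -> P v -> P (a *: u + v)) ->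
  (forall j1 j2 v, in_bi j1 j2 v -> P v) -> forall v, P v.
Proof.
move=> PD Pbi v; rewrite -(pr_sum v).
have P0 : P 0 by apply: (Pbi 0 0); split; rewrite /in_eigenspace linear0 scaler0.
have PDD u v' : P u -> P v' -> P (u + v') by move=> Pu Pv; rewrite -[u]scale1r; exact: PD.
apply: (big_ind P P0 PDD) => j1 _; apply: (big_ind P P0 PDD) => j2 _.
exact: Pbi (pr_bigraded j1 j2 v).
Qed.

Lemma homL_bi j1 j2 v : in_bi j1 j2 v -> homq selR (j1%:~R / T%:R) v.
Proof. by move=> vj; exists j1, j2. Qed.

Lemma homR_bi j1 j2 v : in_bi j1 j2 v -> homq selL (j2%:~R / T%:R) v.
Proof. by move=> vj; exists j1, j2. Qed.

(** Needed for arbitrary u and v, since the bilinear map to be factored through the tensor product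
    is given by these sums. *)
Lemma yt_fin_all u v e f : fin (fun m => L u m (Rt v (e - m) f)).
Proof.
elim/bigraded_ind: u => [a u u' uf uf'|j1 j2 u uj].
  have : fin (fun m => a *: L u m (Rt v (e - m) f) + L u' m (Rt v (e - m) f)).
    by apply: finD => //; exact: finZ.
  by apply: (fin_sub (h := id)) => // m; rewrite (low_linl YL_system).
elim/bigraded_ind: v => [a v v' vf vf'|k1 k2 v vk].
  have : fin (fun m => a *: L u m (Rt v (e - m) f) + L u m (Rt v' (e - m) f)).
    by apply: finD => //; exact: finZ.
  by apply: (fin_sub (h := id)) => // m; rewrite (low_linl YR_system) (low_linr YL_system).
exact: (yt_fin YL_system YR_system YL_YR f e (homL_bi uj) (homR_bi vk)).
Qed.

Local Notation yt := (yt L Rt).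

Lemma yt_linl e f v : linear (fun u => yt u v e f).
Proof.
move=> a u u'; have h u1 := yt_fin_all u1 v e f.
rewrite -fsumZ // -fsumD //; last exact: finZ.
by apply: eq_fsum => m; rewrite (low_linl YL_system).
Qed.

Lemma yt_linr e f u : linear (fun v => yt u v e f).
Proof.
move=> a v v'; have h v1 := yt_fin_all u v1 e f.
rewrite -fsumZ // -fsumD //; last exact: finZ.
by apply: eq_fsum => m; rewrite (low_linl YR_system) (low_linr YL_system).
Qed.

Lemma yt_linf u v e : linear (yt u v e).
Proof.
move=> a f f'; have h g := yt_fin_all u v e g.
rewrite -fsumZ // -fsumD //; last exact: finZ.
by apply: eq_fsum => m; rewrite (low_linr YR_system) (low_linr YL_system).
Qed.

Section Bilinear.
Variables (e : rat) (f : D).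

Definition yt_at u v : D := yt u v e f.

Lemma yt_at_bilinear : bilinear_for (GRing.Scale.Law.clone _ _ *:%R _)
  (GRing.Scale.Law.clone _ _ *:%R _) yt_at.
Proof. by split=> [v|u]; [exact: yt_linl|exact: yt_linr]. Qed.

HB.instance Definition _ := bilinear_isBilinear.Build C V V D _ _ yt_at yt_at_bilinear.

Definition yt_ext : {linear VV -> D} := sval (cid (tva_tensor tensP yt_at)).

Lemma yt_extE u v : yt_ext (tens u v) = yt u v e f.
Proof. by rewrite /yt_ext; case: cid => g [/= ->]. Qed.

End Bilinear.

Definition Yprod x e f : D := yt_ext e f x.

Lemma Yprod_tens u v e f : Yprod (tens u v) e f = yt u v e f.
Proof. exact: yt_extE. Qed.

Lemma Yprod_linl e f : linear (fun x => Yprod x e f).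
Proof. by move=> a x y; rewrite /Yprod linearP. Qed.

Lemma Yprod_linr x e : linear (Yprod x e).
Proof.
elim/(tensor_ind (tva_tensor tensP)): x => [a f g|a x y hx hy k f g|u v a f g].
- by rewrite /Yprod !linear0 addr0.
- by rewrite !Yprod_linl hx hy !scalerDr !scalerA mulrC -!addrA; congr (_ + _); rewrite addrCA.
by rewrite !Yprod_tens yt_linf.
Qed.

HB.instance Definition _ x e := GRing.isLinear.Build C D D *:%R (Yprod x e) (Yprod_linr x e).

Lemma bitensor_ind (P : VV -> Prop) :
  (forall (a : C) x y, P x -> P y -> P (a *: x + y)) ->
  (forall i1 i2 j1 j2 u v, in_bi i1 i2 u -> in_bi j1 j2 v -> P (tens u v)) ->
  forall x, P x.
Proof.
move=> PD Pbi; have Pt u v : P (tens u v).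
  elim/bigraded_ind: u => [a u u' uP uP'|j1 j2 u uj]; first by rewrite linearPl; apply: PD.
  elim/bigraded_ind: v => [a v v' vP vP'|k1 k2 v vk]; first by rewrite linearPr; apply: PD.
  exact: Pbi uj vk.
apply: (tensor_ind (tva_tensor tensP)) => //.
by have := Pt 0 0; rewrite linear0r.
Qed.

Lemma tens_eigen i1 i2 j1 j2 u v : in_bi i1 i2 u -> in_bi j1 j2 v ->
  in_eigenspace T sigma12 (i1 + j2) (tens u v).
Proof.
move=> [ui _] [_ vj].
by rewrite /in_eigenspace sigma12E ui vj linearZl linearZr /= scalerA -eTD.
Qed.

Lemma sigma12_period : iter T sigma12 =1 id.
Proof.
apply: (tensor_ind (tva_tensor tensP)) => [|a x y hx hy|u v].
- exact: (linear_fun0 (iter_linear sigma12 T)).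
- by rewrite (iter_linear sigma12 T) hx hy.
have E n : iter n sigma12 (tens u v) = tens (iter n sigma1 u) (iter n sigma2 v).
  by elim: n => //= n ->.
by rewrite E per1 per2.
Qed.

Lemma eigenproj_scale i j x : in_eigenspace T sigma12 i x ->
  exists a : C, eigenproj T sigma12 j x = a *: x.
Proof.
move=> xi; exists (T%:R^-1 * \sum_(a < T) eT R T (- (a%:Z * j)) * eT R T i ^+ a).
rewrite /eigenproj -scalerA scaler_suml; congr (_ *: _); apply: eq_bigr => a _.
rewrite -scalerA; congr (_ *: _); elim: (nat_of_ord a) => [|n IH]; first by rewrite scale1r.
by rewrite iterS IH linearZ /= xi scalerA exprSr.
Qed.

(** The tensors in a decomposition of x need not lie in the eigenspace. Applying the eigenprojection
    rescales homogeneous tensors and kills those of another degree, while x is the sum of its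
    projections of degree congruent to j. *)
Lemma eigen_ind (P : VV -> Prop) j :
  (forall (a : C) x y, P x -> P y -> P (a *: x + y)) ->
  (forall i1 i2 j1 j2 u v, in_bi i1 i2 u -> in_bi j1 j2 v ->
     (T%:Z %| i1 + j2 - j)%Z -> P (tens u v)) ->
  forall x, in_eigenspace T sigma12 j x -> P x.
Proof.
move=> PD Pbi x xj.
have in_bi0 i : in_bi i 0 0 by split; rewrite /in_eigenspace linear0 scaler0.
have P0 : P 0.
  rewrite -(linear0r tens 0); apply: (Pbi j 0 0 0 0 0) => //.
  by rewrite addr0 subrr.
have PDD y y' : P y -> P y' -> P (y + y').
  by move=> Py Py'; rewrite -[y]scale1r; exact: PD.
have per y := eigenproj_eigen T0 _ (sigma12_period y).
have Pproj i y : (T%:Z %| i - j)%Z -> P (eigenproj T sigma12 i y).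
  move=> ij; elim/bitensor_ind: y => [a y y' hy hy'|i1 i2 j1 j2 u v ui vj].
    by rewrite eigenproj_linear; exact: PD.
  have [->//|y0] := eqVneq (eigenproj T sigma12 i (tens u v)) 0.
  have tij := tens_eigen ui vj; have [a Ea] := eigenproj_scale i tij.
  have d := @eigen_eq _ T T0 _ sigma12 (i1 + j2) i (eigenproj T sigma12 i (tens u v)).
  rewrite Ea -[a *: _]addr0; apply: PD => //; apply: Pbi ui vj _.
  have -> : i1 + j2 - j = (i1 + j2 - i) + (i - j) by rewrite addrA subrK.
  apply: rpredD => //; apply: d => //.
  by rewrite Ea linearZ /= tij scalerA mulrC -scalerA.
rewrite -(eigenproj_sum T0 sigma12 x).
apply: (big_ind P P0 PDD) => i _.
have [->//|y0] := eqVneq (eigenproj T sigma12 i x) 0.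
apply: Pproj; apply: (eigen_eq T0 (per _ _) _ y0).
rewrite (@eigenproj_comm _ _ _ sigma12 sigma12) // xj.
exact: (linear_funZ (eigenproj_linear _ _ _)).
Qed.

Lemma Yprod_trunc x f : exists N : rat, forall e, Yprod x e f <> 0 -> N <= e.
Proof.
elim/bitensor_ind: x => [a x y [N HN] [M HM]|i1 i2 j1 j2 u v ui vj].
  exists (Num.min N M) => e; rewrite Yprod_linl => Y0.
  have [x0|/HN Ne] := pselect (Yprod x e f = 0); last by rewrite ge_min Ne.
  have [y0|/HM Me] := pselect (Yprod y e f = 0); last by rewrite ge_min Me orbT.
  by case: Y0; rewrite x0 y0 scaler0 addr0.
have [N HN] := yt_trunc YL_system YR_system YL_YR f (homL_bi ui) (homR_bi vj).
by exists N => e; rewrite Yprod_tens => /HN[].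
Qed.

Lemma dvd_int (i j : int) : (T%:Z %| i - j)%Z -> i%:~R / T%:R - j%:~R / T%:R \is a @Num.int rat.
Proof.
move=> /(div_int)[n En]; rewrite -mulrBl -intrB En; exact: intr_int.
Qed.

Lemma Yprod_coset j x e f : in_eigenspace T sigma12 j x -> Yprod x e f <> 0 ->
  e + j%:~R / T%:R \is a Num.int.
Proof.
move=> xj Y0; apply: contrapT => ej; apply: Y0; move: x xj.
apply: eigen_ind => [a x y hx hy|i1 i2 j1 j2 u v ui vj d].
  by rewrite Yprod_linl hx hy scaler0 addr0.
rewrite Yprod_tens; apply: contrapT => Y0; apply: ej.
have [N /(_ _ Y0)[eint _]] := yt_trunc YL_system YR_system YL_YR f (homL_bi ui) (homR_bi vj).
have d' := dvd_int d.
rewrite (_ : e + _ = e + (i1%:~R / T%:R + j2%:~R / T%:R) - ((i1 + j2)%:~R / T%:R - j%:~R / T%:R)).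
  exact: rpredB.
by rewrite intrD mulrDl; ring.
Qed.

Lemma Yprod_support x e f : T%:R * e \isn't a Num.int -> Yprod x e f = 0.
Proof.
move=> Te; elim/bitensor_ind: x => [a x y hx hy|i1 i2 j1 j2 u v ui vj].
  by rewrite Yprod_linl hx hy scaler0 addr0.
apply: contrapT => /(Yprod_coset (tens_eigen ui vj)) ej; case/negP: Te.
have TT : T%:R != 0 :> rat by rewrite pnatr_eq0 -lt0n.
rewrite (_ : T%:R * e = T%:R * (e + (i1 + j2)%:~R / T%:R) - (i1 + j2)%:~R).
  apply: rpredB; last exact: intr_int.
  apply: rpredM => //; exact: intr_nat.
by field.
Qed.

Lemma Yprod_vacuum e f : Yprod (vacuum AA) e f = if e == 0 then f else 0.
Proof.
rewrite (tva_vacuum tensP) Yprod_tens.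
have LV := YL_vacuum.
have RV := YR_vacuum.
rewrite /yt (@fsum1 _ _ 0); first by rewrite LV eqxx subr0 RV.
by move=> m /eqP/negbTE m0; rewrite LV m0.
Qed.

Lemma Yprod_truncation j x f : in_eigenspace T sigma12 j x ->
  laurent (mulX (j%:~R / T%:R) (fun e => Yprod x e f)).
Proof.
move=> xj; have [N HN] := Yprod_trunc x f.
exists (Num.floor (N + j%:~R / T%:R)) => e Y0; have /= eint := Yprod_coset xj Y0.
rewrite subrK in eint; split=> //; have := HN _ Y0; have := floor_le (N + j%:~R / T%:R).
by move=> *; lra.
Qed.

Lemma Yprod_fin (h : nat -> rat) x y f c : 
  fin (fun i : nat => Yprod x (h i) (Yprod y (c - i%:R) f)).
Proof.
have [N HN] := Yprod_trunc y f; have [s Hs] := nat_le_seq (c - N).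
apply: finN0; exists s => i Y0; apply: Hs.
have /HN : Yprod y (c - i%:R) f <> 0.
  by move=> y0; apply: Y0; rewrite y0; exact: (linear_fun0 (Yprod_linr x (h i))).
by move=> *; lra.
Qed.

Lemma Yprod_Y_fin x y n f (h : nat -> rat) :
  fin (fun i : nat => Yprod (AA x (n - i%:Z) y) (h i) f).
Proof.
have [N HN] := va_truncation AA x y; apply: (@fin_nat _ _ (absz (n - N)).+1) => i ni.
by rewrite HN ?(linear_fun0 (Yprod_linl _ _)) //; lia.
Qed.

Lemma Yprod_Borcherds_tens i1 i2 j1 j2 k1 k2 l1 l2 u1 v1 u2 v2 f n b c :
  in_bi i1 i2 u1 -> in_bi j1 j2 v1 -> in_bi k1 k2 u2 -> in_bi l1 l2 v2 ->
  Borcherds (- ((i1 + j2)%:~R / T%:R))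
    (fun b c => Yprod (tens u1 v1) b (Yprod (tens u2 v2) c f))
    (fun b c => Yprod (tens u2 v2) c (Yprod (tens u1 v1) b f))
    (fun n e => Yprod (AA (tens u1 v1) n (tens u2 v2)) e f) n b c.
Proof.
move=> u1i v1i u2i v2i.
have [m1 [m2 [A1 A2 H]]] :=
  yt_comm YL_system YR_system YL_YR (homL_bi u1i) (homL_bi u2i) (homR_bi v1i) (homR_bi v2i).
have tensfin k : fin (fun j => tens (A u1 j u2) (A v1 (k - j) v2)).
  apply: finN0; exists [seq s%:Z - m1%:Z | s <- iota 0 (absz (k + (m1 + m2)%:Z)).+1] => j t0.
  have j1' : - m1%:Z <= j.
    by rewrite leNgt; apply/negP => /A1 A0; apply: t0; rewrite A0 linear0l.
  have j2' : - m2%:Z <= k - j.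
    by rewrite leNgt; apply/negP => /A2 A0; apply: t0; rewrite A0 linear0r.
  apply/mapP; exists (absz (j + m1%:Z)); last by lia.
  by rewrite mem_iota; lia.
have F3E k e : Yprod (AA (tens u1 v1) k (tens u2 v2)) e f =
    fsum (fun j => yt (A u1 j u2) (A v1 (k - j) v2) e f).
  rewrite (tva_Y tensP) (linear_fun_fsum (Yprod_linl e f) (tensfin k)).
  by apply: eq_fsum => j; rewrite Yprod_tens.
have [E low DtE] := H f.
pose Z := iter (m1 + m2) (Dl 0) (fun b c => yt u1 v1 b (yt u2 v2 c f)).
have ZE : iter (m1 + m2) (Dl 0)
    (fun b c => Yprod (tens u1 v1) b (Yprod (tens u2 v2) c f)) = Z.
  by congr iter; apply: funext2 => b' c'; rewrite !Yprod_tens.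
apply: (@Dt_Borcherds _ _ _ (m1 + m2)); rewrite ?ZE.
- by move=> b' c'; exact: Yprod_fin.
- by move=> b' c'; exact: Yprod_fin.
- move=> b' c' bg; apply: contrapT => /(Yprod_coset (tens_eigen u1i v1i)).
  by move: bg; rewrite opprK => /negP.
- move=> k km e; rewrite F3E; apply: fsum0 => j.
  have [/A1 ->|j1'] := ltP j (- m1%:Z); first exact: (linear_fun0 (yt_linl _ _ _)).
  by rewrite A2; [exact: (linear_fun0 (yt_linr _ _ _))|lia].
- exact: lower_fin low.
- rewrite -[RHS]E; congr iter; apply: funext2 => b' c'.
  by rewrite !Yprod_tens.
(* With total index t - m1 - m2, both factors can be nonzero only for j = s - m1 with 0 <= s <= t;
   these are the terms of the convolution in [yt_comm]. *)
move=> t e; rewrite DtE F3E (@fsum_seq _ _ [seq s%:Z - m1%:Z | s <- iota 0 t.+1]).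
- rewrite big_map -[t.+1 in LHS]subn0 -/(index_iota 0 t.+1) big_mkord.
  apply: eq_bigr => s _; congr (yt (A u1 _ u2) (A v1 _ v2) e f).
  by have := ltn_ord s; lia.
- by rewrite map_inj_uniq ?iota_uniq // => s s'; lia.
move=> j js.
have [/A1 ->|j1'] := ltP j (- m1%:Z); first exact: (linear_fun0 (yt_linl _ _ _)).
rewrite A2; first exact: (linear_fun0 (yt_linr _ _ _)).
rewrite ltNge; apply/negP => j2'; case/negP: js; apply/mapP.
by exists (absz (j + m1%:Z)); [rewrite mem_iota; lia|lia].
Qed.

Lemma Yprod_Borcherds j x y f n b c : in_eigenspace T sigma12 j x ->
  Borcherds (- (j%:~R / T%:R)) (fun b c => Yprod x b (Yprod y c f))
    (fun b c => Yprod y c (Yprod x b f)) (fun n e => Yprod (AA x n y) e f) n b c.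
Proof.
move: x; apply: eigen_ind => [a x x'|i1 i2 j1 j2 u1 v1 ui vj d].
  apply: (@Borcherds_linear _ _ _ _ (fun x b c => Yprod x b (Yprod y c f))
    (fun x b c => Yprod y c (Yprod x b f)) (fun x n e => Yprod (AA x n y) e f)).
  - by move=> b' c'; exact: Yprod_linl.
  - by move=> b' c' k x1 x2; rewrite Yprod_linl Yprod_linr.
  - by move=> k e k' x1 x2; rewrite va_linear Yprod_linl.
  - by move=> x1; exact: (Yprod_fin (fun i => b - (n%:~R - i%:R))).
  - by move=> x1; exact: (Yprod_fin (fun i => c - (n%:~R - i%:R))).
  by move=> x1; exact: Yprod_Y_fin.
elim/bitensor_ind: y => [a y y'|k1 k2 l1 l2 u2 v2 uk vl].
  apply: (@Borcherds_linear _ _ _ _ (fun y b c => Yprod (tens u1 v1) b (Yprod y c f))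
    (fun y b c => Yprod y c (Yprod (tens u1 v1) b f))
    (fun y n e => Yprod (AA (tens u1 v1) n y) e f)).
  - by move=> b' c' k x1 x2; rewrite Yprod_linl Yprod_linr.
  - by move=> b' c'; exact: Yprod_linl.
  - by move=> k e k' x1 x2; rewrite linearP Yprod_linl.
  - by move=> x1; exact: (Yprod_fin (fun i => b - (n%:~R - i%:R))).
  - by move=> x1; exact: (Yprod_fin (fun i => c - (n%:~R - i%:R))).
  by move=> x1; exact: Yprod_Y_fin.
have := Yprod_Borcherds_tens f n b c ui vj uk vl; rewrite /Borcherds => ->.
(* The degrees i1 + j2 and j differ by a multiple of T, so they define the same coset. *)
suff -> : (b - - ((i1 + j2)%:~R / T%:R) \is a Num.int) =
          (b - - (j%:~R / T%:R) \is a Num.int) by [].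
have d' := dvd_int d.
have -> : b - - ((i1 + j2)%:~R / T%:R) =
  b - - (j%:~R / T%:R) + ((i1 + j2)%:~R / T%:R - j%:~R / T%:R) by ring.
exact: rpredDr.
Qed.

Definition Yreg : twisted_module sigma12 T D :=
  @TwistedModule R VV AA sigma12 T D (fun x e => Yprod x e : {linear D -> D})
    sigma12_period Yprod_linl Yprod_support Yprod_vacuum Yprod_truncation
    (fun j x y f n b c => @Yprod_Borcherds j x y f n b c).

End RegularOperators.

Theorem theorem3p12 (R : realType) (V : lmodType R[i]) (A : vertex_algebra V)
    (T : nat) (sigma sigma1 sigma2 : va_aut A)
    (W : lmodType R[i]) (YW : right_twisted_module sigma T W) (z : R[i])
    (VV : lmodType R[i]) (AA : vertex_algebra VV)
    (tens : {bilinear V -> V -> VV}) (sigma12 : va_aut AA) :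
  (0 < T)%N ->
  sigma1 \o sigma2 =1 sigma2 \o sigma1 ->
  cancel (sigma1 \o sigma2) sigma ->
  iter T sigma1 =1 id -> iter T sigma2 =1 id ->
  z != 0 ->
  is_tensor_va A A AA tens ->
  (forall u v, sigma12 (tens u v) = tens (sigma1 u) (sigma2 v)) ->
  let D := frakD sigma1 sigma2 YW z in
  let L : V -> rat -> D -> D := @YL R V A T sigma sigma1 sigma2 W YW z in
  let Rt : V -> rat -> D -> D := @YR R V A T sigma sigma1 sigma2 W YW z in
  (forall (u v : V) (m n : rat) (f : D),
     L u m (Rt v n f) = Rt v n (L u m f)) /\
  exists Yreg : twisted_module sigma12 T D,
    forall (u v : V) (e : rat) (f : D),
      finite_set [set m | L u m (Rt v (e - m) f) != 0] /\
      Yreg (tens u v) e f = \sum_(m \in [set: rat]) L u m (Rt v (e - m) f).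
Proof.
move=> T0 sigmaC sigmaK per1 per2 z0 tensP sigma12E D L Rt; split.
  exact: YL_YR.
exists (Yreg YW T0 sigmaC per1 per2 sigmaK z0 tensP sigma12E) => u v e f; split.
  have := fin_finite (yt_fin_all T0 sigmaC per1 per2 sigmaK z0 u v e f).
  by congr finite_set; apply/seteqP; split=> m /= /eqP.
exact: Yprod_tens.
Qed.
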